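(* Let $d\geqslant2$ and let $\alpha$ be a mixing Noetherian entropy rank one $\mathbb{Z}^d$-action by continuous automorphisms of a compact metrizable abelian zero-dimensional group $X$. Then there is a set $Q$ of rational primes having positive (relative natural) density in the set of all rational primes such that $\{\mathsf{F}_\alpha(\Lambda):\Lambda\in\mathcal{L}_d,\ [\Lambda]\in Q\}$ is a finite set. When $d\geqslant3$, such a set $Q$ may be found with density $1$ in the set of rational primes.
   Context: $\mathcal{L}_d$ is the set of finite-index subgroups of $\mathbb{Z}^d$; $[\Lambda]=|\mathbb{Z}^d/\Lambda|$; $\mathsf{F}_\alpha(\Lambda)$ is the number of $x\in X$ fixed by $\alpha^{\mathbf{n}}$ for all $\mathbf{n}\in\Lambda$. Let $R_d=\mathbb{Z}[u_1^{\pm1},\dots,u_d^{\pm1}]$. The Pontryagin dual $M=\widehat{X}$ is an $R_d$-module, where multiplication by $u^{\mathbf{n}}=u_1^{n_1}\cdots u_d^{n_d}$ is the dual automorphism $\widehat{\alpha^{\mathbf{n}}}$; the action is Noetherian if $M$ is a Noetherian $R_d$-module. Entropy rank one means every $\alpha^{\mathbf{n}}$ has finite topological entropy. Mixing is with respect to Haar measure. *)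

(* Defs.v *)
From HB Require Import structures.
From mathcomp Require Import all_boot all_order all_algebra.
From mathcomp Require Import all_classical all_reals all_analysis.
Set Implicit Arguments. Unset Strict Implicit. Unset Printing Implicit Defensive.
Import Order.TTheory GRing.Theory Num.Theory numFieldNormedType.Exports.
Local Open Scope classical_set_scope.
Local Open Scope ring_scope.

Section Defs.
Variable R : realType.

Definition zvec (d : nat) := 'rV[int]_d.

Definition subgroupZ d (L : set (zvec d)) : Prop :=
  L 0 /\ forall u v, L u -> L v -> L (u - v).

Definition has_index d (L : set (zvec d)) (k : nat) : Prop :=
  exists s : seq (zvec d),
    [/\ size s = k,
        (forall v, exists2 r, r \in s & L (v - r)) &
        (forall i j, (i < k)%N -> (j < k)%N -> L (nth 0 s i - nth 0 s j) -> i = j)].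

Definition is_Zd_action d (X : topologicalZmodType) (alpha : zvec d -> X -> X) : Prop :=
  [/\ (forall x, alpha 0 x = x),
      (forall m n x, alpha (m + n) x = alpha m (alpha n x)),
      (forall n, continuous (alpha n)) &
      (forall n x y, alpha n (x + y) = alpha n x + alpha n y)].

Definition metrizable (X : topologicalType) : Prop :=
  exists dist : X -> X -> R,
    [/\ (forall x y, 0 <= dist x y),
        (forall x y, dist x y = 0 <-> x = y),
        (forall x y, dist x y = dist y x),
        (forall x y z, dist x z <= dist x y + dist y z) &
        (forall A : set X, open A <->
           (forall x, A x -> exists2 e : R, 0 < e & [set y | dist x y < e] `<=` A))].

Definition borelX (X : topologicalZmodType) := g_sigma_algebraType (@open X).

Definition haar_prob (X : topologicalZmodType) (mu : set X -> \bar R) : Prop :=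
  [/\
      (mu set0 = 0%E),
      (forall A, <<s @open X >> A -> (0 <= mu A)%E),
      (forall F : nat -> set X, (forall k, <<s @open X >> (F k)) ->
         trivIset setT F -> (fun n => \sum_(k < n) mu (F k))%E @ \oo --> mu (\bigcup_k F k)),
      mu setT = 1%E &
      (forall A x, <<s @open X >> A -> mu [set x + a | a in A] = mu A)].

Definition mixing d (X : topologicalZmodType) (alpha : zvec d -> X -> X)
  (mu : set X -> \bar R) : Prop :=
  forall A B, <<s @open X >> A -> <<s @open X >> B ->
  forall eps : R, 0 < eps -> exists K : nat, forall n : zvec d,
    (exists i, (K < absz (n ord0 i))%N) ->
    `| fine (mu (alpha n @^-1` A `&` B)) - fine (mu A) * fine (mu B) | < eps.

(* the circle group T, realised as unit vectors of R*R with complex product *)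
Definition cmul (a b : R * R) : R * R :=
  (a.1 * b.1 - a.2 * b.2, a.1 * b.2 + a.2 * b.1).

Definition is_character (X : topologicalZmodType) (chi : X -> R * R) : Prop :=
  [/\ continuous (chi : X -> (R^o * R^o)%type),
      (forall x, (chi x).1 ^+ 2 + (chi x).2 ^+ 2 = 1) &
      (forall x y, chi (x + y) = cmul (chi x) (chi y))].

(* R_d-submodules of M = dual of X, where u^n acts as chi |-> chi o alpha^n *)
Definition dual_submodule d (X : topologicalZmodType) (alpha : zvec d -> X -> X)
  (S : set (X -> R * R)) : Prop :=
  [/\ (forall chi, S chi -> is_character chi),
      S (fun _ => (1, 0)),
      (forall chi psi, S chi -> S psi -> S (fun x => cmul (chi x) (psi x))),
      (forall chi, S chi -> S (fun x => ((chi x).1, - (chi x).2))) &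
      (forall chi n, S chi -> S (fun x => chi (alpha n x)))].

Definition noetherian_action d (X : topologicalZmodType) (alpha : zvec d -> X -> X) : Prop :=
  forall S : nat -> set (X -> R * R),
    (forall k, dual_submodule alpha (S k)) ->
    (forall k, S k `<=` S k.+1) ->
    exists k0, forall k, (k0 <= k)%N -> S k = S k0.

Definition open_cover (X : topologicalType) (U : seq (set X)) : Prop :=
  (forall i, (i < size U)%N -> open (nth set0 U i)) /\
  (forall x, exists2 i, (i < size U)%N & nth set0 U i x).

Fixpoint join_iter (X : Type) (T : X -> X) (U : seq (set X)) (n : nat) : seq (set X) :=
  match n with
  | 0 => [:: setT]
  | n'.+1 => [seq A `&` (iter n' T @^-1` B) | A <- join_iter T U n', B <- U]
  end.

Definition subcover_of_size (X : Type) (V : seq (set X)) (k : nat) : Prop :=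
  exists s : seq nat, [/\ size s = k, all (fun i => i < size V)%N s &
                          forall x, exists2 i, i \in s & nth set0 V i x].

Definition mincov (X : Type) (V : seq (set X)) : nat :=
  xget 0%N [set k | subcover_of_size V k /\ forall j, subcover_of_size V j -> (k <= j)%N].

Definition cover_entropy (X : topologicalType) (T : X -> X) (U : seq (set X)) : \bar R :=
  limn_esup (fun n => ((ln (mincov (join_iter T U n.+1))%:R) / n.+1%:R)%:E).

Definition top_entropy (X : topologicalType) (T : X -> X) : \bar R :=
  ereal_sup [set cover_entropy T U | U in [set U | open_cover U]].

Definition entropy_rank_one d (X : topologicalZmodType) (alpha : zvec d -> X -> X) : Prop :=
  forall n, (top_entropy (alpha n) < +oo)%E.

End Defs.

Definition count_set (X : Type) (S : set X) : option nat :=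
  if `[< finite_set S >] then Some (xget 0%N [set n | (S #= `I_n)%card]) else None.

Definition Fix_count d (X : Type) (alpha : zvec d -> X -> X) (L : set (zvec d)) : option nat :=
  count_set [set x | forall n, L n -> alpha n x = x].

Definition prime_count (Q : set nat) (N : nat) : nat :=
  \sum_(p < N.+1 | prime p && `[< Q p >]) 1.

Definition has_rel_density (R : realType) (Q : set nat) (delta : R) : Prop :=
  (fun N => (prime_count Q N)%:R / (prime_count setT N)%:R : R) @ \oo --> delta.

(* Main.v *)
(** Idea of the proof. Let A = alpha^(e_1). For an open subgroup U the indices of the windows
{x | A^a x in U for a < k} grow at an exponential rate which is an integer, and finite entropy bounds
these rates; fix U of maximal rate. Mixing says that alpha^n - 1 is onto for n <> 0 (otherwise its
image lies in a proper open subgroup whose cosets alpha^n preserves). Maximality of U and the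
surjectivity of A^j - 1 make two-dimensional windows for A and B = alpha^(+-e_2) grow like
c^(k + l), with c independent of the open subgroup, while a group E of points fixed by T = A^i B^j
forces growth |E|^k of the T-windows, because T - 1 is onto. Hence alpha^n has at most c^(i + j) fixed
points. The same growth argument bounds the primes p for which X has p-torsion.

Let L have prime index q. By the pigeonhole principle L contains a nonzero i e_1 +- j e_2 with
i, j <= sqrt q, so there are at most c^(2 sqrt q) points fixed by L. If Z^d / L, of order q, acts
nontrivially on them, it does so on the p-torsion for one of finitely many primes p, and counting orbits
gives q | p^k - 1 with p^k <= c^(2 sqrt q): the order of p modulo q is O(sqrt q). For all other q
the points fixed by L are those fixed by Z^d.

Primes q for which a has order k = O(sqrt q) have density zero (Erdos). If k <= sqrt N / H then q divides
one of few numbers a^k - 1. Otherwise q - 1 = k m with k and m of size about sqrt N; with S the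
sum of 1/l over the odd primes l <= y, such a product usually has about 2 S prime factors up to y, whereas
q - 1 usually has about S. Upper bounds for both exceptional sets follow from the Brun-Titchmarsh
inequality in residue classes modulo P and k P, where P is the product of these l, with y fixed as
N grows. This yields density one already for d = 2. *)

(* The bound for fixed points must not depend on the open subgroup that separates them, since
   nothing controls how small it is. This is why a maximal growth rate is needed. It exists because
   consecutive window indices are nonincreasing integers; for V inside the maximal U the windows of
   V have bounded index in those of U, so V enters only through factors that k-th roots remove.

   The square root is the critical size of the orders. The numbers a^k - 1 with k <= K have O(K^2)
   binary digits altogether, hence O(K^2 / log N) prime factors above sqrt N, against about N / log
   N primes up to N: K = sqrt N / H leaves a proportion O(1 / H^2). Orders from sqrt N / H to C sqrt
   N need the second argument. There the sieve loses constants and a factor H, so exponential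
   moments are used, (3/2)^omega for q - 1 and 2^(-omega) for k m; they make both exceptional
   proportions arbitrarily small once S is large. The threshold is 4 S / 3, between S and 2 S. *)
Require Import Defs.
From HB Require Import structures.
From mathcomp Require Import all_boot all_order all_algebra.
From mathcomp Require Import cyclic zify ring lra.
From mathcomp Require Import all_classical all_reals all_analysis.
Import Order.TTheory GRing.Theory Num.Theory numFieldNormedType.Exports.
Set Implicit Arguments. Unset Strict Implicit. Unset Printing Implicit Defensive.
Local Open Scope classical_set_scope.
Local Open Scope ring_scope.

(** * Sums over residue classes *)

(** Multiplication by a unit followed by a translation permutes the residues modulo [l]. *)
Lemma sum_affine_mod (V : nmodType) (l a r : nat) (h : nat -> V) :
  coprime a l -> (forall m, h (m %% l)%N = h m) ->
  \sum_(i < l) h (a * i + r)%N = \sum_(i < l) h i.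
Proof.
case: l => [|l] cal per; first by rewrite !big_ord0.
pose g (i : 'I_l.+1) : 'I_l.+1 := inord ((a * i + r) %% l.+1).
have gE i : g i = ((a * i + r) %% l.+1)%N :> nat by rewrite inordK // ltn_mod.
have ginj : injective g.
  move=> i j /(congr1 val) /=; rewrite !gE => /eqP.
  rewrite eqn_modDr => e; apply: val_inj => /=.
  wlog: i j e / (i <= j)%N => [hw|leij].
    by case: (leqP i j) => [|/ltnW] leH; [apply: hw|apply/esym/hw; rewrite // eq_sym].
  move: e; rewrite eq_sym eqn_mod_dvd ?leq_mul2l ?leij ?orbT // -mulnBr.
  rewrite Gauss_dvdr 1?coprime_sym // => /dvdn_leq; have := ltn_ord j; lia.
rewrite [RHS](reindex_inj ginj) /=; apply: eq_bigr => i _.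
by rewrite gE per.
Qed.

Lemma sum_ord_mul (V : nmodType) (a b : nat) (h : nat -> V) :
  \sum_(m < a * b) h m = \sum_(i < a) \sum_(r < b) h (i * b + r)%N.
Proof.
elim: a => [|a IH]; first by rewrite mul0n !big_ord0.
rewrite mulSnr -(big_mkord xpredT h) (@big_cat_nat _ _ _ (a * b)) ?leq_addr //=.
rewrite big_mkord IH big_ord_recr /=; congr (_ + _).
rewrite -{1}[(a * b)%N]add0n big_addn addKn big_mkord.
by apply: eq_bigr => i _; rewrite addnC.
Qed.

Lemma sum_ltn_le X D : (\sum_(m < X) (m < D) <= D)%N.
Proof.
have [XD|DX] := leqP X D.
  rewrite (leq_trans _ XD) // -[leqRHS]card_ord -sum1_card; apply: leq_sum => d _; exact: leq_b1.
rewrite -(big_mkord xpredT (fun d => (d < D)%N : nat)) (@big_cat_nat _ _ _ D) //=; last exact: ltnW.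
have -> : (\sum_(D <= m < X) (m < D)%N = 0)%N.
  by rewrite big_nat big1 // => m /andP[Dm _]; rewrite ltnNge Dm.
rewrite addn0 big_mkord -[leqRHS]card_ord -sum1_card; apply: leq_sum => d _; exact: leq_b1.
Qed.

Lemma sqrtn_ex n : exists s, (s ^ 2 <= n < s.+1 ^ 2)%N.
Proof.
have ex : exists s, (s ^ 2 <= n)%N by exists 0%N.
have ub s : (s ^ 2 <= n)%N -> (s <= n)%N.
  by apply: leq_trans; rewrite expnS expn1; case: s => // s; rewrite leq_pmulr.
case: (ex_maxnP ex ub) => s sn smax; exists s; rewrite sn ltnNge /=.
by apply/negP => /smax; rewrite ltnn.
Qed.

Lemma coprime_lt_prime p i : prime p -> (0 < i < p)%N -> coprime i p.
Proof.
move=> pp /andP[i0 ip]; rewrite coprime_sym prime_coprime //.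
by apply/negP => /dvdn_leq; rewrite i0 leqNgt ip => /(_ isT).
Qed.

Section F.
Variable F : realFieldType.
Implicit Types (f g h : nat -> F).

(** For m = i a + r the factor [g] sees only r, and for fixed r the numbers i a + r run through all
    residues modulo [b]. *)
Lemma sum_crt2 (a b : nat) g h : coprime a b ->
  (forall m, g (m %% a)%N = g m) -> (forall m, h (m %% b)%N = h m) ->
  \sum_(m < a * b) g m * h m = (\sum_(m < a) g m) * (\sum_(m < b) h m).
Proof.
move=> cab pg ph; rewrite mulnC (sum_ord_mul _ _ (fun m => g m * h m)) exchange_big /= mulr_suml.
apply: eq_bigr => r _; under eq_bigr => i _ do rewrite -pg modnMDl modn_small //.
rewrite -mulr_sumr; congr (_ * _).
rewrite -[RHS](@sum_affine_mod _ b a r) //; apply: eq_bigr => i _; by rewrite mulnC.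
Qed.

Lemma coprime_prime_prod (l : nat) (ls : seq nat) :
  prime l -> all prime ls -> l \notin ls -> coprime l (\prod_(i <- ls) i).
Proof.
move=> pl; elim: ls => [|k ls IH] /=; first by rewrite big_nil coprimen1.
case/andP=> pk pls; rewrite inE negb_or => /andP[nlk nls].
by rewrite big_cons coprimeMr IH // andbT prime_coprime // dvdn_prime2.
Qed.

Lemma sum_crt (ls : seq nat) (f : nat -> nat -> F) :
  all prime ls -> uniq ls -> (forall l m, l \in ls -> f l (m %% l)%N = f l m) ->
  \sum_(m < \prod_(l <- ls) l) \prod_(l <- ls) f l m = \prod_(l <- ls) \sum_(m < l) f l m.
Proof.
elim: ls => [|l ls IH] /=; first by rewrite !big_nil big_ord1 big_nil.
case/andP=> pl pls /andP[nl ul] per.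
rewrite !big_cons -IH //; last by move=> k m kl; apply: per; rewrite inE kl orbT.
under eq_bigr => m _ do rewrite big_cons.
rewrite (@sum_crt2 _ _ (f l) (fun m => \prod_(j <- ls) f j m)) //.
- exact: coprime_prime_prod.
- by move=> m; apply: per; rewrite inE eqxx.
move=> m; apply: eq_big_seq => k kl; rewrite -[LHS]per ?inE ?kl ?orbT //.
rewrite -[RHS]per ?inE ?kl ?orbT //; congr (f k _).
by rewrite modn_dvdm // (big_rem k) //= dvdn_mulr.
Qed.

Lemma sum_periods (W X : nat) g : (0 < W)%N -> (forall m, g (m %% W)%N = g m) ->
  \sum_(m < X) g m = (\sum_(m < W) g m) *+ (X %/ W) + \sum_(m < X %% W) g m.
Proof.
move=> W0 per; rewrite -(big_mkord xpredT g) {1}(divn_eq X W).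
rewrite (@big_cat_nat _ _ _ (X %/ W * W)) ?leq_addr //= big_mkord sum_ord_mul.
congr (_ + _).
  transitivity (\sum_(i < X %/ W) \sum_(r < W) g r).
    by apply: eq_bigr => i _; apply: eq_bigr => r _; rewrite -per modnMDl per.
  by rewrite sumr_const card_ord.
rewrite -{1}[(X %/ W * W)%N]add0n big_addn addKn big_mkord.
by apply: eq_bigr => i _; rewrite addnC -per modnMDl per.
Qed.

Lemma sum_periods_le (W X : nat) g : (0 < W)%N -> (forall m, g (m %% W)%N = g m) ->
  (forall m, 0 <= g m) ->
  \sum_(m < X) g m <= (\sum_(m < W) g m) *+ (X %/ W).+1.
Proof.
move=> W0 per g0; rewrite (sum_periods X W0 per) mulrSr lerD2l.
rewrite -!(big_mkord xpredT g) [leRHS](@big_cat_nat _ _ _ (X %% W)) ?(ltnW (ltn_pmod _ _)) //=.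
by rewrite lerDl sumr_ge0.
Qed.

(** Only the last, incomplete period contributes. This carries the orthogonality of the sieve
    functions over to ranges of arbitrary length. *)
Lemma sum_periods0 (W X : nat) (M : F) g : (0 < W)%N -> (forall m, g (m %% W)%N = g m) ->
  (forall m, g m <= M) -> 0 <= M -> \sum_(m < W) g m = 0 ->
  \sum_(m < X) g m <= W%:R * M.
Proof.
move=> W0 per gM M0 s0; rewrite (sum_periods X W0 per) s0 mul0rn add0r.
apply: (@le_trans _ _ ((X %% W)%:R * M)).
  apply: (@le_trans _ _ (\sum_(m < X %% W) M)); first by apply: ler_sum => i _; apply: gM.
  by rewrite sumr_const card_ord mulr_natl.
by rewrite ler_wpM2r // ler_nat ltnW // ltn_pmod.
Qed.
End F.

(** * Selberg's sieve in an arithmetic progression *)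

Definition squarefree (d : nat) := d == (\prod_(l <- primes d) l)%N.

Lemma squarefree_gt0 d : squarefree d -> (0 < d)%N.
Proof. by case: d => //; rewrite /squarefree big_nil. Qed.

Lemma all_prime_primes n : all prime (primes n).
Proof. by apply/allP => l; rewrite mem_primes => /andP[]. Qed.

Lemma uniq_primes_prod_dvd (ls : seq nat) n :
  all prime ls -> uniq ls -> {in ls, forall l, l %| n}%N -> (\prod_(l <- ls) l %| n)%N.
Proof.
elim: ls => [|l ls IH] /=; first by rewrite big_nil dvd1n.
case/andP=> pl pls /andP[nl ul] dv; rewrite big_cons Gauss_dvd; last exact: coprime_prime_prod.
by rewrite dv ?inE ?eqxx // IH // => k kl; rewrite dv // inE kl orbT.
Qed.

Lemma prod_primes_dvd n : (\prod_(l <- primes n) l %| n)%N.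
Proof.
apply: uniq_primes_prod_dvd (all_prime_primes n) (primes_uniq n) _ => l.
by rewrite mem_primes => /and3P[].
Qed.

Lemma squarefreeP d : reflect (0 < d /\ forall l, prime l -> ~~ (l ^ 2 %| d))%N (squarefree d).
Proof.
apply: (iffP idP) => [sd|[d0 nd]].
  split; first exact: squarefree_gt0.
  move=> l pl; apply/negP => ld.
  have lp : l \in primes d.
    by rewrite mem_primes pl squarefree_gt0 //= (dvdn_trans _ ld) // dvdn_exp.
  move: ld; rewrite (eqP sd) (big_rem l) //= expnS expn1 dvdn_pmul2l ?prime_gt0 //.
  apply/negP; rewrite -prime_coprime //; apply: coprime_prime_prod => //.
    by apply/allP => k /mem_rem; apply/allP/all_prime_primes.
  by rewrite mem_rem_uniqF ?primes_uniq.
rewrite /squarefree; apply/eqP; have [k dE] := dvdnP (prod_primes_dvd d).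
suff k1 : k = 1%N by rewrite {1}dE k1 mul1n.
apply/eqP/negPn/negP => k1.
have k0 : (0 < k)%N by move: d0; rewrite dE muln_gt0 => /andP[].
have pk := pdiv_prime (_ : 1 < k)%N; have {}pk : prime (pdiv k) by apply: pk; lia.
have pd : pdiv k \in primes d.
  by rewrite mem_primes pk d0 dE (dvdn_trans (pdiv_dvd k)) // dvdn_mulr.
have /negP[] := nd _ pk; rewrite dE expnS expn1 dvdn_mul ?pdiv_dvd //.
by rewrite (big_rem (pdiv k)) //= dvdn_mulr.
Qed.

Lemma squarefree_dvd d n : (d %| n)%N -> squarefree n -> squarefree d.
Proof.
move=> dn /squarefreeP[n0 nn]; apply/squarefreeP; split; first exact: dvdn_gt0 dn.
by move=> l pl; apply: contra (nn l pl) => ld; apply: dvdn_trans dn.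
Qed.

Lemma square_squarefree n : (0 < n)%N ->
  exists s f, [/\ n = (s ^ 2 * f)%N, (0 < s)%N & squarefree f].
Proof.
elim/ltn_ind: n => n IH n0.
have [sn|] := boolP (squarefree n); first by exists 1%N, n; rewrite mul1n.
move=> nsq; have : ~~ all (fun l => ~~ (l ^ 2 %| n)%N) (primes n).
  apply: contra nsq => /allP al; apply/squarefreeP; split=> // l pl.
  apply/negP => ln; have /al : l \in primes n.
    by rewrite mem_primes pl n0 (dvdn_trans _ ln) // dvdn_exp.
  by rewrite ln.
case/allPn => l; rewrite mem_primes => /and3P[pl _ _]; rewrite negbK => /dvdnP[k nE].
have k0 : (0 < k)%N by move: n0; rewrite nE muln_gt0 => /andP[].
have [||s [f [kE s0 sf]]] := IH k => //.
  by rewrite nE ltn_Pmulr // -(exp1n 2) ltn_exp2r // prime_gt1.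
exists (s * l)%N, f; split=> //; first by rewrite nE kE expnMn; lia.
by rewrite muln_gt0 s0 prime_gt0.
Qed.

Lemma split_squarefree Q f : squarefree f ->
  exists d e, [/\ f = (d * e)%N, squarefree d, squarefree e, coprime d Q & (e %| Q)%N].
Proof.
move=> sf; have f0 := squarefree_gt0 sf.
have /dvdnP[d fE] := dvdn_gcdl f Q; exists d, (gcdn f Q).
have df : (d %| f)%N by rewrite fE dvdn_mulr.
split=> //; first exact: squarefree_dvd sf.
- exact: squarefree_dvd (dvdn_gcdl _ _) sf.
- apply/negPn/negP => nc; have d0 : (0 < d)%N by apply: dvdn_gt0 df.
  have g0 : (0 < gcdn d Q)%N by rewrite gcdn_gt0 d0.
  have pl : prime (pdiv (gcdn d Q)) by apply: pdiv_prime; move: nc; rewrite /coprime; lia.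
  have ld := dvdn_trans (pdiv_dvd _) (dvdn_gcdl d Q).
  have lQ := dvdn_trans (pdiv_dvd _) (dvdn_gcdr d Q).
  have [_ /(_ _ pl) /negP[]] := squarefreeP _ sf.
  by rewrite fE expnS expn1 dvdn_mul // dvdn_gcd lQ (dvdn_trans ld df).
- exact: dvdn_gcdr.
Qed.

Section F.
Variable F : realFieldType.
Implicit Types (Q b d e z : nat).

(* Plays the role of Q / phi(Q), which it does not exceed. *)
Definition sqf_inv_sum (Q : nat) : F := \sum_(e < Q.+1 | (e %| Q)%N && squarefree e) e%:R^-1.
Definition sqf_coprime Q : pred nat := [pred d | squarefree d && coprime d Q].
Definition harm z : F := \sum_(n < z) n.+1%:R^-1.
(** Euler's totient when [d] is squarefree. *)
Definition sqf_phi (d : nat) : F := \prod_(l <- primes d) (l%:R - 1).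
(* Equal to 1 when Q m + b has no prime factor in common with d. For distinct d these functions of m are
   orthogonal over a period, so Bessel's inequality takes the place of Selberg's choice of weights. *)
Definition sieve_char Q b d m : F := \prod_(l <- primes d) (1 - (l * (l %| Q * m + b))%N%:R).

(** Serves to bound a sum by an expanded product: [g] lists the terms of the expansion, every number
    coming from [A] occurs among them, and nonnegativity takes care of repetitions. *)
Lemma sum_cover (T U : finType) (A : {pred T}) (B : {pred U}) (f : T -> nat) (g : U -> nat) (w : nat -> F) :
  (forall n, 0 <= w n) -> injective f ->
  (forall x, x \in A -> exists2 t, t \in B & g t = f x) ->
  \sum_(x in A) w (f x) <= \sum_(t in B) w (g t).
Proof.
move=> w0 finj cov.
apply: (@le_trans _ _ (\sum_(x in A) \sum_(t in B | g t == f x) w (g t))).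
  apply: ler_sum => x /cov[t tB gt].
  rewrite (bigD1 t) /= ?tB ?gt ?eqxx // lerDl; apply: sumr_ge0 => *; exact: w0.
rewrite (exchange_big_dep (mem B)) /=; last by move=> x t _ /andP[].
apply: ler_sum => t tB; have [[x xA /eqP gx]|nx] := altP (@exists_inP _ (mem A) (fun x => g t == f x)).
  rewrite (big_pred1 x) // => y /=; rewrite tB gx /=.
  apply/idP/eqP => [/andP[_ /eqP/finj->]//|->]; by apply/andP; split.
rewrite big_pred0 // => y /=; apply/negP => /and3P[yA _ gy].
by case/negP: nx; apply/exists_inP; exists y.
Qed.

Lemma sum_inv_sqr z : \sum_(s < z) (s.+1 ^ 2)%N%:R^-1 <= 2 :> F.
Proof.
case: z => [|z]; first by rewrite big_ord0.
(* Subtracting the reciprocal of the number of terms makes the induction telescope. *)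
suff : \sum_(s < z.+1) (s.+1 ^ 2)%N%:R^-1 <= 2 - z.+1%:R^-1 :> F.
  have : (0 : F) <= z.+1%:R^-1 by rewrite invr_ge0.
  by move=> ? /le_trans; apply; rewrite gerBl.
elim: z => [|z IH]; first by rewrite big_ord1 exp1n invr1; lra.
rewrite big_ord_recr /=; apply: (le_trans (lerD IH (lexx _))).
have [a a0 aE] : exists2 a : F, 0 < a & z.+1%:R = a by exists z.+1%:R; rewrite ?ltr0n.
rewrite natrX [z.+2%:R]mulrSr aE -subr_ge0.
have -> : 2 - (a + 1)^-1 - (2 - a^-1 + (a + 1) ^- 2) = (a * (a + 1) ^+ 2)^-1.
  by field; lra.
by rewrite invr_ge0 mulr_ge0 ?exprn_ge0 ?addr_ge0 // ltW.
Qed.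

(** The 2^i terms of each dyadic block add up to at least 1/2. *)
Lemma harm_exp i : i%:R / 2 <= harm (2 ^ i).
Proof.
elim: i => [|i IH]; first by rewrite mul0r sumr_ge0 // => *; rewrite invr_ge0.
have -> : harm (2 ^ i.+1) = harm (2 ^ i) + \sum_(n < 2 ^ i) (2 ^ i + n.+1)%:R^-1.
  rewrite /harm expnS mul2n -addnn -!(big_mkord xpredT (fun n => n.+1%:R^-1)).
  rewrite (@big_cat_nat _ _ _ (2 ^ i)) ?leq_addr //=; congr (_ + _).
  rewrite -{1}[(2 ^ i)%N]add0n big_addn addnK big_mkord.
  by apply: eq_bigr => n _; rewrite -addSn addnC.
rewrite mulrSr mulrDl lerD //.
apply: (@le_trans _ _ (\sum_(n < 2 ^ i) (2 ^ i.+1)%:R^-1)).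
  rewrite sumr_const card_ord expnS natrM invfM -[leRHS]mulr_natl mulrCA mulfV ?pnatr_eq0 -?lt0n ?expn_gt0 //.
  by rewrite mulr1 mul1r.
apply: ler_sum => n _; rewrite lef_pV2 ?posrE ?ltr0n ?expn_gt0 ?addnS // ler_nat.
by rewrite expnS mul2n -addnn -addnS leq_add2l.
Qed.

(** Each n <= z is s^2 d e with d e squarefree, d coprime to [Q] and e dividing [Q], so 1 / n occurs
    in the expansion of a product of three sums. The sum over s gives the factor 2. *)
Lemma harm_le_good Q z : (0 < Q)%N ->
  harm z <= 2 * (\sum_(d < z.+1 | sqf_coprime Q d) d%:R^-1) * sqf_inv_sum Q.
Proof.
move=> Q0.
pose w n : F := n%:R^-1.
pose B := [pred t : 'I_z * ('I_z.+1 * 'I_Q.+1) | [&& sqf_coprime Q t.2.1, (t.2.2 %| Q)%N & squarefree t.2.2]].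
pose g (t : 'I_z * ('I_z.+1 * 'I_Q.+1)) := (t.1.+1 ^ 2 * (t.2.1 * t.2.2))%N.
have : \sum_(n in 'I_z) w n.+1 <= \sum_(t in B) w (g t).
  apply: (@sum_cover _ _ _ _ (fun n : 'I_z => n.+1)) => [n|n m [/val_inj->]//|n _].
    by rewrite invr_ge0.
  have [//|s [f [nE s0 /(split_squarefree Q)[d [e [fE sd se cd eQ]]]]]] := @square_squarefree n.+1.
  have d0 := squarefree_gt0 sd; have e0 := squarefree_gt0 se.
  have sz : (s.-1 < z)%N.
    rewrite prednK //; apply: leq_trans (ltn_ord n); rewrite nE fE.
    by rewrite expnS expn1 -!mulnA leq_pmulr // !muln_gt0 s0 d0 e0.
  have dz : (d < z.+1)%N.
    rewrite ltnS; apply: leq_trans (ltn_ord n); rewrite nE fE.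
    by rewrite mulnCA leq_pmulr // !muln_gt0 ?expn_gt0 s0 e0.
  have eQ' : (e < Q.+1)%N by rewrite ltnS dvdn_leq.
  exists (Ordinal sz, (Ordinal dz, Ordinal eQ')); first by apply/and3P; split=> //; apply/andP.
  by rewrite /g /= prednK // nE fE.
rewrite /harm => /le_trans -> //.
rewrite (eq_bigr (fun t : 'I_z * ('I_z.+1 * 'I_Q.+1) => (t.1.+1 ^ 2)%:R^-1 * (t.2.1%:R^-1 * t.2.2%:R^-1))); last first.
  by move=> t _; rewrite /w /g !natrM !invfM.
rewrite -(pair_big (fun _ : 'I_z => true) (fun t : 'I_z.+1 * 'I_Q.+1 => sqf_coprime Q t.1 && ((t.2 %| Q)%N && squarefree t.2))
  (fun (i : 'I_z) t => (i.+1 ^ 2)%:R^-1 * (t.1%:R^-1 * t.2%:R^-1))) /=.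
under eq_bigr => i _ do rewrite -mulr_sumr.
rewrite -mulr_suml -(pair_big (fun d : 'I_z.+1 => sqf_coprime Q d) (fun e : 'I_Q.+1 => (e %| Q)%N && squarefree e)
  (fun (d : 'I_z.+1) (e : 'I_Q.+1) => d%:R^-1 * e%:R^-1)) /=.
under [X in _ * X <= _]eq_bigr => i _ do rewrite -mulr_sumr.
rewrite -mulr_suml -mulrA ler_wpM2r ?sum_inv_sqr // mulr_ge0 //;
  by apply: sumr_ge0 => *; rewrite invr_ge0.
Qed.
End F.

Section F.
Variable F : realFieldType.
Implicit Types (Q b d e z X m l : nat).
Local Notation sieve_char := (sieve_char F).
Local Notation sqf_phi := (sqf_phi F).
Local Notation sqf_inv_sum := (sqf_inv_sum F).

Lemma prod_primes_ext N d (f : nat -> F) : (0 < N)%N -> (d %| N)%N ->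
  \prod_(l <- primes d) f l = \prod_(l <- primes N) (if (l %| d)%N then f l else 1).
Proof.
move=> N0 dN; rewrite -[RHS]big_mkcond -[RHS]big_filter; apply: perm_big.
apply: uniq_perm; rewrite ?filter_uniq ?primes_uniq // => l.
rewrite mem_filter !mem_primes N0 (dvdn_gt0 N0 dN) /=.
apply/andP/and3P => [[pl ld]|[ld pl _]]; split=> //; exact: dvdn_trans dN.
Qed.

Lemma sum_dvd_affine Q b l (c : bool -> F) : prime l -> coprime l Q ->
  \sum_(m < l) c (l %| Q * m + b)%N = c true + (l.-1)%:R * c false.
Proof.
move=> pl cl; rewrite (@sum_affine_mod _ l Q b (fun m => c (l %| m)%N)) 1?coprime_sym //; last first.
  by move=> m; rewrite /dvdn modn_mod.
case: l pl {cl} => // l _; rewrite big_ord_recl dvdn0; congr (_ + _).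
rewrite (eq_bigr (fun=> c false)) ?sumr_const ?card_ord ?mulr_natl // => i _.
by rewrite gtnNdvd // ltnS ltn_ord.
Qed.

Lemma ler_prod_seq (s : seq nat) (E1 E2 : nat -> F) :
  (forall i, i \in s -> 0 <= E1 i <= E2 i) -> \prod_(i <- s) E1 i <= \prod_(i <- s) E2 i.
Proof. by move=> le12; rewrite !big_seq; apply: ler_prod. Qed.

Lemma prime_natr_ge2 l : prime l -> 2 <= l%:R :> F.
Proof. by move/prime_gt1 => l1; rewrite (ler_nat F 2). Qed.

Lemma sqf_phi_ge1 d : 1 <= sqf_phi d.
Proof.
apply: (@le_trans _ _ (\prod_(l <- primes d) 1)); [by rewrite big1_eq|apply: ler_prod_seq => l].
by rewrite mem_primes => /andP[/prime_natr_ge2 l2 _]; lra.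
Qed.

Lemma sqf_phi_le d : squarefree d -> sqf_phi d <= d%:R.
Proof.
move=> /eqP {2}->; rewrite natr_prod; apply: ler_prod_seq => l.
by rewrite mem_primes => /andP[/prime_natr_ge2 l2 _]; lra.
Qed.

Lemma norm_sieve_char_le Q b d m : squarefree d -> `|sieve_char Q b d m| <= d%:R.
Proof.
move=> /eqP {2}->; rewrite natr_prod normr_prod; apply: ler_prod_seq => l.
rewrite mem_primes normr_ge0 => /andP[/prime_natr_ge2 l2 _].
by case: dvdn; rewrite /= ?muln1 ?muln0 ?subr0 ler_norml; lra.
Qed.

Let f Q b d l m : F := if (l %| d)%N then 1 - (l * (l %| Q * m + b))%N%:R else 1.

Let f_mod Q b d l m : f Q b d l (m %% l) = f Q b d l m.
Proof.
by rewrite /f; case: ifP => // _; do 3 congr (_ _ _); rewrite /dvdn -modnDml modnMmr modnDml.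
Qed.

(** The Chinese remainder theorem reduces to one prime l of d e. There the factor 1 - l occurs for
    one residue and 1 for the l - 1 others: a single factor has sum 0, its square has sum l (l -
    1). *)
Lemma sum_sieve_char2 Q b d e : squarefree d -> squarefree e -> coprime d Q -> coprime e Q ->
  \sum_(m < \prod_(l <- primes (d * e)) l) sieve_char Q b d m * sieve_char Q b e m =
  if d == e then d%:R * sqf_phi d else 0.
Proof.
move=> sd se cd ce; have d0 := squarefree_gt0 sd; have e0 := squarefree_gt0 se.
have N0 : (0 < d * e)%N by rewrite muln_gt0 d0.
have E m : sieve_char Q b d m * sieve_char Q b e m = \prod_(l <- primes (d * e)) (f Q b d l m * f Q b e l m).
  rewrite /sieve_char (@prod_primes_ext (d * e) d) ?dvdn_mulr // (@prod_primes_ext (d * e) e) ?dvdn_mull //.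
  by rewrite -big_split.
rewrite (eq_bigr (fun m : 'I__ => \prod_(l <- primes (d * e)) (f Q b d l m * f Q b e l m))) => [|m _]; last exact: E.
rewrite (@sum_crt _ _ (fun l m => f Q b d l m * f Q b e l m)) ?all_prime_primes ?primes_uniq //; last first.
  by move=> l m _; rewrite !f_mod.
have S l : l \in primes (d * e) -> \sum_(m < l) f Q b d l m * f Q b e l m =
    if (l %| d)%N && (l %| e)%N then l%:R * (l%:R - 1) else 0.
  rewrite mem_primes N0 /= => /andP[pl]; rewrite Euclid_dvdM // => lde.
  have cl : coprime l Q.
    by case/orP: lde => ld; [apply: coprime_dvdl cd|apply: coprime_dvdl ce].
  have lE : (l.-1)%:R = l%:R - 1 :> F by rewrite -subn1 natrB ?prime_gt0.
  rewrite /f; case: (boolP (l %| d)%N) lde => [ld _|nld /= ->]; last first.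
    under eq_bigr => m _ do rewrite mul1r.
    rewrite (@sum_dvd_affine Q b l (fun t => 1 - (l * t)%N%:R)) // lE muln1 muln0; ring.
  case: (boolP (l %| e)%N) => [le|nle] /=.
    rewrite (@sum_dvd_affine Q b l (fun t => (1 - (l * t)%N%:R) * (1 - (l * t)%N%:R))) // lE muln1 muln0; ring.
  under eq_bigr => m _ do rewrite mulr1.
  rewrite (@sum_dvd_affine Q b l (fun t => 1 - (l * t)%N%:R)) // lE muln1 muln0; ring.
rewrite (eq_big_seq _ S); case: eqVneq => [<-|nde].
  have -> : primes (d * d) = primes d.
    by apply/eq_primes => l; rewrite primesM // orbb.
  have -> : d%:R = \prod_(l <- primes d) l%:R :> F by rewrite {1}(eqP sd) natr_prod.
  rewrite -big_split /=; apply: eq_big_seq => l.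
  by rewrite mem_primes andbb => /and3P[_ _ ->].
have : ~~ all (fun l => (l %| d) && (l %| e))%N (primes (d * e)).
  apply: contra nde => /allP al; rewrite (eqP sd) (eqP se); apply/eqP; congr (\prod_(i <- _) _)%N.
  apply/eq_primes => l; rewrite !mem_primes d0 e0 /=; case pl: (prime l) => //=.
  apply/idP/idP => lx; have /al/andP[] // : l \in primes (d * e);
  by rewrite mem_primes pl N0 /= Euclid_dvdM // lx ?orbT.
by case/allPn => l lp nl; rewrite (big_rem l) //= (negbTE nl) mul0r.
Qed.
End F.

Section F.
Variable F : realFieldType.
Implicit Types (Q b d e z X m l : nat).
Local Notation sieve_char := (sieve_char F).
Local Notation sqf_phi := (sqf_phi F).
Local Notation sqf_inv_sum := (sqf_inv_sum F).

Lemma sieve_char_mod Q b d W m : {in primes d, forall l, l %| W}%N -> sieve_char Q b d (m %% W) = sieve_char Q b d m.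
Proof.
move=> dW; rewrite /sieve_char; apply: eq_big_seq => l ld; congr (1 - (_ * nat_of_bool _)%N%:R).
by rewrite /dvdn -modnDml -modnMmr modn_dvdm ?dW // modnMmr modnDml.
Qed.

Lemma primes_sqr d : primes (d * d) = primes d.
Proof.
have [->//|d0] := posnP d.
by apply/eq_primes => l; rewrite primesM // orbb.
Qed.

(** For distinct [d] and [e] full periods cancel, and the incomplete one has at most d e terms of
    size at most d e. For d = e the terms are nonnegative, so the number of periods may be rounded
    up. *)
Lemma sum_sieve_char2_le Q b d e X : squarefree d -> squarefree e -> coprime d Q -> coprime e Q ->
  \sum_(m < X) sieve_char Q b d m * sieve_char Q b e m <= (d == e)%:R * (X%:R * sqf_phi d) + ((d * e) ^ 2)%:R.
Proof.
move=> sd se cd ce; have d0 := squarefree_gt0 sd; have e0 := squarefree_gt0 se.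
have N0 : (0 < d * e)%N by rewrite muln_gt0 d0.
have Wle : (\prod_(l <- primes (d * e)) l <= d * e)%N by rewrite dvdn_leq // prod_primes_dvd.
have W0 : (0 < \prod_(l <- primes (d * e)) l)%N.
  by rewrite big_seq; apply: prodn_cond_gt0 => l /=; rewrite mem_primes => /andP[/prime_gt0].
have per m : sieve_char Q b d (m %% \prod_(l <- primes (d * e)) l) * sieve_char Q b e (m %% \prod_(l <- primes (d * e)) l)
     = sieve_char Q b d m * sieve_char Q b e m.
  have h k : k \in primes (d * e) -> (k %| \prod_(l <- primes (d * e)) l)%N.
    by move=> kp; rewrite (big_rem k) //= dvdn_mulr.
  by congr (_ * _); apply: sieve_char_mod => l lp; apply: h; rewrite primesM // lp ?orbT.
have S := sum_sieve_char2 F b sd se cd ce.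
move: S W0 Wle per; case: eqVneq => [<-|nde] S W0 Wle per; last first.
  rewrite mul0r add0r; apply: le_trans (@sum_periods0 _ _ X (d * e)%:R (fun m => sieve_char Q b d m * sieve_char Q b e m) W0 per _ _ S) _ => //.
    move=> m; apply: le_trans (ler_norm _) _; rewrite normrM natrM.
    by apply: ler_pM => //; apply: norm_sieve_char_le.
  by rewrite -natrM ler_nat expnS expn1 leq_mul2r Wle orbT.
rewrite mul1r; move: S W0 Wle per; rewrite primes_sqr -(eqP sd) => S W0 Wle per.
have HH := (@sum_periods_le _ _ X (fun m => sieve_char Q b d m * sieve_char Q b d m) W0 per). apply: le_trans (HH _) _ => [m|]; first by rewrite -expr2 sqr_ge0.
rewrite S mulrSr lerD //.
  rewrite -[leLHS]mulr_natr mulrAC ler_wpM2r ?(le_trans ler01 (sqf_phi_ge1 _ _)) //.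
  by rewrite -natrM ler_nat mulnC leq_divM.
rewrite expnS expn1 !natrM -mulrA ler_wpM2l //.
apply: le_trans (sqf_phi_le _ sd) _; rewrite ler_peMr // -!natrM (ler_nat F 1) !muln_gt0.
by rewrite d0.
Qed.

(** The classical G(z) of Selberg's sieve, over moduli coprime to [Q]; the gain of the sieve is
    division by it. *)
Definition sieve_mass Q z : F := \sum_(d < z.+1 | sqf_coprime Q d) (sqf_phi d)^-1.

Lemma sieve_mass_ge1 Q z : (0 < z)%N -> 1 <= sieve_mass Q z.
Proof.
move=> z0; rewrite /sieve_mass (bigD1 (Ordinal (z0 : 1 < z.+1)%N)) /=; last first.
  by rewrite /sqf_coprime /= /squarefree big_nil eqxx coprime1n.
rewrite /sqf_phi big_nil invr1 lerDl; apply: sumr_ge0 => d _.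
by rewrite invr_ge0 (le_trans ler01 (sqf_phi_ge1 _ _)).
Qed.

(** On the sifted set [P] all characters equal 1, so the combination [T] has the value G =
    [sieve_mass Q z] there. Hence the count times G^2 is at most the sum of the squares of [T],
    which near-orthogonality bounds by X G + z^6: the weights 1 / phi(d) turn the diagonal into X
    G. *)
Lemma selberg_sieve Q b z X (P : pred nat) : (0 < z)%N ->
  (forall m d, P m -> (d <= z)%N -> sqf_coprime Q d -> sieve_char Q b d m = 1) ->
  (\sum_(m < X) P m)%:R <= X%:R / sieve_mass Q z + (z ^ 6)%:R.
Proof.
move=> z0 PJ; set G := sieve_mass Q z.
have G1 : 1 <= G := sieve_mass_ge1 Q z0; have G0 : 0 < G by lra.
pose T m := \sum_(d < z.+1 | sqf_coprime Q d) (sqf_phi d)^-1 * sieve_char Q b d m.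
have H1 : (\sum_(m < X) P m)%:R * G ^+ 2 <= \sum_(m < X) T m ^+ 2.
  rewrite natr_sum mulr_suml; apply: ler_sum => m _.
  case Pm : (P m); last by rewrite mul0r sqr_ge0.
  rewrite mul1r le_eqVlt; apply/orP; left; apply/eqP; congr (_ ^+ 2).
  by apply: eq_bigr => d gd; rewrite PJ ?mulr1 // -ltnS.
have H2 : \sum_(m < X) T m ^+ 2 <= X%:R * G + (z ^ 6)%:R.
  have -> : \sum_(m < X) T m ^+ 2 = \sum_(d < z.+1 | sqf_coprime Q d) \sum_(e < z.+1 | sqf_coprime Q e)
      ((sqf_phi d)^-1 * (sqf_phi e)^-1) * \sum_(m < X) sieve_char Q b d m * sieve_char Q b e m.
    rewrite /T; under eq_bigr => m _ do rewrite expr2 mulr_suml.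
    rewrite exchange_big /=; apply: eq_bigr => d _.
    under eq_bigr => m _ do rewrite mulr_sumr.
    rewrite exchange_big /=; apply: eq_bigr => e _; rewrite mulr_sumr.
    by apply: eq_bigr => m _; ring.
  apply: (@le_trans _ _ (\sum_(d < z.+1 | sqf_coprime Q d) \sum_(e < z.+1 | sqf_coprime Q e)
      ((d == e)%:R * (X%:R * (sqf_phi e)^-1) + ((d * e) ^ 2)%:R))).
    apply: ler_sum => d gd; apply: ler_sum => e ge.
    have /andP[sd cd] := gd; have /andP[se ce] := ge.
    have pd := sqf_phi_ge1 F d; have pe := sqf_phi_ge1 F e.
    have i0 : 0 <= (sqf_phi d)^-1 * (sqf_phi e)^-1 by rewrite mulr_ge0 // invr_ge0; lra.
    have i1 : (sqf_phi d)^-1 * (sqf_phi e)^-1 <= 1.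
      by rewrite mulr_ile1 ?invr_ge0 ?invf_le1 //; lra.
    apply: le_trans (ler_wpM2l i0 (sum_sieve_char2_le b X sd se cd ce)) _.
    rewrite mulrDr lerD ?ler_piMl //.
    rewrite -val_eqE /=; case: eqVneq => [E|_]; last by rewrite !mul0r mulr0.
    by rewrite !mul1r -E mulrCA -mulrA mulVf ?mulr1 //; lra.
  under eq_bigr => d _ do rewrite big_split /=.
  rewrite big_split /= lerD //.
    rewrite exchange_big /= mulr_sumr; apply: ler_sum => e ge.
    rewrite (bigD1 e) //= eqxx mul1r big1 ?addr0 // => d /andP[_ /negbTE->].
    by rewrite mul0r.
  pose B : nat := (\sum_(d < z.+1) d ^ 2)%N.
  have BE : (B <= z ^ 3)%N.
    rewrite /B big_ord_recl add0n (@leq_trans (\sum_(i < z) z ^ 2)%N) //.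
      by apply: leq_sum => i _; rewrite leq_exp2r // /bump /= ltn_ord.
    by rewrite sum_nat_const card_ord -expnS.
  apply: (@le_trans _ _ (\sum_(d < z.+1) \sum_(e < z.+1) ((d * e) ^ 2)%:R)).
    rewrite big_mkcond; apply: ler_sum => d _; case: ifP => _; last exact: sumr_ge0.
    by rewrite big_mkcond; apply: ler_sum => e _; case: ifP.
  have -> : \sum_(d < z.+1) \sum_(e < z.+1) ((d * e) ^ 2)%:R = (B * B)%:R :> F.
    rewrite natrM /B !natr_sum mulr_suml; apply: eq_bigr => d _.
    by rewrite mulr_sumr; apply: eq_bigr => e _; rewrite expnMn natrM.
  by rewrite ler_nat (expnD z 3 3) leq_mul.
have H := le_trans H1 H2.
rewrite -(ler_pM2r (exprn_gt0 2 G0)); apply: le_trans H _.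
rewrite mulrDl lerD //; last by rewrite ler_peMr // exprn_ege1.
by rewrite expr2 mulrA mulfVK // gt_eqF.
Qed.

(** Logarithms are avoided: for z = 2^i the exponent i stands for log z. As phi(d) <= d for
    squarefree d, the two harmonic bounds pass to [sieve_mass]. *)
Lemma sieve_mass_invs Q i : (0 < Q)%N -> i%:R / 4 <= sieve_mass Q (2 ^ i) * sqf_inv_sum Q.
Proof.
move=> Q0; have := le_trans (harm_exp F i) (harm_le_good F _ Q0).
have s0 : 0 <= sqf_inv_sum Q by apply: sumr_ge0 => *; rewrite invr_ge0.
suff : (\sum_(d < (2 ^ i).+1 | sqf_coprime Q d) d%:R^-1) <= sieve_mass Q (2 ^ i).
  by move/(ler_wpM2r s0); set a := _ * _; set c := _ * _; rewrite -mulrA -/a; lra.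
apply: ler_sum => d /andP[sd _].
rewrite lef_pV2 ?posrE ?ltr0n ?squarefree_gt0 // ?sqf_phi_le //.
by apply: lt_le_trans (sqf_phi_ge1 _ _).
Qed.


(** The sieving level is z = 2^i with z^8 <= X. The main term gives 4 of the constant 7; the sieve
    error z^6 and the at most z + 1 indices whose prime value does not exceed z give the other 3. *)
Lemma brun_titchmarsh Q b i X : (0 < Q)%N -> (0 < i)%N -> (2 ^ (8 * i) <= X)%N ->
  (\sum_(m < X) prime (Q * m + b))%:R <= 7 * sqf_inv_sum Q * X%:R / i%:R.
Proof.
move=> Q0 i0 iX; set z := (2 ^ i)%N.
have z0 : (0 < z)%N by rewrite expn_gt0.
have s1 : 1 <= sqf_inv_sum Q.
  rewrite /sqf_inv_sum (bigD1 (Ordinal (Q0 : 1 < Q.+1)%N)) /=; last first.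
    by rewrite dvd1n /squarefree big_nil.
  by rewrite invr1 lerDl; apply: sumr_ge0 => *; rewrite invr_ge0.
pose P m := prime (Q * m + b) && (z < Q * m + b)%N.
have PJ m d : P m -> (d <= z)%N -> sqf_coprime Q d -> sieve_char Q b d m = 1.
  case/andP=> pm zm dz /andP[sd cd]; rewrite /sieve_char big_seq big1 // => l.
  rewrite mem_primes => /and3P[pl d0 ld]; rewrite dvdn_prime2 //.
  case: eqP => [E|_]; last by rewrite muln0 subr0.
  by move: (dvdn_leq d0 ld); rewrite E leqNgt (leq_ltn_trans dz).
have := selberg_sieve X z0 PJ; set S := (\sum_(m < X) P m)%N => HS.
have c1 : (\sum_(m < X) prime (Q * m + b) <= S + z.+1)%N.
  apply: (@leq_trans (\sum_(m < X) (P m + (m <= z)))%N).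
    apply: leq_sum => m _; rewrite /P; case: prime => //=.
    case: (ltnP z) => //= le; rewrite (_ : (m <= z)%N) //.
    by apply: leq_trans le; rewrite -{1}[m : nat]mul1n (leq_trans (leq_mul Q0 (leqnn _))) // leq_addr.
  by rewrite big_split /= leq_add2l (sum_ltn_le X z.+1).
have ir : (0 : F) < i%:R by rewrite ltr0n.
have G1 := sieve_mass_ge1 Q z0.
have XG : X%:R / sieve_mass Q z <= 4 * sqf_inv_sum Q * X%:R / i%:R.
  have := sieve_mass_invs i Q0; rewrite -/z => h.
  rewrite ler_pdivrMr; last lra.
  rewrite mulrAC ler_pdivlMr // [leLHS]mulrC.
  have -> : 4 * sqf_inv_sum Q * X%:R * sieve_mass Q z = (4 * (sieve_mass Q z * sqf_inv_sum Q)) * X%:R by ring.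
  by rewrite ler_wpM2r //; lra.
have zX : (z ^ 6 + z.+1)%:R <= 3 * X%:R / i%:R :> F.
  rewrite ler_pdivlMr // -!natrM ler_nat (leq_trans _ (leq_mul (leqnn 3) iX)) //.
  have -> : (2 ^ (8 * i) = z ^ 8)%N by rewrite mulnC expnM.
  have iz : (i <= z)%N by rewrite ltnW // ltn_expl.
  have z1 : (z <= z ^ 6)%N by rewrite -{1}[z]expn1 leq_exp2l // /z -{1}(expn0 2) ltn_exp2l.
  have z7 : (z ^ 6 * z <= z ^ 8)%N by rewrite -expnSr leq_pexp2l.
  have := leq_mul (leqnn (z ^ 6)) iz; nia.
apply: (@le_trans _ _ (S + z.+1)%N%:R); first by rewrite ler_nat.
rewrite natrD; have -> : 7 * sqf_inv_sum Q * X%:R / i%:R = 4 * sqf_inv_sum Q * X%:R / i%:R + 3 * X%:R / i%:R * sqf_inv_sum Q by ring.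
move: zX; rewrite natrD; set A := 3 * _ / _; have A0 : 0 <= A by rewrite divr_ge0 ?mulr_ge0.
have := ler_peMr A0 s1; lra.
Qed.
End F.

(** * Prime factors of shifted primes *)

Definition omega (ls : seq nat) (n : nat) := count (fun l => l %| n)%N ls.

Lemma omega_eq ls n m : (forall l, l \in ls -> (l %| n) = (l %| m))%N -> omega ls n = omega ls m.
Proof. by move=> E; apply: eq_in_count => l /E. Qed.

Section F.
Variable F : realFieldType.
Local Notation sqf_inv_sum := (sqf_inv_sum F).

Lemma prod_if_count (x : F) (a : pred nat) (ls : seq nat) :
  \prod_(l <- ls) (if a l then x else 1) = x ^+ count a ls.
Proof.
elim: ls => [|l ls IH]; first by rewrite big_nil.
by rewrite big_cons IH /=; case: (a l); [rewrite add1n exprS|rewrite add0n mul1r].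
Qed.

(* The local factor at l of the weight x^omega(n), restricted to n + 1 coprime to the sieving primes. *)
Definition omega_weight (x : F) (l n : nat) : F := if (l %| n.+1)%N then 0 else if (l %| n)%N then x else 1.

Lemma omega_weight_ge0 x l n : 0 <= x -> 0 <= omega_weight x l n.
Proof. by move=> x0; rewrite /omega_weight; case: ifP => // _; case: ifP. Qed.

Lemma omega_weight_mod x l n : omega_weight x l (n %% l) = omega_weight x l n.
Proof.
by rewrite /omega_weight /dvdn modn_mod -addn1 modnDml addn1.
Qed.

Lemma prod_wt x ls n : all prime ls -> coprime n.+1 (\prod_(l <- ls) l) ->
  \prod_(l <- ls) omega_weight x l n = x ^+ omega ls n.
Proof.
move=> pls cn; rewrite -prod_if_count; apply: eq_big_seq => l ll; rewrite /omega_weight.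
case: ifP => // ln; have pl := allP pls _ ll.
move: cn; rewrite (big_rem l) //= coprimeMr => /andP[].
by rewrite coprime_sym prime_coprime // ln.
Qed.

(** The residue 0 has weight x, the residue -1 weight 0, all others weight 1. *)
Lemma sum_wt x l : (1 < l)%N -> \sum_(b < l) omega_weight x l b = l%:R - 2 + x.
Proof.
case: l => [|[|l]] // _; rewrite -(big_mkord xpredT (omega_weight x l.+2)) big_nat_recr //= big_ltn //.
rewrite (eq_big_nat _ _ (F2 := fun=> 1)) => [|b /andP[b0 bl]]; last first.
  by rewrite /omega_weight !gtnNdvd // ltnS // ltnW.
rewrite /omega_weight dvdnn dvdn0 gtnNdvd // sumr_const_nat subn1 addr0 -[l.+2]addn2 natrD /=; ring.
Qed.

Lemma sqf_inv_sum_prod_le ls : all prime ls -> uniq ls ->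
  sqf_inv_sum (\prod_(l <- ls) l) <= \prod_(l <- ls) (1 + l%:R^-1).
Proof.
elim: ls => [_ _|l ls IH /= /andP[pl pls] /andP[nl ul]].
  rewrite !big_nil /sqf_inv_sum big_mkcond big_ord_recl big_ord1 /=.
  rewrite /squarefree big_nil. by rewrite /bump /= invr1 add0r.
rewrite !big_cons; set P := (\prod_(j <- ls) j)%N.
have P0 : (0 < P)%N.
  by rewrite /P big_seq; apply: prodn_cond_gt0 => k /(allP pls)/prime_gt0.
have cl : coprime l P by apply: coprime_prime_prod.
apply: (@le_trans _ _ ((1 + l%:R^-1) * sqf_inv_sum P)); last first.
  by rewrite ler_wpM2l ?addr_ge0 ?invr_ge0 // IH.
pose B := [pred t : bool * 'I_P.+1 | (t.2 %| P)%N && squarefree t.2].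
pose g (t : bool * 'I_P.+1) := ((if t.1 then l else 1) * t.2)%N.
have := @sum_cover F _ _ [pred e : 'I_(l * P).+1 | (e %| l * P)%N && squarefree e] B
   (fun e => e) g (fun n => n%:R^-1) _ val_inj _.
rewrite /sqf_inv_sum => /(_ _ _)/le_trans; apply => [n|e|]; first by rewrite invr_ge0.
  case/andP=> el se; have e0 := squarefree_gt0 se.
  have [le|nle] := boolP (l %| e)%N.
    have /dvdnP[e' eE] := le.
    have e'P : (e' %| P)%N by move: el; rewrite eE mulnC dvdn_pmul2l ?prime_gt0.
    have h : (e' < P.+1)%N by rewrite ltnS dvdn_leq.
    exists (true, Ordinal h); last by rewrite /g /= eE mulnC.
    apply/andP; split=> //; apply: squarefree_dvd se; rewrite eE /= dvdn_mulr //.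
  have eP : (e %| P)%N by rewrite -(@Gauss_dvdr e l) // coprime_sym prime_coprime.
  have h : (e < P.+1)%N by rewrite ltnS dvdn_leq.
  by exists (false, Ordinal h); [apply/andP|rewrite /g /= mul1n].
rewrite -(pair_big (fun _ : bool => true) (fun e : 'I_P.+1 => (e %| P)%N && squarefree e)
  (fun (c : bool) (e : 'I_P.+1) => (g (c, e))%:R^-1)) /= big_bool /= mulrDl addrC mul1r mulr_sumr.
rewrite lerD //; apply: ler_sum => e _; rewrite /g /= ?mul1n // natrM invfM //.
Qed.

(* Rankin's trick: [omega >= T] is bounded by (3/2)^(omega - T), averaged by the Chinese remainder theorem. *)
Lemma prime_count_omega_ge ls N i T : let P := (\prod_(l <- ls) l)%N in
  let X := (N %/ P).+1 in
  all prime ls -> uniq ls -> (0 < i)%N -> (2 ^ (8 * i) <= X)%N ->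
  (\sum_(n < N) (prime n.+1 && (T <= omega ls n)%N))%:R <=
  P%:R + 7 * (X * P)%:R / i%:R * (2 / 3) ^+ T * \prod_(l <- ls) ((1 + l%:R^-1) * (1 - l%:R^-1 / 2)) :> F.
Proof.
move=> P X pls uls i0 iX.
have P0 : (0 < P)%N.
  by rewrite /P big_seq; apply: prodn_cond_gt0 => k /(allP pls)/prime_gt0.
pose c b := coprime b.+1 P && (T <= omega ls b)%N.
have H1 : (\sum_(n < N) (prime n.+1 && (T <= omega ls n)%N) <=
    P + \sum_(b < P) c b * \sum_(m < X) prime (P * m + b.+1))%N.
  have NX : (N <= X * P)%N by rewrite ltnW // /X ltn_ceil.
  apply: (@leq_trans (\sum_(n < X * P) (prime n.+1 && (T <= omega ls n)))%N).
    rewrite -!(big_mkord xpredT (fun n => (prime n.+1 && (T <= omega ls n)%N) : nat)).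
    by rewrite [leqRHS](@big_cat_nat _ _ _ N) //= leq_addr.
  rewrite (sum_ord_mul _ _ (fun n => (prime n.+1 && (T <= omega ls n)%N) : nat)).
  (* The block m = 0 is counted trivially. For m > 0 the prime exceeds P, hence is coprime to P, and
     only b with b + 1 coprime to P contribute. *)
  apply: (@leq_trans (\sum_(m < X) \sum_(b < P) ((m == 0 :> nat) + c b * prime (P * m + b.+1)))%N).
    apply: leq_sum => m _; apply: leq_sum => b _.
    case: posnP => [//|m0] /=; first by case: andb.
    have E : (m * P + b).+1 = (P * m + b.+1)%N by rewrite addnS mulnC.
    rewrite E; case pr: (prime _) => //=; rewrite muln1 /c.
    have -> : omega ls (m * P + b) = omega ls b.
      apply: omega_eq => l ll; rewrite dvdn_addr // dvdn_mull //.
      by rewrite /P (big_rem l) //= dvdn_mulr.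
    suff -> : coprime b.+1 P by [].
    rewrite coprime_sym /coprime -(gcdnMDl m) mulnC -/(coprime _ _) coprime_sym prime_coprime //.
    apply/negP => /dvdn_leq; rewrite P0 => /(_ isT); rewrite leqNgt => /negP[].
    by rewrite -E ltnS (leq_trans _ (leq_addr _ _)) // leq_pmull.
  under eq_bigr => m _ do rewrite big_split /= sum_nat_const card_ord.
  rewrite big_split /= exchange_big /= leq_add //.
    by rewrite -big_distrr /= big_ord_recl eqxx big1 ?addn0 ?muln1.
  by apply: leq_sum => b _; rewrite big_distrr.
apply: (@le_trans _ _ (P + \sum_(b < P) c b * \sum_(m < X) prime (P * m + b.+1))%N%:R).
  by rewrite ler_nat.
rewrite natrD lerD2l natr_sum.
set A := 7 * sqf_inv_sum P * X%:R / i%:R.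
have s0 : 0 <= sqf_inv_sum P by apply: sumr_ge0 => *; rewrite invr_ge0.
have A0 : 0 <= A by rewrite /A !mulr_ge0 ?invr_ge0.
apply: (@le_trans _ _ (\sum_(b < P) ((2 / 3) ^+ T * \prod_(l <- ls) omega_weight (3 / 2) l b) * A)).
  apply: ler_sum => b _; rewrite natrM.
  apply: ler_pM => //; last exact: brun_titchmarsh.
  rewrite /c; case: (boolP (coprime _ _)) => [cb|_] /=; last first.
    by rewrite mulr_ge0 ?exprn_ge0 ?divr_ge0 // prodr_ge0 // => l _; apply: omega_weight_ge0; rewrite divr_ge0.
  rewrite prod_wt //; case: leqP => [Tb|_] /=; last first.
    by rewrite mulr_ge0 ?exprn_ge0 ?divr_ge0.
  rewrite -(subnK Tb) exprD mulrCA -exprMn.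
  rewrite (_ : 2 / 3 * (3 / 2) = 1 :> F) ?expr1n ?mulr1 ?exprn_ege1 //; last by field.
  by rewrite ler_pdivlMr //; lra.
rewrite -mulr_suml -mulr_sumr sum_crt //; last by move=> l m _; rewrite omega_weight_mod.
have -> : \prod_(l <- ls) \sum_(b < l) omega_weight (3 / 2) l b = P%:R * \prod_(l <- ls) (1 - l%:R^-1 / 2).
  rewrite /P natr_prod -big_split /=; apply: eq_big_seq => l ll.
  have pl := allP pls _ ll; have l2 := prime_natr_ge2 F pl.
  rewrite sum_wt ?prime_gt1 // mulrBr mulrA mulfV; last by apply/eqP; lra.
  by field.
rewrite big_split /=; set p1 := \prod_(l <- ls) (1 + l%:R^-1); set p2 := \prod_(l <- ls) (1 - l%:R^-1 / 2).
have p20 : 0 <= p2.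
  rewrite /p2 big_seq prodr_ge0 // => l ll.
  have l2 := prime_natr_ge2 F (allP pls _ ll).
  have : l%:R^-1 <= 1 :> F by rewrite invf_le1 //; lra.
  lra.
have -> : (2 / 3) ^+ T * (P%:R * p2) * A = (7 * (X * P)%:R / i%:R * (2 / 3) ^+ T * p2) * sqf_inv_sum P.
  by rewrite /A natrM; ring.
rewrite [p1 * p2]mulrC mulrA ler_wpM2l ?sqf_inv_sum_prod_le // !mulr_ge0 ?invr_ge0 ?exprn_ge0 ?divr_ge0 //.
Qed.
End F.

Lemma prod_primes_gt0 ls : all prime ls -> (0 < \prod_(l <- ls) l)%N.
Proof.
by move=> pls; rewrite big_seq; apply: prodn_cond_gt0 => k /(allP pls)/prime_gt0.
Qed.

Lemma mem_dvd_prod l (ls : seq nat) : l \in ls -> (l %| \prod_(k <- ls) k)%N.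
Proof. by move=> ll; rewrite (big_rem l) //= dvdn_mulr. Qed.

Section F.
Variable F : realFieldType.
Local Notation sqf_inv_sum := (sqf_inv_sum F).

(** The contribution of [k] to [sqf_inv_sum (k * P)], kept as a divisor sum so that the summation
    over [k] can later be interchanged with it. *)
Definition coprime_inv_sum (P k : nat) : F := \sum_(d < k.+1 | (d %| k)%N && coprime d P) d%:R^-1.

Lemma sqf_inv_sum_mul_le k P : (0 < k)%N -> (0 < P)%N -> sqf_inv_sum (k * P) <= sqf_inv_sum P * coprime_inv_sum P k.
Proof.
move=> k0 P0.
pose B := [pred t : 'I_P.+1 * 'I_k.+1 | ((t.1 %| P)%N && squarefree t.1) && ((t.2 %| k)%N && coprime t.2 P)].
pose g (t : 'I_P.+1 * 'I_k.+1) := (t.1 * t.2)%N.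
have := @sum_cover F _ _ [pred e : 'I_(k * P).+1 | (e %| k * P)%N && squarefree e] B
   (fun e => e) g (fun n => n%:R^-1) _ val_inj _.
rewrite {1}/sqf_inv_sum => /(_ _ _)/le_trans; apply => [n|e|]; first by rewrite invr_ge0.
  case/andP=> ek /(split_squarefree P)[d [e' [eE sd se cd eP]]].
  have dk : (d %| k)%N by rewrite -(@Gauss_dvdl d _ P) // (dvdn_trans _ ek) // eE dvdn_mulr.
  have h1 : (e' < P.+1)%N by rewrite ltnS dvdn_leq.
  have h2 : (d < k.+1)%N by rewrite ltnS dvdn_leq.
  exists (Ordinal h1, Ordinal h2); last by rewrite /g /= eE mulnC.
  by apply/andP; split; apply/andP.
rewrite -(pair_big (fun e : 'I_P.+1 => (e %| P)%N && squarefree e)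
  (fun d : 'I_k.+1 => (d %| k)%N && coprime d P)
  (fun (e : 'I_P.+1) (d : 'I_k.+1) => (g (e, d))%:R^-1)) /= /sqf_inv_sum mulr_suml.
by apply: ler_sum => e _; rewrite /coprime_inv_sum mulr_sumr; apply: ler_sum => d _; rewrite /g /= natrM invfM.
Qed.

(* Rankin's trick with 2^(T - omega), for the values k m + 1 with k fixed. *)
Lemma count_prime_values ls N i T k : let P := (\prod_(l <- ls) l)%N in
  all prime ls -> uniq ls -> (0 < i)%N -> (0 < k)%N -> (2 ^ (8 * i) * (k * P) <= N)%N ->
  (\sum_(m < (N %/ k).+1) [&& prime (k * m + 1), (P < k * m + 1)%N & (omega ls (k * m) <= T)%N])%:R <=
  14 * (sqf_inv_sum P * coprime_inv_sum P k) * (N%:R / (k * P)%:R) / i%:R * 2 ^+ T *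
     \prod_(l <- ls) \sum_(b < l) omega_weight 2^-1 l (k * b) :> F.
Proof.
move=> P pls uls i0 k0 big; have P0 : (0 < P)%N := prod_primes_gt0 pls.
have kP0 : (0 < k * P)%N by rewrite muln_gt0 k0.
pose X := (N %/ (k * P)).+1.
have iX : (2 ^ (8 * i) <= X)%N by rewrite /X ltnW // ltnS leq_divRL.
(* Since k P <= N, rounding up at most doubles N / (k P); hence 14 instead of 7. *)
have XN : X%:R <= 2 * (N%:R / (k * P)%:R) :> F.
  rewrite mulrA ler_pdivlMr ?ltr0n // -!natrM ler_nat /X mulSn mul2n -addnn leq_add ?leq_divM //.
  by apply: leq_trans big; rewrite leq_pmull // expn_gt0.
pose c b := coprime (k * b).+1 P && (omega ls (k * b) <= T)%N.
have H1 : (\sum_(m < (N %/ k).+1) [&& prime (k * m + 1), P < k * m + 1 & omega ls (k * m) <= T] <=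
    \sum_(b < P) c b * \sum_(m < X) prime (k * P * m + (k * b + 1)))%N.
  have NX : (N %/ k < X * P)%N by rewrite /X divnMA ltn_ceil.
  pose h m := [&& prime (k * m + 1), P < k * m + 1 & omega ls (k * m) <= T]%N.
  apply: (@leq_trans (\sum_(m < X * P) h m)%N).
    rewrite -!(big_mkord xpredT (fun n => h n : nat)).
    by rewrite [leqRHS](@big_cat_nat _ _ _ (N %/ k).+1) //= leq_addr.
  rewrite (sum_ord_mul _ _ (fun n => h n : nat)) exchange_big /=.
  apply: leq_sum => b _; rewrite big_distrr; apply: leq_sum => j _ /=.
  rewrite /h; have E : (k * (j * P + b) + 1 = k * P * j + (k * b + 1))%N by lia.
  rewrite E; case pr: (prime _) => //=; rewrite muln1 /c.
  case: ltnP => //= lt; have -> : omega ls (k * (j * P + b)) = omega ls (k * b).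
    apply: omega_eq => l ll; rewrite mulnDr dvdn_addr // dvdn_mull // dvdn_mull //.
    exact: mem_dvd_prod.
  suff -> : coprime (k * b).+1 P by [].
  rewrite -addn1 coprime_sym /coprime -(gcdnMDl (k * j)) -mulnA [(j * P)%N]mulnC mulnA -/(coprime _ _).
  rewrite coprime_sym prime_coprime //.
  by apply/negP => /dvdn_leq; rewrite P0 => /(_ isT); rewrite leqNgt lt.
apply: (@le_trans _ _ (\sum_(b < P) c b * \sum_(m < X) prime (k * P * m + (k * b + 1)))%N%:R).
  by rewrite ler_nat.
rewrite natr_sum.
set A := 7 * sqf_inv_sum (k * P) * X%:R / i%:R.
have s0 Q : 0 <= sqf_inv_sum Q by apply: sumr_ge0 => *; rewrite invr_ge0.
have A0 : 0 <= A by rewrite /A !mulr_ge0 ?invr_ge0.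
have h0 : 0 <= 2^-1 :> F by rewrite invr_ge0.
apply: (@le_trans _ _ (\sum_(b < P) (2 ^+ T * \prod_(l <- ls) omega_weight 2^-1 l (k * b)) * A)).
  apply: ler_sum => b _; rewrite natrM.
  apply: ler_pM => //; last exact: brun_titchmarsh.
  rewrite /c; case: (boolP (coprime _ _)) => [cb|_] /=; last first.
    by rewrite mulr_ge0 ?exprn_ge0 // prodr_ge0 // => l _; apply: omega_weight_ge0.
  rewrite prod_wt //; case: leqP => [Tb|_] /=; last by rewrite mulr_ge0 ?exprn_ge0.
  by rewrite -(subnK Tb) exprD -mulrA -exprMn mulfV ?pnatr_eq0 // expr1n mulr1 exprn_ege1 // ler1n.
have kb l m : omega_weight (2^-1 : F) l (k * (m %% l)) = omega_weight 2^-1 l (k * m).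
  by rewrite -omega_weight_mod modnMmr omega_weight_mod.
rewrite -mulr_suml -mulr_sumr (@sum_crt _ _ (fun l b => omega_weight 2^-1 l (k * b))) //.
set g := \prod_(l <- ls) _; have g0 : 0 <= g.
  by apply: prodr_ge0 => l _; apply: sumr_ge0 => b _; apply: omega_weight_ge0.
set R := N%:R / _ in XN *.
have -> : 14 * (sqf_inv_sum P * coprime_inv_sum P k) * R / i%:R * 2 ^+ T * g = (2 ^+ T * g) * (7 * (sqf_inv_sum P * coprime_inv_sum P k) * (2 * R) / i%:R) by ring.
rewrite ler_wpM2l ?mulr_ge0 ?exprn_ge0 // /A ler_wpM2r ?invr_ge0 //.
by rewrite ler_pM ?mulr_ge0 // ler_wpM2l // sqf_inv_sum_mul_le.
Qed.

(** For fixed [k], the local factor at [l] of the moment of 2^(-omega(k m)) over those m with k m +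
    1 prime to [l]. *)
Definition sum_omega_weight (l k : nat) : F := \sum_(b < l) omega_weight 2^-1 l (k * b).

Lemma sum_omega_weight_mod l k : sum_omega_weight l (k %% l) = sum_omega_weight l k.
Proof. by apply: eq_bigr => b _; rewrite -omega_weight_mod modnMml omega_weight_mod. Qed.

(** If [l] divides [k], every product is 0 modulo [l] and has weight 1/2; otherwise the products run
    through all residues and [sum_wt] applies. *)
Lemma sum_omega_weightE l k : prime l -> sum_omega_weight l k = if (l %| k)%N then l%:R / 2 else l%:R - 3 / 2.
Proof.
move=> pl; have l1 := prime_gt1 pl; case: ifP => lk.
  rewrite /sum_omega_weight (eq_bigr (fun=> 2^-1)) ?sumr_const ?card_ord => [|b _]; first by rewrite mulr_natl.
  by rewrite /omega_weight -addn1 dvdn_addr ?dvdn_mulr // gtnNdvd.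
rewrite -[RHS](_ : l%:R - 2 + 2^-1 = _); last by field.
rewrite -(sum_wt (2^-1) l1) -(@sum_affine_mod _ l k 0 (omega_weight 2^-1 l)).
- by apply: eq_bigr => b _; rewrite addn0.
- by rewrite coprime_sym prime_coprime // lk.
- exact: omega_weight_mod.
Qed.

Lemma sum_omega_weight_ge0 l k : 0 <= sum_omega_weight l k.
Proof. by apply: sumr_ge0 => b _; apply: omega_weight_ge0; rewrite invr_ge0. Qed.

(** One class of [k] contributes l / 2, the other l - 1 contribute l - 3/2 each. Relative to l^2
    this is about 1 - 2 / l: half of the probability 2 / l that l divides k m, and 1 / l for the
    excluded class k m = -1. *)
Lemma sum_gw ls : all prime ls -> uniq ls ->
  \sum_(k < \prod_(l <- ls) l) \prod_(l <- ls) sum_omega_weight l k = \prod_(l <- ls) (l%:R ^+ 2 - 2 * l%:R + 3 / 2).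
Proof.
move=> pls uls; rewrite sum_crt //; last by move=> l m _; rewrite sum_omega_weight_mod.
apply: eq_big_seq => l ll; have pl := allP pls _ ll.
rewrite (eq_bigr (fun k : 'I_l => if (l %| k)%N then l%:R / 2 else l%:R - 3 / 2)); last first.
  by move=> k _; rewrite sum_omega_weightE.
have l2 := prime_gt1 pl; case: l {ll pl} l2 => // l l2; rewrite big_ord_recl dvdn0.
rewrite (eq_bigr (fun=> l.+1%:R - 3 / 2)); last first.
  by move=> k _; rewrite gtnNdvd // lift0 ltnS ltn_ord.
rewrite sumr_const card_ord -[_ *+ l]mulr_natl -[l.+1]addn1 natrD; by field.
Qed.

Lemma harm_le Y D : (0 < D)%N -> \sum_(d < Y.+1) d%:R^-1 <= D%:R + Y.+1%:R / D%:R :> F.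
Proof.
move=> D0; apply: (@le_trans _ _ (\sum_(d < Y.+1) ((d < D)%:R + D%:R^-1))).
  apply: ler_sum => d _; case: ltnP => dD /=.
    have [->|d0] := posnP d; first by rewrite invr0 addr_ge0 // invr_ge0.
    have : d%:R^-1 <= 1 :> F by rewrite invf_le1 ?ltr0n // ler1n.
    have : 0 <= D%:R^-1 :> F by rewrite invr_ge0.
    lra.
  by rewrite add0r lef_pV2 ?posrE ?ltr0n ?ler_nat // (leq_trans D0).
rewrite big_split /= sumr_const card_ord mulr_natl lerD //.
by rewrite -natr_sum ler_nat sum_ltn_le.
Qed.

(** Interchanging the sums leaves, for each d coprime to P, the sum of G over the multiples of d. As
    G(d k) = G(k) depends only on k modulo P, this amounts to about Y / (d P) periods. *)
Lemma sum_tau_gw ls Y : let P := (\prod_(l <- ls) l)%N in all prime ls -> uniq ls ->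
  (16 * P ^ 2 < Y)%N ->
  \sum_(k < Y.+1 | (0 < k)%N) coprime_inv_sum P k * \prod_(l <- ls) sum_omega_weight l k <=
  4 * (Y%:R / P%:R) * \prod_(l <- ls) (l%:R ^+ 2 - 2 * l%:R + 3 / 2).
Proof.
move=> P pls uls PY; have P0 : (0 < P)%N := prod_primes_gt0 pls.
pose G k := \prod_(l <- ls) sum_omega_weight l k.
set Gam := \prod_(l <- ls) (l%:R ^+ 2 - 2 * l%:R + 3 / 2 : F); have GamE : Gam = \sum_(k < P) G k by rewrite /Gam -sum_gw.
have G0 k : 0 <= G k by apply: prodr_ge0 => l _; apply: sum_omega_weight_ge0.
have Gam0 : 0 <= Gam by rewrite GamE sumr_ge0.
have Gper k : G (k %% P)%N = G k.
  apply: eq_big_seq => l ll; rewrite -sum_omega_weight_mod modn_dvdm ?sum_omega_weight_mod //; exact: mem_dvd_prod.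
have Gd d k : coprime d P -> G (d * k)%N = G k.
  move=> cd; apply: eq_big_seq => l ll; rewrite !sum_omega_weightE ?(allP pls _ ll) //.
  rewrite Gauss_dvdr //; apply: coprime_dvdl (mem_dvd_prod ll) _.
  by rewrite coprime_sym.
apply: (@le_trans _ _ (\sum_(d < Y.+1 | (0 < d)%N && coprime d P) d%:R^-1 * \sum_(k < Y.+1 | (d %| k)%N) G k)).
  apply: (@le_trans _ _ (\sum_(k < Y.+1 | (0 < k)%N) \sum_(d < Y.+1 | (0 < d)%N && coprime d P)
     (if (d %| k)%N then d%:R^-1 * G k else 0))).
    apply: ler_sum => k k0; rewrite /coprime_inv_sum mulr_suml.
    rewrite (big_ord_widen_cond Y.+1 (fun d => (d %| k)%N && coprime d P) (fun d => d%:R^-1 * G k)) //.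
    rewrite [leLHS]big_mkcond [leRHS]big_mkcond /=; apply: ler_sum => d _.
    case: (boolP (d %| k)%N) => [dk|_] /=; last by case: ifP.
    rewrite (dvdn_gt0 k0 dk) /=; case: ifP => [/andP[-> _]//|_]; case: ifP => // _.
    by rewrite mulr_ge0 ?invr_ge0.
  rewrite exchange_big /=; apply: ler_sum => d /andP[d0 _]; rewrite mulr_sumr.
  rewrite [leLHS]big_mkcond [leRHS]big_mkcond; apply: ler_sum => k _.
  by do 2 case: ifP => //; rewrite mulr_ge0 ?invr_ge0.
have H d : (0 < d)%N -> coprime d P -> \sum_(k < Y.+1 | (d %| k)%N) G k <= (Y%:R / P%:R * d%:R^-1 + 2) * Gam.
  move=> d0 cd; apply: (@le_trans _ _ (\sum_(j < (Y %/ d).+1) G j)).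
    have := @sum_cover F _ _ [pred k : 'I_Y.+1 | (d %| k)%N] (predT : pred 'I_(Y %/ d).+1)
       (fun k => k) (fun j => d * j)%N G G0 val_inj.
    move=> /(_ _)/le_trans; apply; last by apply: ler_sum => j _; rewrite Gd.
    move=> k /= /dvdnP[j kE]; have jY : (j < (Y %/ d).+1)%N.
      by rewrite ltnS leq_divRL // -kE -ltnS ltn_ord.
    by exists (Ordinal jY); rewrite //= kE mulnC.
  apply: le_trans (sum_periods_le _ P0 Gper G0) _.
  rewrite -GamE -[leLHS]mulr_natl ler_wpM2r //.
  have dP : 0 < d%:R * P%:R :> F by rewrite -natrM ltr0n muln_gt0 d0.
  rewrite (_ : Y%:R / P%:R * d%:R^-1 + 2 = (Y%:R + 2 * (d%:R * P%:R)) / (d%:R * P%:R)); last first.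
    have dn : d%:R != 0 :> F by rewrite pnatr_eq0 -lt0n.
    have Pn : P%:R != 0 :> F by rewrite pnatr_eq0 -lt0n.
    by field; rewrite Pn.
  rewrite ler_pdivlMr // -!natrM -natrD ler_nat.
  have := leq_divM (Y %/ d).+1 P; have := leq_divM Y d; nia.
apply: (@le_trans _ _ (\sum_(d < Y.+1 | (0 < d)%N) d%:R^-1 * ((Y%:R / P%:R * d%:R^-1 + 2) * Gam))).
  rewrite [leLHS]big_mkcond [leRHS]big_mkcond; apply: ler_sum => d _.
  have i0 : 0 <= d%:R^-1 :> F by rewrite invr_ge0.
  have [->//|d0] := posnP d; case: ifP => /= [cd|_].
    by rewrite ler_wpM2l // H.
  by rewrite !mulr_ge0 // addr_ge0 // !mulr_ge0 // invr_ge0.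
rewrite (eq_bigr (fun d : 'I_Y.+1 => (Y%:R / P%:R * Gam) * (d ^ 2)%:R^-1 + 2 * Gam * d%:R^-1)); last first.
  by move=> d d0; rewrite natrX -exprVn; ring.
rewrite big_split /= -!mulr_sumr.
have S1 : \sum_(d < Y.+1 | (0 < d)%N) (d ^ 2)%:R^-1 <= 2 :> F.
  rewrite big_mkcond big_ord_recl /= add0r; apply: le_trans (sum_inv_sqr F Y).
  by apply: ler_sum => d _.
have S2 : \sum_(d < Y.+1 | (0 < d)%N) d%:R^-1 <= Y%:R / P%:R :> F.
  apply: (@le_trans _ _ (\sum_(d < Y.+1) d%:R^-1)).
    by rewrite big_mkcond; apply: ler_sum => d _; case: ifP => // _; rewrite invr_ge0.
  (* With D = 4 P the bound is 4 P + (Y + 1) / (4 P), which is below Y / P because 16 P^2 < Y. *)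
  apply: le_trans (harm_le Y (_ : 0 < 4 * P)%N) _; first by rewrite muln_gt0.
  have Pr : (0 : F) < P%:R by rewrite ltr0n.
  rewrite -subr_ge0 (_ : _ - _ = (3 * Y%:R - 16 * P%:R ^+ 2 - 1) / (4 * P%:R)); last first.
    by rewrite natrM -natr1; field; rewrite gt_eqF.
  rewrite divr_ge0 ?mulr_ge0 ?ler0n //.
  have : (16 * P ^ 2 + 1)%:R <= Y%:R :> F by rewrite ler_nat addn1.
  have : (1 : F) <= Y%:R by rewrite ler1n; apply: leq_ltn_trans PY.
  rewrite natrD natrM natrX; lra.
have a0 : 0 <= Y%:R / P%:R * Gam by rewrite !mulr_ge0 ?invr_ge0.
have := ler_wpM2l a0 S1; have := ler_wpM2l (_ : 0 <= 2 * Gam) S2.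
move=> /(_ (mulr_ge0 _ Gam0)) -/(_ (ler0n _ _)); lra.
Qed.
End F.

(** * Elementary prime counting *)

Section PrimeCounting.
Local Open Scope nat_scope.

Lemma dvdn_pred_expn q a k : 0 < a -> (q %| a ^ k - 1) = (a ^ k == 1 %[mod q]).
Proof. by move=> a0; rewrite eqn_mod_dvd // expn_gt0 a0. Qed.

Lemma dvdn_pred_expn_gcd q a m n : 0 < a -> 0 < m ->
  q %| a ^ m - 1 -> q %| a ^ n - 1 -> q %| a ^ gcdn m n - 1.
Proof.
move=> a0 m0; rewrite !dvdn_pred_expn // => /eqP am /eqP an.
have [u v E _] := egcdnP n m0.
have /(congr1 (modn^~ q)) : a ^ (u * m) = a ^ (v * n) * a ^ gcdn m n by rewrite E expnD.
rewrite mulnC expnM -modnXm am modnXm exp1n -modnMml [v * n]mulnC expnM -modnXm an modnXm exp1n.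
by rewrite modnMml mul1n => ->.
Qed.

Lemma dvdn_pred_expn_prime q a k : prime q -> 0 < a -> 0 < k -> q %| a ^ k - 1 -> q %| a ^ q.-1 - 1.
Proof.
move=> pq a0 k0 qa; rewrite dvdn_pred_expn // -(totient_prime pq).
apply/eqP/Euler_exp_totient; rewrite coprime_sym prime_coprime //; apply/negP => qd.
have : q %| a ^ k by rewrite (dvdn_trans qd) // -{1}(expn1 a) dvdn_exp2l.
rewrite -(subnK (_ : 1 <= a ^ k)) ?expn_gt0 ?a0 // dvdn_addr // dvdn1.
by move/eqP => q1; rewrite q1 in pq.
Qed.

(** The primes in question are distinct divisors of the product of the a^k - 1 with k <= K, which is
    at most 2^(a K^2), while each exceeds the square root of [N]. *)
Lemma count_prime_small_order a K N (Q : pred nat) : 1 < a ->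
  (forall q, Q q -> [/\ prime q, N < q ^ 2 & exists2 k, 0 < k <= K & q %| a ^ k - 1]) ->
  (\sum_(q < N.+1) Q q) * trunc_log 2 N <= 2 * a * K ^ 2.
Proof.
move=> a1 HQ; have [->|N0] := posnP N; first by rewrite trunc_log0 muln0.
pose s := [seq q <- iota 0 N.+1 | Q q].
have us : uniq s by rewrite filter_uniq ?iota_uniq.
have ps : all prime s by apply/allP => q; rewrite mem_filter => /andP[/HQ[]].
have -> : \sum_(q < N.+1) Q q = size s.
  rewrite size_filter -sum1_count -(big_mkord xpredT (fun q => Q q : nat)) /index_iota subn0.
  by rewrite [RHS]big_mkcond; apply: eq_bigr => q _; case: (Q q).
pose M := \prod_(k < K) (a ^ k.+1 - 1).
have M0 : 0 < M.
  by apply: prodn_gt0 => k; rewrite subn_gt0 -(exp1n k.+1) ltn_exp2r.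
have sM : \prod_(q <- s) q <= M.
  apply: dvdn_leq => //; apply: uniq_primes_prod_dvd => // q.
  rewrite mem_filter => /andP[/HQ[_ _ [[//|k] /andP[_ kK] qk]] _].
  by apply: dvdn_trans qk _; rewrite /M (bigD1 (Ordinal kK)) //= dvdn_mulr.
have MK : M <= 2 ^ (a * K ^ 2).
  apply: (@leq_trans (\prod_(k < K) (2 ^ (a * K)))).
    apply: leq_prod => k _; apply: leq_trans (leq_subr _ _) _.
    apply: (@leq_trans ((2 ^ a) ^ k.+1)); first by rewrite leq_exp2r // ltnW // ltn_expl.
    by rewrite -expnM leq_pexp2l // leq_mul2l ltn_ord orbT.
  by rewrite prod_nat_const card_ord -expnM -mulnA.
have sN : 2 ^ (size s * trunc_log 2 N) <= (\prod_(q <- s) q) ^ 2.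
  have: all (fun q => N < q ^ 2) s by apply/allP => q; rewrite mem_filter => /andP[/HQ[]].
  elim: (s) => [|q t IH] /=; first by rewrite big_nil.
  case/andP => Nq /IH IHt; rewrite big_cons expnMn mulSn expnD leq_mul //.
  by rewrite (leq_trans (trunc_logP _ _)) // ltnW.
rewrite -(@leq_exp2l 2) //; apply: leq_trans sN _.
by rewrite -mulnA mulnC expnM leq_exp2r // (leq_trans sM).
Qed.

Definition primepi (N : nat) := \sum_(p < N.+1) prime p.

(** By Legendre's formula the exponent is a sum of terms floor(2 n / p^k) - 2 floor(n / p^k), each
    at most 1 and zero once p^k > 2 n. *)
Lemma expn_logn_central p n : prime p -> 0 < n -> p ^ logn p 'C(2 * n, n) <= 2 * n.
Proof.
move=> pp n0; set b := 'C(_, _).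
have b0 : 0 < b by rewrite bin_gt0; lia.
have E : logn p b + (logn p n`! + logn p n`!) = logn p (2 * n)`!.
  rewrite -lognM ?fact_gt0 // -lognM ?muln_gt0 ?fact_gt0 //.
  by rewrite -(@bin_fact (2 * n) n) ?leq_pmull // (_ : 2 * n - n = n) //; lia.
have t1 := prime_gt1 pp; set t := trunc_log p (2 * n).
have pt : p ^ t <= 2 * n by apply: trunc_logP => //; rewrite muln_gt0.
suff le : logn p b <= t by rewrite (leq_trans _ pt) // leq_exp2l.
rewrite -(leq_add2r (logn p n`! + logn p n`!)) E !logn_fact //.
have W m : m <= 2 * n -> \sum_(1 <= k < m.+1) m %/ p ^ k = \sum_(1 <= k < (2 * n).+1) m %/ p ^ k.
  move=> mn; rewrite [RHS](@big_cat_nat _ _ _ m.+1) //= [X in _ + X]big_nat [X in _ + X]big1 ?addn0 // => k.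
  by case/andP=> mk _; rewrite divn_small // (leq_trans mk) // ltnW // ltn_expl.
rewrite (W n) ?leq_pmull // -big_split /= -[t]subn0.
have tn : t <= 2 * n by rewrite (leq_trans _ pt) // ltnW // ltn_expl.
have -> : t - 0 = \sum_(1 <= k < (2 * n).+1) (k <= t).
  rewrite (@big_cat_nat _ _ _ t.+1) //= [X in _ + X]big_nat [X in _ + X]big1 => [|k /andP[tk _]]; last first.
    by rewrite leqNgt tk.
  rewrite addn0 big_nat (eq_bigr (fun=> 1)) => [|k /andP[_ kt]]; last by rewrite -ltnS kt.
  by rewrite -big_nat sum_nat_const_nat subn1 muln1 subn0.
rewrite -big_split /= leq_sum // => k _.
have p0 : 0 < p ^ k by rewrite expn_gt0 prime_gt0.
have [kt|tk] := leqP k t.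
  suff : 2 * n %/ p ^ k < 2 * (n %/ p ^ k).+1 by lia.
  rewrite ltn_divLR //; have := ltn_ceil n p0; nia.
rewrite [X in X <= _]divn_small //.
by rewrite (leq_trans (trunc_log_ltn (2 * n) t1)) // leq_exp2l.
Qed.

Lemma expn2_central n : 2 ^ n <= 'C(2 * n, n).
Proof.
elim: n => // n IH; rewrite expnS (leq_trans (leq_mul (leqnn 2) IH)) //.
have -> : 2 * n.+1 = (2 * n).+2 by lia.
rewrite binS mul2n -addnn leq_add //; first by rewrite binS leq_addl.
by case: n {IH} => // n; rewrite binS leq_addr.
Qed.

(** Follows from 2^n <= C(2 n, n) <= (2 n)^pi(N) with n = floor(N / 2). *)
Lemma chebyshev N : 1 < N -> N <= 6 * primepi N * trunc_log 2 N.
Proof.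
move=> N1; have [n n0 Nn] : exists2 n, 0 < n & 2 * n <= N <= 2 * n + 1.
  by exists (N %/ 2); have := divn_eq N 2; have := ltn_pmod N (isT : 0 < 2); lia.
set b := 'C(2 * n, n).
have b0 : 0 < b by rewrite bin_gt0; lia.
have b2 : 2 ^ n <= b := expn2_central n.
have pi0 : 0 < primepi N by rewrite /primepi (bigD1 (Ordinal (N1 : 2 < N.+1))).
have bp : b <= (2 * n) ^ primepi N.
  rewrite (prod_prime_decomp b0) prime_decompE big_map /=.
  apply: (@leq_trans (\prod_(p <- primes b) (2 * n))).
    rewrite big_seq [leqRHS]big_seq; apply: leq_prod => p.
    by rewrite mem_primes => /andP[pp _]; apply: expn_logn_central.
  rewrite big_const_seq count_predT iter_muln_1 leq_pexp2l ?muln_gt0 //.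
  have -> : primepi N = size [seq p <- iota 0 N.+1 | prime p].
    rewrite size_filter -sum1_count /primepi -(big_mkord xpredT (fun q => prime q : nat)) /index_iota subn0.
    by rewrite [RHS]big_mkcond; apply: eq_bigr => q _; case: prime.
  apply: uniq_leq_size; first exact: primes_uniq.
  move=> p pb; have := pb; rewrite mem_primes => /andP[pp _].
  rewrite mem_filter pp mem_iota add0n ltnS /=.
  apply: (@leq_trans (p ^ logn p b)).
    by rewrite -{1}(expn1 p) leq_exp2l ?prime_gt1 // logn_gt0.
  by apply: leq_trans (expn_logn_central pp n0) _; case/andP: Nn.
have : 2 ^ n <= 2 ^ ((trunc_log 2 N).+1 * primepi N).
  apply: leq_trans b2 (leq_trans bp _); rewrite expnM leq_exp2r ?pi0 // ltnW //.
  by rewrite (leq_ltn_trans _ (trunc_log_ltn N _)) //; case/andP: Nn.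
rewrite leq_exp2l // => h; have l0 : 0 < trunc_log 2 N by rewrite trunc_log_gt0.
nia.
Qed.

End PrimeCounting.

(** * Primes modulo which an integer has small order *)

(** The order of [a] modulo [q] is at most the square root of [C * q]; bounding k makes this
    boolean, so that it can be summed. *)
Definition small_order (a C q : nat) :=
  [exists k : 'I_(C * q).+1, [&& (0 < k)%N, (k ^ 2 <= C * q)%N & (q %| a ^ k - 1)%N]].

Lemma small_orderP a C q :
  reflect (exists k, [/\ 0 < k, k ^ 2 <= C * q & q %| a ^ k - 1]%N) (small_order a C q).
Proof.
apply: (iffP existsP) => [[k /and3P[]]|[k [k0 kC qk]]]; first by exists (k : nat).
have h : (k < (C * q).+1)%N by rewrite ltnS (leq_trans _ kC) // expnS expn1 leq_pmulr.
by exists (Ordinal h); rewrite /= k0 kC qk.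
Qed.

(** By Fermat, gcd(k, q - 1) is again a multiple of the order. This provides the factorization q - 1
    = k m. *)
Lemma small_order_dvd a C q : (1 < a)%N -> prime q -> small_order a C q ->
  exists k, [/\ 0 < k, k ^ 2 <= C * q, q %| a ^ k - 1 & k %| q.-1]%N.
Proof.
move=> a1 pq /small_orderP[k [k0 kC qk]]; exists (gcdn k q.-1).
have a0 := ltnW a1; have q0 : (0 < q.-1)%N by have := prime_gt1 pq; lia.
split; rewrite ?gcdn_gt0 ?k0 ?dvdn_gcdr //.
  by apply: leq_trans kC; rewrite leq_exp2r // dvdn_leq ?dvdn_gcdl.
by apply: dvdn_pred_expn_gcd => //; apply: dvdn_pred_expn_prime pq a0 k0 qk.
Qed.

Section F.
Variable F : realFieldType.
Local Notation sqf_inv_sum := (sqf_inv_sum F).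

(** Four kinds of primes: those up to P or sqrt N; those with an order k such that k H <= s; those
    for which q - 1 has at least [T] divisors in [ls]; and those with q - 1 = k m, k H > s and fewer
    than [T] such divisors, summed over k. The witness [s] is the integer square root of [N], and 3
    s collects 2 P + s. *)
Lemma count_small_order a C H ls T N i : let P := (\prod_(l <- ls) l)%N in
  let lam := trunc_log 2 N in
  (1 < a)%N -> (0 < C)%N -> (0 < H)%N -> all prime ls -> uniq ls ->
  (24 * i <= lam)%N -> (16 * C ^ 2 * P ^ 2 <= i)%N ->
  exists s : nat, [/\ (s ^ 2 <= N)%N, (2 ^ (8 * i) <= s)%N, (P <= s)%N &
  (\sum_(q < N.+1) (prime q && small_order a C q))%:R <=
  (3 * s)%:R + (2 * a)%:R * N%:R / (H%:R ^+ 2 * lam%:R)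
  + 14 * (N%:R / i%:R) * ((2 / 3) ^+ T * \prod_(l <- ls) ((1 + l%:R^-1) * (1 - l%:R^-1 / 2)))
  + 56 * C%:R * H%:R * (N%:R / i%:R) * (2 ^+ T * \prod_(l <- ls) ((1 + l%:R^-1) * (1 - 2 * l%:R^-1 + 3 / 2 * l%:R^-1 ^+ 2))) :> F].
Proof.
move=> P lam a1 C0 H0 pls uls ilam iP.
have P0 : (0 < P)%N := prod_primes_gt0 pls.
have i0 : (0 < i)%N by apply: leq_trans iP; rewrite !muln_gt0 ?expn_gt0 C0 P0.
have N0 : (0 < N)%N by case: posnP ilam => // E; rewrite /lam E trunc_log0 leqNgt muln_gt0 i0.
have lam0 : (0 < lam)%N by rewrite (leq_trans _ ilam) // muln_gt0 i0.
pose z := (2 ^ (8 * i))%N.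
(* The moduli k P below reach a constant times sqrt N; z <= N^(1/3) ensures that the progressions
   still have at least z terms. *)
have z3N : (z ^ 3 <= N)%N.
  apply: leq_trans (trunc_logP (isT : 1 < 2)%N N0); by rewrite /z -expnM leq_exp2l // mulnAC.
have iz : (i < z)%N by rewrite (leq_trans (ltn_expl i (isT : 1 < 2)%N)) // /z leq_exp2l // leq_pmull.
have [s /andP[sN Ns]] := sqrtn_ex N.
have zs : (z <= s)%N.
  rewrite -ltnS -(ltn_exp2r _ _ (isT : 0 < 2)%N); apply: leq_ltn_trans Ns.
  by apply: leq_trans z3N; rewrite leq_pexp2l // expn_gt0.
have P2 : (P <= P ^ 2)%N by rewrite expnS expn1 leq_pmulr.
have C2 : (C <= C ^ 2)%N by rewrite expnS expn1 leq_pmulr.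
have CPi : (C ^ 2 * P ^ 2 <= i)%N by rewrite (leq_trans _ iP) // -mulnA leq_pmull.
have Pi : (P <= i)%N by rewrite (leq_trans P2) // (leq_trans _ CPi) // leq_pmull // expn_gt0 C0.
have Pz : (P <= z)%N := leq_trans Pi (ltnW iz).
have Ps : (P <= s)%N := leq_trans Pz zs.
exists s; split => //.
(* [K] bounds the orders treated through divisors of a^k - 1, and [Y] bounds all k, since k^2 <= C q
   <= C N < (C u)^2. *)
set u := s.+1; pose Y := (C * u)%N; pose K := (s %/ H)%N.
pose Iq q := [&& prime q, (N < q ^ 2)%N & [exists k : 'I_K.+1, (0 < k)%N && (q %| a ^ k - 1)%N]].
pose Aq n := prime n.+1 && (T <= omega ls n)%N.
pose h k m := [&& prime (k * m + 1), (P < k * m + 1)%N & (omega ls (k * m) <= T)%N].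
pose rk k := (0 < k)%N && (u <= k * H)%N.
have bnd : (\sum_(q < N.+1) (prime q && small_order a C q) <=
   P + s + \sum_(q < N.+1) Iq q + \sum_(n < N) Aq n
   + \sum_(k < Y.+1 | rk k) \sum_(m < (N %/ k).+1) h k m)%N.
  apply: (@leq_trans (\sum_(q < N.+1) ((0 < q <= P) + (0 < q <= s) + Iq q + ((0 < q) && Aq q.-1) +
     \sum_(k < Y.+1 | rk k) \sum_(m < (N %/ k).+1) (h k m && (q == k * m + 1 :> nat))))%N).
    apply: leq_sum => q _; case pq: (prime q) => //=; case so: (small_order _ _ _) => //.
    have q0 := prime_gt0 pq; rewrite q0 /=.
    case: (leqP q P) => //= Pq; case: (leqP q s) => //= sq.
    have Nq : (N < q ^ 2)%N by apply: leq_trans Ns _; rewrite leq_exp2r.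
    have [k [k0 kC qk kq]] := small_order_dvd a1 pq so.
    have [kH|Hk] := leqP (k * H) s.
      suff -> : Iq q by [].
      rewrite /Iq pq Nq; apply/existsP.
      have kK : (k < K.+1)%N by rewrite ltnS /K leq_divRL.
      by exists (Ordinal kK); rewrite /= k0 qk.
    rewrite {1}/Aq prednK // pq /=; case: (leqP T) => [_|Tw]; first by rewrite addn1 addSn.
    have qN : (q <= N)%N by rewrite -ltnS ltn_ord.
    have kY : (k < Y.+1)%N.
      rewrite ltnS -(leq_exp2r _ _ (isT : 0 < 2)%N) (leq_trans kC) // /Y expnMn.
      apply: leq_mul => //; apply: leq_trans (ltnW Ns); exact: qN.
    have /dvdnP[m qE] := kq.
    have qE1 : q = (k * m + 1)%N :> nat by rewrite mulnC -qE addn1 prednK.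
    have mN : (m < (N %/ k).+1)%N by rewrite ltnS leq_divRL // (leq_trans _ qN) // qE1 mulnC leq_addr.
    rewrite (bigD1 (Ordinal kY)) /=; last by rewrite /rk k0.
    rewrite (bigD1 (Ordinal mN)) //= -qE1 eqxx andbT /h -qE1 pq Pq /= mulnC -qE (ltnW Tw).
    by rewrite ltn_addl // ltn_addr // ltn_addr.
  rewrite !big_split /= !leq_add //.
  - rewrite big_ord_recl add0n; apply: leq_trans (sum_ltn_le N P).
    by apply: leq_sum => q _; rewrite lift0.
  - rewrite big_ord_recl add0n; apply: leq_trans (sum_ltn_le N s).
    by apply: leq_sum => q _; rewrite lift0.
  - by rewrite big_ord_recl add0n; apply: leq_sum => q _; rewrite lift0.
  rewrite exchange_big; apply: leq_sum => k _; rewrite exchange_big; apply: leq_sum => m _ /=.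
  case hk: (h k m) => /=; last by rewrite big1.
  have [le|gt] := leqP (k * m + 1) N.
    rewrite (bigD1 (Ordinal (le : k * m + 1 < N.+1)%N)) //= eqxx big1 // => q.
    by rewrite -val_eqE /= => /negbTE->.
  by rewrite big1 // => q _; rewrite ltn_eqF // (leq_trans (ltn_ord q)).
have HI : ((\sum_(q < N.+1) Iq q) * lam <= 2 * a * K ^ 2)%N.
  apply: count_prime_small_order => // q /and3P[pq Nq /existsP[k /andP[k0 qk]]]; split=> //.
  by exists (k : nat); rewrite // k0 -ltnS ltn_ord.
have i0' : (0 : F) < i%:R by rewrite ltr0n.
have Pr0 : (0 : F) < P%:R by rewrite ltr0n.
have ur0 : (0 : F) < u%:R by rewrite ltr0n.
have HIr : (\sum_(q < N.+1) Iq q)%:R <= (2 * a)%:R * N%:R / (H%:R ^+ 2 * lam%:R) :> F.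
  rewrite ler_pdivlMr ?mulr_gt0 ?exprn_gt0 ?ltr0n //.
  rewrite -natrX -!natrM ler_nat mulnCA mulnA.
  apply: (@leq_trans (H ^ 2 * (2 * a * K ^ 2))); first by rewrite -mulnA leq_mul2l HI orbT.
  rewrite mulnCA leq_mul2l -expnMn; apply/orP; right.
  by apply: leq_trans sN; rewrite leq_exp2r // /K mulnC leq_divM.
have zPN : (z * P <= N)%N.
  apply: leq_trans z3N; rewrite (expnD z 1 2) expn1 leq_mul2l; by rewrite (leq_trans Pz) ?orbT // expnS expn1 leq_pmulr // expn_gt0.
have HA := @prime_count_omega_ge F ls N i T pls uls i0.
have {}HA := HA (leq_trans _ (leqnSn _)).
have zX : (2 ^ (8 * i) <= N %/ P)%N by rewrite leq_divRL.
have {HA} := HA zX; rewrite -/P => HA.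
set pA := \prod_(l <- ls) _ in HA *.
have pA0 : 0 <= pA.
  rewrite /pA big_seq prodr_ge0 // => l ll.
  have l2 := prime_natr_ge2 F (allP pls _ ll).
  have l3 : l%:R^-1 <= 1 :> F by rewrite invf_le1 //; lra.
  have l4 : 0 <= l%:R^-1 :> F by rewrite invr_ge0.
  rewrite mulr_ge0 //; lra.
have {}HA : (\sum_(n < N) Aq n)%:R <= P%:R + 14 * (N%:R / i%:R) * ((2 / 3) ^+ T * pA).
  apply: le_trans HA _; rewrite lerD2l [leRHS]mulrA ler_wpM2r // ler_wpM2r ?exprn_ge0 ?divr_ge0 //.
  rewrite [leRHS]mulrA ler_wpM2r ?invr_ge0 // (_ : 14 * N%:R = 7 * (2 * N)%:R :> F); last by rewrite natrM; ring.
  rewrite ler_wpM2l // ler_nat.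
  by rewrite mulSn mul2n -addnn leq_add ?leq_divM // (leq_trans _ zPN) // leq_pmull // expn_gt0.
have zkN k : (k <= Y)%N -> (2 ^ (8 * i) * (k * P) <= N)%N.
  move=> kY; rewrite -(leq_exp2r _ _ (isT : 0 < 2)%N).
  have u2 : (u ^ 2 <= 4 * N)%N.
    apply: leq_trans (_ : (2 * s) ^ 2 <= _)%N; first by rewrite leq_exp2r // mul2n -addnn /u -addn1 leq_add2l (leq_trans P0).
    by rewrite expnMn leq_mul2l sN orbT.
  have h1 : ((2 ^ (8 * i) * (k * P)) ^ 2 <= z ^ 2 * ((C * P) ^ 2 * u ^ 2))%N.
    rewrite -!expnMn leq_exp2r // leq_mul2l mulnAC leq_mul2r; apply/orP; right.
    by apply/orP; right.
  apply: leq_trans h1 _; rewrite !expnMn.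
  have h2 : (C ^ 2 * P ^ 2 * 4 <= z)%N.
    rewrite (_ : C ^ 2 * P ^ 2 * 4 = 4 * C ^ 2 * P ^ 2)%N; last by rewrite mulnC mulnA.
    by rewrite (leq_trans _ (ltnW iz)) // (leq_trans _ iP) // !leq_mul2r !orbT.
  have h3 : (z ^ 2 * (C ^ 2 * P ^ 2 * 4) <= N)%N.
    by apply: leq_trans z3N; rewrite (expnD z 2 1) expn1 leq_mul2l h2 orbT.
  apply: (@leq_trans (z ^ 2 * (C ^ 2 * P ^ 2 * (4 * N)))).
    by rewrite !leq_mul2l u2 !orbT.
  rewrite (_ : (z ^ 2 * _ = z ^ 2 * (C ^ 2 * P ^ 2 * 4) * N)%N); last by rewrite !mulnA.
  by rewrite -(mulnn N) leq_mul2r h3 orbT.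
set pB := \prod_(l <- ls) ((1 + l%:R^-1) * (1 - 2 * l%:R^-1 + 3 / 2 * l%:R^-1 ^+ 2)).
have HB : (\sum_(k < Y.+1 | rk k) \sum_(m < (N %/ k).+1) h k m)%:R <=
   56 * C%:R * H%:R * (N%:R / i%:R) * (2 ^+ T * pB) :> F.
  have is0 Q : 0 <= sqf_inv_sum Q by apply: sumr_ge0 => *; rewrite invr_ge0.
  have gp0 k : 0 <= \prod_(l <- ls) sum_omega_weight F l k by apply: prodr_ge0 => l _; apply: sum_omega_weight_ge0.
  have t0 k : 0 <= coprime_inv_sum F P k by apply: sumr_ge0 => *; rewrite invr_ge0.
  (* The factor 1 / k is replaced by H / u, which is legitimate as k H >= u; over the range up to Y
     = C u this costs the factor C H. *)
  set c := 14 * sqf_inv_sum P * (N%:R / P%:R) * (H%:R / u%:R) / i%:R * 2 ^+ T.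
  have c0 : 0 <= c by rewrite /c !mulr_ge0 ?invr_ge0 ?exprn_ge0.
  apply: (@le_trans _ _ (\sum_(k < Y.+1 | (0 < k)%N) c * (coprime_inv_sum F P k * \prod_(l <- ls) sum_omega_weight F l k))).
    rewrite natr_sum [leLHS]big_mkcond [leRHS]big_mkcond; apply: ler_sum => k _.
    rewrite /rk; case: posnP => [//|k0] /=; case: (leqP u) => [ukH|_] /=; last by rewrite mulr_ge0 // mulr_ge0.
    have kY : (k <= Y)%N by rewrite -ltnS ltn_ord.
    apply: le_trans (count_prime_values F T pls uls i0 k0 (zkN _ kY)) _.
    rewrite -/P [leRHS]mulrA; apply: ler_wpM2r (gp0 k) _ _ _; rewrite /c.
    have kr0 : (0 : F) < k%:R by rewrite ltr0n.
    have -> : 14 * (sqf_inv_sum P * coprime_inv_sum F P k) * (N%:R / (k * P)%:R) / i%:R * 2 ^+ T =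
       (14 * sqf_inv_sum P * (N%:R / P%:R) / i%:R * 2 ^+ T * coprime_inv_sum F P k) * k%:R^-1.
      by rewrite natrM; field; rewrite !gt_eqF.
    rewrite (_ : 14 * sqf_inv_sum P * (N%:R / P%:R) * (H%:R / u%:R) / i%:R * 2 ^+ T * coprime_inv_sum F P k =
       (14 * sqf_inv_sum P * (N%:R / P%:R) / i%:R * 2 ^+ T * coprime_inv_sum F P k) * (H%:R / u%:R)); last by ring.
    rewrite ler_wpM2l ?mulr_ge0 ?invr_ge0 ?exprn_ge0 //.
    by rewrite ler_pdivlMr // mulrC ler_pdivrMr // mulrC -natrM ler_nat.
  rewrite -mulr_sumr.
  have PY : (16 * P ^ 2 < Y)%N.
    apply: (@leq_trans u); last by rewrite /Y leq_pmull.
    rewrite ltnS (leq_trans _ zs) // (leq_trans _ (ltnW iz)) // (leq_trans _ iP) //.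
    by rewrite leq_mul2r leq_pmulr ?orbT // expn_gt0 C0.
  apply: le_trans (ler_wpM2l c0 (sum_tau_gw F pls uls PY)) _; rewrite -/P.
  set Gam := \prod_(l <- ls) _; have Gam0 : 0 <= Gam.
    rewrite /Gam big_seq prodr_ge0 // => l ll.
    by have l2 := prime_natr_ge2 F (allP pls _ ll); nra.
  have GE : sqf_inv_sum P * Gam <= P%:R ^+ 2 * pB.
    apply: le_trans (ler_wpM2r Gam0 (sqf_inv_sum_prod_le F pls uls)) _.
    rewrite /P natr_prod expr2 /Gam /pB -!big_split /= le_eqVlt; apply/orP; left; apply/eqP.
    apply: eq_big_seq => l ll; have l2 := prime_natr_ge2 F (allP pls _ ll).
    by field; rewrite gt_eqF //; lra.
  rewrite (_ : c * (4 * (Y%:R / P%:R) * Gam) = 56 * C%:R * H%:R * (N%:R / i%:R) * 2 ^+ T / P%:R ^+ 2 * (sqf_inv_sum P * Gam)); last first.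
    by rewrite /c /Y natrM; field; rewrite !gt_eqF.
  rewrite (_ : 56 * C%:R * H%:R * (N%:R / i%:R) * (2 ^+ T * pB) =
     56 * C%:R * H%:R * (N%:R / i%:R) * 2 ^+ T / P%:R ^+ 2 * (P%:R ^+ 2 * pB)); last first.
    by field; rewrite !gt_eqF.
  by rewrite ler_wpM2l // !mulr_ge0 ?invr_ge0 ?exprn_ge0.
apply: le_trans (_ : (P + s + \sum_(q < N.+1) Iq q + \sum_(n < N) Aq n
   + \sum_(k < Y.+1 | rk k) \sum_(m < (N %/ k).+1) h k m)%N%:R <= _); first by rewrite ler_nat.
have Psr : P%:R <= s%:R :> F by rewrite ler_nat.
rewrite 4!natrD [(3 * s)%:R]natrM; apply: lerD HB.
move: HIr HA; set x1 := (2 * a)%:R * _ / _; set x2 := 14 * _ * _; lra.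
Qed.
End F.

(** * Choice of the auxiliary primes and of the threshold *)

Section R.
Variable R : realType.

Lemma prod_le_expR (s : seq nat) (x y : nat -> R) :
  (forall l, l \in s -> 0 <= x l <= 1 + y l) -> \prod_(l <- s) x l <= expR (\sum_(l <- s) y l).
Proof.
move=> H; rewrite expR_sum; apply: ler_prod_seq => l /H/andP[-> h] /=.
exact: le_trans h (expR_ge1Dx _).
Qed.

(** The prime 2 is left out because (1 + x) (1 - 2 x + 3 x^2 / 2) <= 1 - x, for x = 1 / l, requires
    x <= 1/3. *)
Definition oddprimes n := [seq l <- iota 3 n | prime l].

(** Euler's argument through [harm_le_good]: if Q is the product of all primes up to z = 2^i, only d
    = 1 survives, so i is bounded by a multiple of [sqf_inv_sum Q], hence of exp(B). *)
Lemma sum_inv_oddprimes_unbounded (B : R) : exists n, B < \sum_(l <- oddprimes n) l%:R^-1.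
Proof.
have [//|nB] := pselect (exists n, B < \sum_(l <- oddprimes n) l%:R^-1); exfalso.
have {}nB n : \sum_(l <- oddprimes n) l%:R^-1 <= B.
  by rewrite leNgt; apply/negP => h; apply: nB; exists n.
have H i : i%:R / 4 <= 2 * expR B.
  pose z := (2 ^ i)%N; pose ls := [seq l <- iota 0 z.+1 | prime l].
  have pls : all prime ls by apply: filter_all.
  have uls : uniq ls by rewrite filter_uniq ?iota_uniq.
  pose Q := (\prod_(l <- ls) l)%N; have Q0 : (0 < Q)%N := prod_primes_gt0 pls.
  have h1 := le_trans (harm_exp R i) (harm_le_good R _ Q0).
  have h2 : \sum_(d < (2 ^ i).+1 | sqf_coprime Q d) d%:R^-1 <= 1 :> R.
    have z1 : (1 < z.+1)%N by rewrite ltnS expn_gt0.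
    rewrite (big_pred1 (Ordinal z1)) ?invr1 // => d; rewrite /sqf_coprime /= -val_eqE /=.
    apply/andP/eqP => [[sd cd]|->]; last by rewrite coprime1n /squarefree big_nil.
    apply/eqP/negPn/negP => d1; have d0 := squarefree_gt0 sd.
    have pd : prime (pdiv d).
      apply: pdiv_prime. by rewrite ltn_neqAle eq_sym d1.
    have : pdiv d \in ls.
      rewrite mem_filter pd mem_iota add0n ltnS /= (leq_trans (pdiv_leq d0)) //.
      by rewrite -ltnS ltn_ord.
    move/mem_dvd_prod => dQ; have : (pdiv d %| gcdn d Q)%N by rewrite dvdn_gcd pdiv_dvd.
    by rewrite (eqP cd) dvdn1 => /eqP p1; rewrite p1 in pd.
  have h3 : sqf_inv_sum R Q <= 2 * expR B.
    apply: le_trans (sqf_inv_sum_prod_le R pls uls) _.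
    have z1 : (1 < z.+1)%N by rewrite ltnS expn_gt0.
    have [z2|z2] := leqP z 1.
      rewrite (_ : ls = [::]) ?big_nil; last first.
        by rewrite /ls (_ : z = 1%N) //; lia.
      have : 1 + B <= expR B := expR_ge1Dx B.
      have := nB 0%N; rewrite /oddprimes /= big_nil; lra.
    rewrite (_ : ls = 2%N :: oddprimes (z - 2)); last first.
      by rewrite /ls /oddprimes (_ : z.+1 = (3 + (z - 2))%N) ?iotaD //; lia.
    rewrite big_cons; apply: ler_pM.
    - lra.
    - by apply: prodr_ge0 => l _; rewrite addr_ge0 ?invr_ge0.
    - lra.
    apply: le_trans (_ : expR (\sum_(l <- oddprimes (z - 2)) l%:R^-1) <= _); last by rewrite ler_expR.
    by apply: prod_le_expR => l _; rewrite addr_ge0 ?invr_ge0 //=.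
  have i0 : 0 <= sqf_inv_sum R Q by apply: sumr_ge0 => *; rewrite invr_ge0.
  have := ler_wpM2r i0 h2; move: h1; set S := \sum_(d < _ | _) _; rewrite -mulrA; lra.
have := H (Num.truncn (8 * expR B)).+1.
have := truncnS_gt (8 * expR B); lra.
Qed.

Lemma oddprimes_between (j : nat) : exists n : nat,
  3 * j%:R <= \sum_(l <- oddprimes n) (l%:R^-1 : R) <= 3 * j%:R + 1.
Proof.
have [n0 Hn0] := sum_inv_oddprimes_unbounded (3 * j%:R).
have ex : exists n, 3 * j%:R <= \sum_(l <- oddprimes n) l%:R^-1 :> R by exists n0; apply: ltW.
case: (ex_minnP ex) => [[|n] Hn nmin]; first by exists 0%N; rewrite Hn /= big_nil addr_ge0 // mulr_ge0.
exists n.+1; rewrite Hn /=; have : \sum_(l <- oddprimes n) l%:R^-1 <= 3 * j%:R :> R.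
  by rewrite leNgt; apply/negP => /ltW /nmin; rewrite ltnn.
rewrite /oddprimes -[n.+1]addn1 iotaD filter_cat big_cat /= => h.
apply: lerD => //; case: prime; rewrite ?big_nil // big_seq1 invf_le1 ?ltr0n // ler1n //.
Qed.

(** One of the two inequalities that make the threshold 4 S / 3 work; the other is exp(3/2) < 81/16.
    They come from 1 + x <= exp(x) at x = 1/8 and x = -1/16. *)
Lemma expR3_gt : 16 < expR (3 : R).
Proof.
have -> : (3 : R) = 24%:R * (1 / 8) by field.
rewrite expRM_natl; have h : 1 + 1 / 8 <= expR (1 / 8 : R) := expR_ge1Dx _.
apply: lt_le_trans (_ : (1 + 1 / 8) ^+ 24 <= _); last by rewrite lerXn2r ?nnegrE //; lra.
lra.
Qed.

Lemma expR32_lt : expR (3 / 2 : R) < 81 / 16.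
Proof.
have -> : (3 / 2 : R) = 24%:R * (1 / 16) by field.
rewrite expRM_natl; have h : 1 + - (1 / 16) <= expR (- (1 / 16) : R) := expR_ge1Dx _.
have e0 := expR_gt0 (1 / 16 : R).
have h2 : expR (1 / 16 : R) <= 16 / 15.
  by move: h; rewrite expRN => h; rewrite -[leLHS]invrK invf_ple ?posrE ?invr_gt0 //; lra.
apply: le_lt_trans (_ : _ <= (16 / 15) ^+ 24) _; first by rewrite lerXn2r ?nnegrE //; lra.
lra.
Qed.

Lemma expr_lt_eventually (c e : R) : 0 <= c -> c < 1 -> 0 < e ->
  exists n0, forall n, (n0 <= n)%N -> c ^+ n < e.
Proof.
move=> c0 c1 e0; have : `|c| < 1 by rewrite ger0_norm.
move=> /cvg_expr /cvgrPdist_lt /(_ _ e0) [n0 _ H]; exists n0 => n nn.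
have := H n nn; rewrite sub0r normrN ger0_norm ?exprn_ge0 //.
Qed.
End R.

Lemma leq_double_divn n : (0 < n %/ 24 -> n <= 48 * (n %/ 24))%N.
Proof. by have := divn_eq n 24; have := ltn_pmod n (isT : 0 < 24)%N; lia. Qed.

Section R.
Variable R : realType.

Lemma quotient_bound (n p lam i : R) : 0 <= p -> 0 < i ->
  n <= 6 * p * lam -> lam <= 48 * i -> n / i <= 288 * p.
Proof.
move=> p0 i0 np li; rewrite ler_pdivrMr //.
have p6 : 0 <= 6 * p by rewrite mulr_ge0.
have := ler_wpM2l p6 li; lra.
Qed.

(** Lets sqrt N disappear against N / log N: the hypotheses give s i <= 288 p, and 3456 is 12 times
    288. *)
Lemma root_bound (n p s i e : R) : 0 <= p -> 0 < i -> 0 < e -> 0 < s -> n / i <= 288 * p ->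
  i * i <= s -> s * s <= n -> 3456 / e <= i -> 3 * s <= e / 4 * p.
Proof.
move=> p0 i0 e0 s0; rewrite ler_pdivrMr // ler_pdivrMr // => np iis ss ei.
have si : s * i <= 288 * p.
  rewrite -(ler_pM2r s0).
  have b1 := ler_wpM2r (ltW i0) (le_trans ss np).
  have p1 : 0 <= 288 * p by lra.
  have := ler_wpM2l p1 iis; lra.
rewrite -(ler_pM2r i0); have := ler_wpM2r p0 ei; lra.
Qed.

(** With S between 3 j and 3 j + 1 and T = 4 j, the two expressions are at most exp(1/2) (16/81
    exp(3/2))^j and (16 / exp(3))^j, which tend to 0. *)
Lemma exists_oddprimes_weights (e1 e2 : R) : 0 < e1 -> 0 < e2 -> exists ls T,
  [/\ all prime ls, uniq ls,
   (2 / 3) ^+ T * \prod_(l <- ls) ((1 + l%:R^-1) * (1 - l%:R^-1 / 2)) <= e1 &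
   2 ^+ T * \prod_(l <- ls) ((1 + l%:R^-1) * (1 - 2 * l%:R^-1 + 3 / 2 * l%:R^-1 ^+ 2)) <= e2].
Proof.
move=> e10 e20; have E3 := expR3_gt R; have E32 := expR32_lt R.
have c10 : 0 <= 16 / 81 * expR (3 / 2 : R) by rewrite mulr_ge0 ?expR_ge0 //; lra.
have c11 : 16 / 81 * expR (3 / 2 : R) < 1 by lra.
have c20 : 0 <= 16 / expR (3 : R) by rewrite divr_ge0 ?expR_ge0.
have c21 : 16 / expR (3 : R) < 1 by rewrite ltr_pdivrMr ?expR_gt0 // mul1r.
have e10' : 0 < e1 / expR (1 / 2) by rewrite divr_gt0 ?expR_gt0.
have [n1 H1] := expr_lt_eventually c10 c11 e10'.
have [n2 H2] := expr_lt_eventually c20 c21 e20.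
pose j := maxn n1 n2; have {}H1 := H1 j (leq_maxl _ _); have {}H2 := H2 j (leq_maxr _ _).
have [n /andP[Lge Lle]] := oddprimes_between R j.
exists (oddprimes n), (4 * j)%N; set ls := oddprimes n in Lge Lle *.
have l3 l : l \in ls -> 0 <= (l%:R^-1 : R) <= 1 / 3.
  rewrite mem_filter mem_iota => /and3P[_ l3 _]; rewrite invr_ge0 ler0n /= mul1r.
  by rewrite lef_pV2 ?posrE ?ltr0n // ?ler_nat // (leq_trans _ l3).
split; [exact: filter_all|by rewrite filter_uniq ?iota_uniq| |].
- apply: (@le_trans _ _ ((16 / 81) ^+ j * expR (3 / 2 * j%:R + 1 / 2))); last first.
    rewrite expRD [3 / 2 * _]mulrC expRM_natl mulrA -exprMn -ler_pdivlMr ?expR_gt0 //; exact: ltW.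
  rewrite exprM (_ : (2 / 3) ^+ 4 = 16 / 81 :> R); last by field.
  rewrite ler_wpM2l ?exprn_ge0 //; apply: le_trans (_ : expR (\sum_(l <- ls) l%:R^-1 / 2) <= _).
    by apply: prod_le_expR => l /l3; nra.
  by rewrite ler_expR -mulr_suml; lra.
- apply: (@le_trans _ _ (16 ^+ j * expR (- (3 * j%:R)))); last first.
    by rewrite expRN [3 * _]mulrC expRM_natl -exprVn -exprMn ltW.
  rewrite exprM (_ : 2 ^+ 4 = 16 :> R); last by ring.
  rewrite ler_wpM2l ?exprn_ge0 //; apply: le_trans (_ : expR (\sum_(l <- ls) - l%:R^-1) <= _).
    by apply: prod_le_expR => l /l3 /andP[x0 x3]; apply/andP; split; nra.
  by rewrite ler_expR sumrN lerN2.
Qed.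

(** Each of the four terms gets e / 4. [H] is chosen first, then [ls] and [T], because the last term
    carries the factor [H], and only then is [N] taken large. The sieving level i is a 24th of log
    N. *)
Lemma small_order_density (a C : nat) (e : R) : (1 < a)%N -> (0 < C)%N -> 0 < e ->
  exists N0, forall N, (N0 <= N)%N ->
  (\sum_(q < N.+1) (prime q && small_order a C q))%:R <= e * (primepi N)%:R.
Proof.
move=> a1 C0 e0.
(* Here 12 is 2 times Chebyshev's constant 6, and 48 a / e is four times 12 a / e. *)
pose H := (Num.truncn (48 * a%:R / e)).+1.
have HE : 12 * a%:R / H%:R ^+ 2 <= e / 4.
  have h := truncnS_gt (48 * a%:R / e); rewrite -/H in h.
  have H1 : 1 <= H%:R :> R by rewrite ler1n.
  rewrite ler_pdivrMr; last by rewrite exprn_gt0 //; lra.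
  move: h; rewrite ltr_pdivrMr // => h.
  have : H%:R * e <= H%:R ^+ 2 * e by rewrite expr2 -mulrA ler_peMl // mulr_ge0 // ltW.
  lra.
have H0 : (0 : R) < H%:R by rewrite ltr0n.
have C0r : (0 : R) < C%:R by rewrite ltr0n.
(* In both denominators 14 and 56 are coefficients from [count_small_order], 288 comes from N / i <=
   288 pi(N), and 4 from the share e / 4. *)
have d1 : 0 < e / (4 * 14 * 288) by lra.
have d2 : 0 < e / (C%:R * H%:R) / (4 * 56 * 288).
  have : 0 < e / (C%:R * H%:R) by rewrite divr_gt0 // mulr_gt0.
  by move=> ?; lra.
have [ls [T [pls uls A B]]] := exists_oddprimes_weights d1 d2.
pose P := (\prod_(l <- ls) l)%N.
pose i0 := (16 * C ^ 2 * P ^ 2 + (Num.truncn (3456 / e)).+1)%N.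
exists (2 ^ (24 * i0))%N; move=> N NN.
set lam := trunc_log 2 N; pose i := (lam %/ 24)%N.
have ii : (i0 <= i)%N.
  by rewrite /i leq_divRL // mulnC trunc_log_max.
have i0p : (0 < i0)%N by rewrite /i0 addnS.
have ip : (0 < i)%N := leq_trans i0p ii.
have ir : (0 : R) < i%:R by rewrite ltr0n.
have lami : (lam <= 48 * i)%N := leq_double_divn ip.
have lam0 : (0 < lam)%N := leq_trans ip (leq_div lam 24).
have lamr : (0 : R) < lam%:R by rewrite ltr0n.
have g1 : (24 * i <= lam)%N by rewrite mulnC leq_divM.
have g2 : (16 * C ^ 2 * P ^ 2 <= i)%N by apply: leq_trans ii; apply: leq_addr.
have [s [sN zs Ps]] := @count_small_order R a C H ls T N i a1 C0 isT pls uls g1 g2.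
move/le_trans; apply.
have N1 : (1 < N)%N by apply: leq_trans NN; rewrite -{1}(expn0 2) ltn_exp2l // muln_gt0.
have cheb : N%:R <= 6 * (primepi N)%:R * lam%:R :> R by rewrite -!natrM ler_nat chebyshev.
set pn : R := (primepi N)%:R; rewrite -/pn in cheb; have pn0 : 0 <= pn by [].
have lamir : lam%:R <= 48 * i%:R :> R by rewrite -natrM ler_nat.
have Ni : N%:R / i%:R <= 288 * pn := quotient_bound pn0 ir cheb lamir.
have Ni0 : 0 <= N%:R / i%:R :> R by rewrite divr_ge0.
have t1 : (3 * s)%:R <= e / 4 * pn.
  have isq : (i ^ 2 <= s)%N.
    apply: leq_trans zs; apply: (@leq_trans ((2 ^ i) ^ 2)%N).
      by rewrite leq_exp2r // ltnW // ltn_expl.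
    by rewrite -expnM leq_exp2l // mulnC leq_mul2r orbT.
  have s0 : (0 : R) < s%:R by rewrite ltr0n (leq_trans _ isq) // expn_gt0 ip.
  have isr : i%:R * i%:R <= s%:R :> R by rewrite -natrM ler_nat mulnn.
  have ssr : s%:R * s%:R <= N%:R :> R by rewrite -natrM ler_nat mulnn.
  rewrite natrM; apply: (root_bound pn0 ir e0 s0 Ni isr ssr).
  apply: le_trans (ltW (truncnS_gt _)) _; rewrite ler_nat.
  by apply: leq_trans ii; apply: leq_addl.
have t2 : (2 * a)%:R * N%:R / (H%:R ^+ 2 * lam%:R) <= e / 4 * pn.
  apply: le_trans (ler_wpM2r pn0 HE).
  rewrite natrM ler_pdivrMr ?mulr_gt0 ?exprn_gt0 //.
  rewrite (_ : 12 * a%:R / H%:R ^+ 2 * pn * (H%:R ^+ 2 * lam%:R) = 2 * a%:R * (6 * pn * lam%:R)); last first.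
    by field; rewrite gt_eqF.
  by rewrite ler_wpM2l // mulr_ge0.
have t3 : 14 * (N%:R / i%:R) * ((2 / 3) ^+ T * \prod_(l <- ls) ((1 + l%:R^-1) * (1 - l%:R^-1 / 2))) <= e / 4 * pn.
  apply: le_trans (ler_wpM2l _ A) _; first by rewrite mulr_ge0.
  rewrite (_ : e / 4 * pn = 14 * (288 * pn) * (e / (4 * 14 * 288))); last by field.
  by apply: ler_wpM2r (ltW d1) _ _ _; exact: ler_wpM2l Ni.
have t4 : 56 * C%:R * H%:R * (N%:R / i%:R) * (2 ^+ T * \prod_(l <- ls) ((1 + l%:R^-1) * (1 - 2 * l%:R^-1 + 3 / 2 * l%:R^-1 ^+ 2))) <= e / 4 * pn.
  apply: le_trans (ler_wpM2l _ B) _; first by rewrite !mulr_ge0.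
  rewrite (_ : e / 4 * pn = 56 * C%:R * H%:R * (288 * pn) * (e / (C%:R * H%:R) / (4 * 56 * 288))); last first.
    by field; rewrite !gt_eqF.
  apply: ler_wpM2r (ltW d2) _ _ _; apply: ler_wpM2l Ni.
  by rewrite !mulr_ge0.
rewrite (_ : e * pn = e / 4 * pn + e / 4 * pn + e / 4 * pn + e / 4 * pn); last by field.
by apply: lerD t4; apply: lerD t3; apply: lerD.
Qed.
End R.

(** * Indices of subgroups *)

Section Index.
Variable V : zmodType.
Implicit Types (G H K : set V) (s t c : seq V).

Definition subg (H : set V) : Prop := H 0 /\ forall u v, H u -> H v -> H (u - v).

Lemma subgN H x : subg H -> H x -> H (- x).
Proof. by case=> H0 HB Hx; rewrite -sub0r; apply: HB. Qed.

Lemma subgD H x y : subg H -> H x -> H y -> H (x + y).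
Proof. by move=> sH Hx Hy; rewrite -[y]opprK; apply: (proj2 sH) => //; apply: subgN. Qed.

Lemma subgC H x y : subg H -> H (x - y) -> H (y - x).
Proof. by move=> sH /(subgN sH); rewrite opprB. Qed.

Lemma subg_trans H x y z : subg H -> H (x - y) -> H (y - z) -> H (x - z).
Proof. by move=> sH xy yz; rewrite -(subrK y x) -addrA; apply: subgD. Qed.

Lemma subgMn H x n : subg H -> H x -> H (x *+ n).
Proof.
move=> sH Hx; elim: n => [|n IH]; first by rewrite mulr0n; case: sH.
by rewrite mulrS; apply: subgD.
Qed.

Lemma subgI H K : subg H -> subg K -> subg (H `&` K).
Proof.
by move=> [H0 HB] [K0 KB]; split=> // u v [Hu Ku] [Hv Kv]; split; [apply: HB|apply: KB].
Qed.

(** Lists of representatives replace quotient groups: [sep] alone yields lower bounds for an index,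
    [cov] alone upper bounds. *)
Definition sep G H s :=
  [/\ uniq s, {in s, forall x, G x} & {in s &, forall x y, H (x - y) -> x = y}].
Definition cov G H c := forall v, G v -> exists2 r, r \in c & H (v - r).
(* [G : H] = n; neither G nor H is required to be a subgroup, nor H to lie in G. *)
Definition idx G H n := exists s, [/\ sep G H s, cov G H s & size s = n].

(** Sending x to a representative in [c] of the class of f x is injective on [s]. The comparisons of
    indices below reduce to this pigeonhole. *)
Lemma sep_cov_le (f : V -> V) G H G' H' s c :
  subg H' -> sep G H s -> cov G' H' c ->
  (forall x, G x -> G' (f x)) -> (forall x y, G x -> G y -> H' (f x - f y) -> H (x - y)) ->
  (size s <= size c)%N.
Proof.
move=> sH' [us Gs Hs] cc fG fH.
have [g Hg] : {g : V -> V & forall x, x \in s -> g x \in c /\ H' (f x - g x)}.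
  apply: (@choice _ _ (fun x r => x \in s -> r \in c /\ H' (f x - r))) => x.
  have [xs|] := boolP (x \in s); last by exists 0.
  by have [r rc rx] := cc _ (fG _ (Gs _ xs)); exists r.
rewrite -(size_map g); apply: uniq_leq_size.
  rewrite map_inj_in_uniq // => x y xs ys gxy; apply: (Hs x y) => //.
  apply: fH; [exact: Gs|exact: Gs|apply: (@subg_trans H' _ (g x)) => //].
    exact: (proj2 (Hg _ xs)).
  by rewrite gxy; apply: subgC => //; apply: (proj2 (Hg _ ys)).
by move=> _ /mapP[x xs ->]; apply: (proj1 (Hg _ xs)).
Qed.

Lemma sep_idx_le G H s n : subg H -> sep G H s -> idx G H n -> (size s <= n)%N.
Proof. by move=> sH ss [c [_ cc <-]]; exact: (@sep_cov_le id G H G H s c sH ss cc (fun _ h => h) (fun _ _ _ _ h => h)). Qed.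

Lemma idx_le (f : V -> V) G H G' H' a b : subg H' ->
  (forall x, G x -> G' (f x)) -> (forall x y, G x -> G y -> H' (f x - f y) -> H (x - y)) ->
  idx G H a -> idx G' H' b -> (a <= b)%N.
Proof. by move=> sH' fG fH [s [ss _ <-]] [c [_ cc <-]]; exact: (sep_cov_le sH' ss cc fG fH). Qed.

Lemma idx_inj G H a b : subg H -> idx G H a -> idx G H b -> a = b.
Proof.
move=> sH ia ib; apply/eqP; rewrite eqn_leq.
by rewrite !(@idx_le id G H G H) //.
Qed.

(** A longest separated list is also covering, since an uncovered element could be added to it. *)
Lemma sep_idx G H m : subg H -> (forall s, sep G H s -> (size s <= m)%N) ->
  exists2 n, (n <= m)%N & idx G H n.
Proof.
move=> sH ub; pose P n := `[< exists2 s, sep G H s & size s = n >].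
have ex : exists n, P n by exists 0%N; apply/asboolP; exists [::].
have bd n : P n -> (n <= m)%N by move/asboolP => [s /ub h <-].
case: (ex_maxnP ex bd) => n /asboolP[s ss sn] nmax; exists n.
  by rewrite -sn ub.
exists s; split=> // v Gv; apply: contrapT => nv.
have nvs r : r \in s -> ~ H (v - r) by move=> rs h; apply: nv; exists r.
have [us Gs Hs] := ss; have : P n.+1.
  apply/asboolP; exists (v :: s); last by rewrite /= sn.
  split=> /=.
  - rewrite us andbT; apply/negP => vs; apply: (nvs _ vs); rewrite subrr; by case: sH.
  - by move=> x; rewrite inE => /predU1P[->|/Gs].
  move=> x y; rewrite !inE => /predU1P[->|xs] /predU1P[->|ys] //.
  - by move/(nvs _ ys).
  - by move/(subgC sH)/(nvs _ xs).
  exact: Hs.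
by move/nmax; rewrite ltnn.
Qed.

Lemma cov_idx G H c : subg H -> cov G H c -> exists2 n, (n <= size c)%N & idx G H n.
Proof.
move=> sH cc; apply: sep_idx => // s ss.
by exact: (@sep_cov_le id G H G H s c sH ss cc (fun _ h => h) (fun _ _ _ _ h => h)).
Qed.

Lemma idx_gt0 G H n : G 0 -> idx G H n -> (0 < n)%N.
Proof. by move=> G0 [s [_ cs <-]]; have [r] := cs _ G0; case: s {cs}. Qed.

Lemma idx_mul G H K a b : subg G -> subg H -> subg K -> H `<=` G -> K `<=` H ->
  idx G H a -> idx H K b -> idx G K (a * b).
Proof.
move=> sG sH sK HG KH [s [[us Gs Hs] cs sa]] [t [[ut Ht Kt] ct tb]].
have inj : {in [seq (x, y) | x <- s, y <- t] &, forall p q, K ((p.1 + p.2) - (q.1 + q.2)) -> p = q}.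
  move=> [x y] [x' y'] /allpairsP[[u v] /= [us' vt [-> ->]]] /allpairsP[[u' v'] /= [us'' vt' [-> ->]]] /= h.
  have uu : u = u'.
    apply: Hs => //; have := subgD sH (KH _ h) (proj2 sH _ _ (Ht _ vt') (Ht _ vt)).
    by rewrite opprD [u + v + _]addrACA -[_ + (v' - v)]addrA -(opprB v v') subrr addr0.
  congr (_, _) => //; apply: Kt => //.
  by move: h; rewrite uu opprD addrACA subrr add0r.
exists [seq p.1 + p.2 | p <- [seq (x, y) | x <- s, y <- t]]; split; last first.
- by rewrite size_map size_allpairs sa tb.
- move=> v Gv; have [x xs xv] := cs _ Gv; have [y yt yv] := ct _ xv.
  exists (x + y); last by rewrite opprD addrA.
  by apply/mapP; exists (x, y) => //; apply: allpairs_f.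
split.
- rewrite map_inj_in_uniq ?allpairs_uniq // => [[x y] [x' y'] _ _ [-> ->]//|p q ps qs e].
  by apply: inj => //; rewrite e subrr; case: sK.
- move=> _ /mapP[p /allpairsP[[x y] [xs yt ->]] ->] /=.
  by apply: subgD => //; [apply: Gs|apply/HG/Ht].
- move=> _ _ /mapP[p ps ->] /mapP[q qs ->] /inj E; by rewrite (E ps qs).
Qed.

Lemma idx1_sub G H : subg H -> idx G H 1 -> G 0 -> G `<=` H.
Proof.
move=> sH [s [[us Gs Hs] cs s1]] G0; case: s s1 us Gs Hs cs => [|r []] // _ _ Gr _ cs v Gv.
have [r1] := cs _ Gv; have [r2] := cs _ G0; rewrite !inE => /eqP-> h0 /eqP-> hv.
by have := subg_trans sH hv (subgC sH h0); rewrite subr0.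
Qed.

Lemma sep_multiples p G H x : prime p -> subg G -> subg H -> G x -> ~ H x -> H (x *+ p) ->
  sep G H (mkseq (fun i => x *+ i) p).
Proof.
move=> pp sG sH Gx nHx Hp.
have nx i : (0 < i < p)%N -> ~ H (x *+ i).
  move=> ip Hi; apply: nHx; have /andP[i0 _] := ip.
  have [u v E _] := egcdnP p i0; rewrite (eqP (coprime_lt_prime pp ip)) in E.
  have <- : x *+ (u * i) - x *+ (v * p) = x by rewrite E mulrnDr mulr1n addrC addKr.
  apply: (proj2 sH); rewrite mulnC mulrnA; first exact: (subgMn u sH Hi).
  exact: (subgMn v sH Hp).
have inj i j : (i < p)%N -> (j < p)%N -> H (x *+ i - x *+ j) -> i = j.
  move=> ip jp hij; case: (ltngtP i j) => // ij.
    have /(nx (j - i)%N)[] : (0 < j - i < p)%N by lia.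
    by rewrite mulrnBr ?(ltnW ij) //; exact: (subgC sH hij).
  have /(nx (i - j)%N)[] : (0 < i - j < p)%N by lia.
  by rewrite mulrnBr ?(ltnW ij).
split.
- rewrite map_inj_in_uniq ?iota_uniq // => i j; rewrite !mem_iota !add0n => ip jp e.
  by apply: inj => //; rewrite e subrr; case: sH.
- by move=> _ /mapP[i _ ->]; exact: (subgMn i sG Gx).
move=> _ _ /mapP[i iI ->] /mapP[j jI ->] hij; congr (x *+ _).
by apply: inj => //; [move: iI|move: jI]; rewrite mem_iota add0n.
Qed.
End Index.

(** * Compact zero-dimensional groups *)

Section Top.
Variable X : topologicalZmodType.
Implicit Types (U V K : set X).

Definition osubg U := subg U /\ open U.

Lemma addl_continuous (a : X) : continuous (fun x : X => a + x).
Proof.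
move=> x; apply: (@continuous_comp _ _ _ (fun x => (a, x)) (fun x : X * X => x.1 + x.2)).
  by apply: cvg_pair => /=; [exact: cvg_cst|exact: cvg_id].
exact: add_continuous.
Qed.

Lemma add2_continuous (f g : X -> X) : continuous f -> continuous g -> continuous (fun x => f x + g x).
Proof.
move=> cf cg x; apply: (@continuous_comp _ _ _ (fun x => (f x, g x)) (fun x : X * X => x.1 + x.2)).
  by apply: cvg_pair => /=; [exact: cf|exact: cg].
exact: add_continuous.
Qed.

Lemma open_shift U (a : X) : open U -> open [set x | U (x - a)].
Proof.
move=> oU; have -> : [set x | U (x - a)] = (fun x => - a + x) @^-1` U.
  by apply/seteqP; split => x /=; rewrite addrC.
by apply: open_comp => // x _; apply: addl_continuous.
Qed.

Lemma osubgT : osubg setT.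
Proof. by split; [|exact: openT]. Qed.

Lemma osubgI U V : osubg U -> osubg V -> osubg (U `&` V).
Proof. by move=> [sU oU] [sV oV]; split; [apply: subgI|apply: openI]. Qed.

Lemma osubg_preimage (f : X -> X) U : continuous f -> {morph f : x y / x + y} ->
  osubg U -> osubg (f @^-1` U).
Proof.
move=> cf fD [sU oU]; split; last by apply: open_comp.
have f0 : f 0 = 0 by apply: (addrI (f 0)); rewrite -fD !addr0.
have fN x : f (- x) = - f x by apply: (addrI (f x)); rewrite -fD !subrr f0.
split=> /=; first by rewrite f0; case: sU.
by move=> u v Uu Uv /=; rewrite fD fN; apply: (proj2 sU).
Qed.

Lemma subg_open U V : osubg V -> subg U -> V `<=` U -> open U.
Proof.
move=> [sV oV] sU VU; rewrite openE => x Ux; rewrite /interior.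
apply: (@filterS _ _ _ [set y | V (y - x)]).
  by move=> y /VU Uy; rewrite -(subrK x y); apply: subgD.
by apply: open_nbhs_nbhs; split; [apply: open_shift|rewrite /= subrr; case: sV].
Qed.

Lemma osubg_closed U : osubg U -> closed U.
Proof.
move=> [sU oU]; rewrite -[U]setCK; apply: open_closedC; rewrite openE => x nUx; rewrite /interior.
apply: (@filterS _ _ _ [set y | U (y - x)]).
  move=> y Uyx Uy; apply: nUx; have := proj2 sU _ _ Uy Uyx.
  by rewrite opprB addrC subrK.
by apply: open_nbhs_nbhs; split; [apply: open_shift|rewrite /= subrr; case: sU].
Qed.

Hypothesis cX : compact [set: X].
Hypothesis zX : zero_dimensional X.

(** Compactness as a uniformity principle, used in place of finite subcovers: what holds locally in
    x and eventually in i holds eventually for all x at once. *)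
Lemma compact_uniform (I : Type) (F : set_system I) (P : I -> X -> Prop) : Filter F ->
  (forall x : X, exists (A : set X) (B : set I), [/\ nbhs x A, F B & forall y i, A y -> B i -> P i y]) ->
  F (fun i => forall x, P i x).
Proof.
move=> FF H; have /compact_near_coveringP/(_ I F P FF) K := cX.
apply: filterS (K _) => [i h x|x _]; first exact: h.
by have [A [B [xA FB AB]]] := H x; exists (A, B) => // -[y i] [/= Ay Bi]; apply: AB.
Qed.

Lemma nbhs_coset U (x : X) : osubg U -> nbhs x [set y | U (y - x)].
Proof.
by move=> [sU oU]; apply: open_nbhs_nbhs; split; [apply: open_shift|rewrite /= subrr; case: sU].
Qed.

Lemma osubg_idx U : osubg U -> exists n, idx setT U n.
Proof.
move=> oU; have sU := proj1 oU.
(* The filter generated by the lists that contain a given finite list: a statement holds eventually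
   if it holds for all larger lists. *)
pose F : set_system (seq X) := fun A => exists c : seq X, forall c' : seq X, {subset c <= c'} -> A c'.
have FF : Filter F.
  split; first by exists [::].
    move=> A B [c1 h1] [c2 h2]; exists (c1 ++ c2) => c' cc; split.
      by apply: h1 => x xc; apply: cc; rewrite mem_cat xc.
    by apply: h2 => x xc; apply: cc; rewrite mem_cat xc orbT.
  by move=> A B AB [c h]; exists c => c' /h /AB.
have [|c /(_ c (fun _ h => h)) cc] := @compact_uniform _ F (fun c x => exists2 r, r \in c & U (x - r)) FF.
  move=> x; exists [set y | U (y - x)], [set c : seq X | x \in c]; split.
  - exact: nbhs_coset.
  - by exists [:: x] => c'; apply; rewrite inE.
  by move=> y c Uy xc; exists x.
by have [|n _ iN] := @cov_idx _ setT U c sU; [move=> v _; apply: cc|exists n].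
Qed.

(** Van Dantzig's argument: take a clopen K containing 0 but not x. Its stabilizer H under
    translation lies in K because 0 does, and compactness of X makes H a neighbourhood of 0. *)
Lemma osubg_separates (x : X) : x != 0 -> exists2 U, osubg U & ~ U x.
Proof.
rewrite eq_sym => /zX[K [[oK cK] K0 nKx]].
pose H : set X := [set g | forall y, K y <-> K (y + g)].
have HK : H `<=` K by move=> g /(_ 0); rewrite add0r => -[h _]; apply: h.
exists H; last by move/HK.
have sH : subg H.
  split=> [y|u v Hu Hv y]; first by rewrite addr0.
  by rewrite (Hu y) (Hv (y + (u - v))) -addrA subrK.
split=> //.
have key (C : set X) y : open C -> C y -> exists (A : set X) (B : set X),
    [/\ nbhs y A, nbhs (0 : X) B & forall y' w, A y' -> B w -> C y' /\ C (y' + w)].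
  move=> oC Cy; have [[A B] /= [yA B0] AB] : nbhs ((y, 0) : X * X) [set p | C (p.1 + p.2)].
    by apply: (@add_continuous X (y, 0)); apply: open_nbhs_nbhs; split; rewrite //= addr0.
  exists (A `&` C), B; split=> //; first by apply: filterI => //; apply: open_nbhs_nbhs.
  by move=> y' w [Ay Cy'] Bw; split=> //; apply: (AB (y', w)).
have H0 : nbhs (0 : X) H.
  apply: (@compact_uniform _ (nbhs (0 : X)) (fun w y => K y <-> K (y + w))) => y.
  have [Ky|nKy] := pselect (K y).
    have [A [B [yA B0 AB]]] := key K y oK Ky.
    by exists A, B; split=> // y' w Ay Bw; have [] := AB y' w Ay Bw.
  have [A [B [yA B0 AB]]] := key (~` K) y (closed_openC cK) nKy.
  by exists A, B; split=> // y' w Ay Bw; have [] := AB y' w Ay Bw.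
rewrite openE => g Hg; rewrite /interior.
have h : nbhs g ((fun y => - g + y) @^-1` H) by apply: addl_continuous; rewrite /= addNr.
apply: filterS h => y /= Hy; have := subgD sH Hg Hy; by rewrite addrA subrr add0r.
Qed.

(** The image of [f] is compact, so a point outside it stays outside f(X) + V for some open subgroup
    V, and U = f(X) + V works. *)
Lemma closed_subg_proper (f : X -> X) : continuous f -> {morph f : x y / x + y} ->
  (exists x, forall z, f z <> x) -> exists U, [/\ osubg U, forall z, U (f z) & exists x, ~ U x].
Proof.
move=> cf fD [x nx].
have f0 : f 0 = 0 by apply: (addrI (f 0)); rewrite -fD !addr0.
have fN y : f (- y) = - f y by apply: (addrI (f y)); rewrite -fD !subrr f0.
pose F : set_system (set X) := fun A => exists2 U, osubg U & forall V, osubg V -> V `<=` U -> A V.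
have FF : Filter F.
  split; first by exists setT => //; apply: osubgT.
    move=> A B [U oU hU] [V oV hV]; exists (U `&` V); first exact: osubgI.
    by move=> W oW WUV; split; [apply: hU => // y /WUV[]|apply: hV => // y /WUV[]].
  by move=> A B AB [U oU hU]; exists U => // V oV VU; apply/AB/hU.
have [|V oV /(_ V oV (fun _ h => h)) HV] := @compact_uniform _ F (fun V z => osubg V -> ~ V (x - f z)) FF.
  move=> z; have xz : x - f z != 0 by rewrite subr_eq0; apply/eqP => h; apply: (nx z).
  have [U oU nU] := osubg_separates xz.
  exists [set y | U (f y - f z)], [set V : set X | V `<=` U]; split.
  - exact: (cf z _ (nbhs_coset (f z) oU)).
  - by exists U.
  move=> y V /= Uy VU oV /VU Ux; apply: nU.
  exact: (subg_trans (proj1 oU) Ux Uy).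
have sV := proj1 oV.
pose U : set X := [set y | exists z, V (y - f z)].
have sU : subg U.
  split; first by exists 0; rewrite f0 subrr; case: sV.
  move=> u v [a Va] [b Vb]; exists (a - b); rewrite fD fN.
  rewrite (_ : u - v - (f a - f b) = (u - f a) - (v - f b)); first exact: (proj2 sV).
  by rewrite !opprB [f b - f a]addrC addrACA [- v + f b]addrC.
exists U; split.
- split=> //; apply: (@subg_open U V) => // y Vy; exists 0; by rewrite f0 subr0.
- by move=> z; exists z; rewrite subrr; case: sV.
by exists x => -[z Vz]; apply: (HV z).
Qed.

(** Open subgroups are closed, so each point outside [O] has a neighbourhood disjoint from all late
    D k; compactness makes the stage uniform. *)
Lemma decreasing_osubg_inside (D : nat -> set X) (O : set X) : (forall k, osubg (D k)) ->
  (forall k, D k.+1 `<=` D k) -> open O -> (forall x, (forall k, D k x) -> O x) ->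
  exists k, D k `<=` O.
Proof.
move=> oD dD oO DO.
have dec j k : (j <= k)%N -> D k `<=` D j.
  by move=> /subnK <-; elim: (k - j)%N => // m IH x /dD; apply: IH.
have [|k _ /(_ k (leqnn k)) DkO] := @compact_uniform _ \oo (fun k x => D k x -> O x) _.
  move=> x; have [Ox|nOx] := pselect (O x).
    exists O, setT; split=> //; first exact: open_nbhs_nbhs.
    exact: filterT.
  have [k nDk] : exists k, ~ D k x.
    by apply: contrapT => h; apply/nOx/DO => k; apply: contrapT => hk; apply: h; exists k.
  exists (~` D k), [set i | (k <= i)%N]; split.
  - by apply: open_nbhs_nbhs; split=> //; apply: closed_openC; apply: osubg_closed.
  - exact: nbhs_infty_ge.
  by move=> y i nDy ki /(dec _ _ ki).
by exists k.
Qed.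
End Top.

(** * Growth of orbit windows *)

Lemma nonincreasing_stable (u : nat -> nat) : (forall k, u k.+1 <= u k)%N ->
  exists k0, forall k, (k0 <= k)%N -> u k = u k0.
Proof.
move=> du; pose P n := `[< exists k, u k = n >].
have ex : exists n, P n by exists (u 0%N); apply/asboolP; exists 0%N.
case: (ex_minnP ex) => n /asboolP[k0 kn] nmin; exists k0 => k kk; apply/eqP; rewrite eqn_leq.
apply/andP; split; last by rewrite kn; apply: nmin; apply/asboolP; exists k.
move: kk => /subnK <-; elim: (k - k0)%N => // m IH; exact: leq_trans (du _) IH.
Qed.

Section Dyn.
Variable X : topologicalZmodType.
Hypothesis cX : compact [set: X].
Implicit Types (U V G H K : set X) (s : seq X).

Definition endo (f : X -> X) := continuous f /\ {morph f : x y / x + y}.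
Definition surj (f : X -> X) := forall y, exists x, f x = y.

Lemma endo0 f : endo f -> f 0 = 0.
Proof. by move=> [_ fD]; apply: (addrI (f 0)); rewrite -fD !addr0. Qed.

Lemma endoN f x : endo f -> f (- x) = - f x.
Proof. by move=> ef; apply: (addrI (f x)); rewrite -(proj2 ef) !subrr endo0. Qed.

Lemma endoB f x y : endo f -> f (x - y) = f x - f y.
Proof. by move=> ef; rewrite (proj2 ef) endoN. Qed.

Lemma endo_comp f g : endo f -> endo g -> endo (f \o g).
Proof.
move=> [cf fD] [cg gD]; split; last by move=> x y /=; rewrite gD fD.
by move=> x; apply: continuous_comp; [apply: cg|apply: cf].
Qed.

Lemma endo_id : endo id.
Proof. by split=> // x; apply: cvg_id. Qed.

Lemma endo_iter f n : endo f -> endo (iter n f).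
Proof. by move=> ef; elim: n => [|n IH]; [apply: endo_id|apply: (endo_comp ef IH)]. Qed.

Lemma endo_sub f g : endo f -> endo g -> endo (fun x => f x - g x).
Proof.
move=> [cf fD] [cg gD]; split; last by move=> x y; rewrite fD gD opprD addrACA.
apply: add2_continuous => // x.
by apply: continuous_comp; [apply: cg|apply: opp_continuous].
Qed.

Lemma surj_comp f g : surj f -> surj g -> surj (f \o g).
Proof. by move=> sf sg y; have [z <-] := sf y; have [x <-] := sg z; exists x. Qed.

Lemma surj_iter f n : surj f -> surj (iter n f).
Proof. by move=> sf; elim: n => [|n IH]; [move=> y; exists y|apply: (surj_comp sf IH)]. Qed.

(** The default 0 is never reached when [H] is an open subgroup and X compact, by [idxnP]. *)
Definition idxn G H : nat := xget 0%N [set n | idx G H n].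

Lemma idxnP G U : osubg U -> idx G U (idxn G U).
Proof.
move=> oU; have [n iU] := osubg_idx cX oU.
have [|m _ im] := @sep_idx _ G U n (proj1 oU).
  by move=> s [us _ Hs]; apply: (sep_idx_le (proj1 oU) _ iU).
exact: (@xgetPex _ 0%N [set n | idx G U n] (ex_intro _ m im)).
Qed.

Lemma idxn_gt0 G U : osubg U -> G 0 -> (0 < idxn G U)%N.
Proof. by move=> /(idxnP G) i G0; apply: idx_gt0 i. Qed.

Lemma idxn_mul G H K : subg G -> osubg H -> osubg K -> H `<=` G -> K `<=` H ->
  idxn G K = (idxn G H * idxn H K)%N.
Proof.
move=> sG oH oK HG KH; apply: (idx_inj (proj1 oK) (idxnP G oK)).
by apply: idx_mul; [exact: sG|exact: (proj1 oH)|exact: (proj1 oK)|exact: HG|exact: KH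
  |exact: idxnP|exact: idxnP].
Qed.

Lemma idxn_le (f : X -> X) G H G' H' : endo f -> osubg H -> osubg H' ->
  (forall x, G x -> G' (f x)) -> subg G -> (forall x, G x -> H' (f x) -> H x) ->
  (idxn G H <= idxn G' H')%N.
Proof.
move=> ef oH oH' fG sG fH; apply: (idx_le (proj1 oH') fG _ (idxnP G oH) (idxnP G' oH')).
move=> x y Gx Gy; rewrite -endoB //; apply: fH; exact: (proj2 sG).
Qed.

Lemma sep_idxn_le G U s : osubg U -> sep G U s -> (size s <= idxn G U)%N.
Proof. by move=> oU ss; apply: (sep_idx_le (proj1 oU) ss (idxnP G oU)). Qed.

Definition window (f : X -> X) U k : set X := [set x | forall a, (a < k)%N -> U (iter a f x)].

Lemma window0 f U : window f U 0 = setT.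
Proof. by apply/seteqP; split. Qed.

Lemma windowS f U k : window f U k.+1 = window f U k `&` (iter k f @^-1` U).
Proof.
apply/seteqP; split => x /=.
  by move=> h; split => [a ak|]; apply: h => //; rewrite ltnS ltnW.
by move=> [h hk] a; rewrite ltnS leq_eqVlt => /predU1P[->|/h].
Qed.

Lemma windowSl f U k : window f U k.+1 = U `&` (f @^-1` window f U k).
Proof.
apply/seteqP; split => x /=.
  move=> h; split => [|a ak]; first exact: (h 0%N).
  by have := h a.+1 ak; rewrite iterSr.
by move=> [h hk] [|a] // /hk; rewrite iterSr.
Qed.

Lemma window1 f U : window f U 1 = U.
Proof. by rewrite windowSl window0 preimage_setT setIT. Qed.

Lemma window_osubg f U k : endo f -> osubg U -> osubg (window f U k).
Proof.
move=> ef oU; elim: k => [|k IH]; first by rewrite window0; apply: osubgT.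
rewrite windowS; apply: osubgI => //.
by apply: osubg_preimage => //; case: (endo_iter k ef).
Qed.

Lemma windowW f U k : window f U k.+1 `<=` window f U k.
Proof. by rewrite windowS => x []. Qed.

Lemma window_mono f U V k : U `<=` V -> window f U k `<=` window f V k.
Proof. by move=> UV x h a /h/UV. Qed.

Definition window_index f U k := idxn (window f U k) (window f U k.+1).

(** [f] maps each window into the previous one and is injective on the successive quotients: a point
    of U whose image lies in a window lies in the next window. Hence the indices stabilize and the
    growth rate is an integer. *)
Lemma window_index_nonincreasing f U k : endo f -> osubg U -> (window_index f U k.+1 <= window_index f U k)%N.
Proof.
move=> ef oU; apply: (@idxn_le f) => //; try exact: window_osubg.
- by move=> x; rewrite windowSl => -[].
- exact: (proj1 (window_osubg _ _ _)).
by move=> x Dx Dfx; rewrite windowSl; split=> //; move: Dx; rewrite windowSl => -[].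
Qed.

Lemma window_index_gt0 f U k : endo f -> osubg U -> (0 < window_index f U k)%N.
Proof.
by move=> ef oU; apply: idxn_gt0; [apply: window_osubg|case: (proj1 (window_osubg k ef oU))].
Qed.

Lemma idxnTT : idxn setT setT = 1%N.
Proof.
apply: (idx_inj (proj1 (osubgT X)) (idxnP setT (osubgT X))).
exists [:: 0]; split=> //; last by move=> v _; exists 0; rewrite ?inE.
by split=> // x y; rewrite !inE => /eqP-> /eqP->.
Qed.

Lemma idxn_DkS f U k : endo f -> osubg U ->
  idxn setT (window f U k.+1) = (idxn setT (window f U k) * window_index f U k)%N.
Proof.
move=> ef oU; apply: idxn_mul => //; try exact: window_osubg; last exact: windowW.
Qed.

Lemma idxn_Dk_ge f U k r : endo f -> osubg U -> (forall k, r <= window_index f U k)%N ->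
  (r ^ k <= idxn setT (window f U k))%N.
Proof.
move=> ef oU h; elim: k => [|k IH]; first by rewrite window0 idxnTT.
by rewrite idxn_DkS // expnSr leq_mul.
Qed.

Lemma idxn_Dk_le f U k r : endo f -> osubg U -> (forall k, window_index f U k <= r)%N ->
  (idxn setT (window f U k) <= r ^ k)%N.
Proof.
move=> ef oU h; elim: k => [|k IH]; first by rewrite window0 idxnTT.
by rewrite idxn_DkS // expnSr leq_mul.
Qed.

Lemma window_index_le0 f U k : endo f -> osubg U -> (window_index f U k <= window_index f U 0)%N.
Proof.
move=> ef oU; elim: k => // k IH; exact: leq_trans (window_index_nonincreasing k ef oU) IH.
Qed.

Lemma window_index0 f U : window_index f U 0 = idxn setT U.
Proof. by rewrite /window_index window0 window1. Qed.

(* exp(entropy of f) <= M, phrased through the growth of the indices of the orbit windows *)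
Definition growth_le f M := forall U r, osubg U ->
  (forall k, r ^ k <= idxn setT (window f U k))%N -> (r <= M)%N.

Section Rate.
Variables (f : X -> X) (M : nat).
Hypothesis (ef : endo f) (gf : growth_le f M).

(** The exponential growth rate of the indices of the windows, that is, the exponential of the
    entropy of [f] relative to the partition into cosets of [U]. *)
Definition rate U r := osubg U /\ exists k0, forall k, (k0 <= k)%N -> window_index f U k = r.

Lemma rate_ex U : osubg U -> exists r, rate U r.
Proof.
move=> oU; have [k0 h] := nonincreasing_stable (fun k => window_index_nonincreasing k ef oU).
by exists (window_index f U k0); split=> //; exists k0.
Qed.

Lemma window_index_ge_rate U r k : rate U r -> (r <= window_index f U k)%N.
Proof.
move=> [oU [k0 h]]; have [kk|/ltnW kk] := leqP k0 k; first by rewrite h.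
rewrite -(h k0 (leqnn _)) -(subnK kk); elim: (k0 - k)%N => // m IH.
exact: leq_trans (window_index_nonincreasing _ ef oU) IH.
Qed.

Lemma rate_le U r : rate U r -> (r <= M)%N.
Proof.
move=> rU; have [oU _] := rU; apply: (gf oU) => k; apply: idxn_Dk_ge => // j.
exact: window_index_ge_rate.
Qed.

Lemma max_rate : exists U r, rate U r /\ forall V t, rate V t -> (t <= r)%N.
Proof.
pose P n := `[< exists U, rate U n >].
have ex : exists n, P n.
  by have [r hr] := rate_ex (osubgT X); exists r; apply/asboolP; exists setT.
have bd n : P n -> (n <= M)%N by move/asboolP => [U]; apply: rate_le.
case: (ex_maxnP ex bd) => n /asboolP[U rU] nmax; exists U, n; split=> // V t rV.
by apply: nmax; apply/asboolP; exists V.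
Qed.

(* The relative indices c_k satisfy c_k t = r c_(k+1) for large k, where t <= r is the rate of V. *)
Lemma ratio_bounded U r V : rate U r -> (forall V t, rate V t -> (t <= r)%N) ->
  osubg V -> V `<=` U -> exists C, forall k, (idxn (window f U k) (window f V k) <= C)%N.
Proof.
move=> rU rmax oV VU; have [t rV] := rate_ex oV; have tr := rmax _ _ rV.
have [oU [k1 h1]] := rU; have [_ [k2 h2]] := rV.
pose c k := idxn (window f U k) (window f V k).
have mul k : (c k * window_index f V k = window_index f U k * c k.+1)%N.
  have oUk := window_osubg k ef oU; have oUk1 := window_osubg k.+1 ef oU.
  have oVk := window_osubg k ef oV; have oVk1 := window_osubg k.+1 ef oV.
  have sUk := proj1 oUk.
  rewrite /c /window_index -!idxn_mul //; try exact: windowW; exact: window_mono.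
have r0 : (0 < r)%N by rewrite -(h1 k1 (leqnn _)) window_index_gt0.
have step k : (maxn k1 k2 <= k)%N -> (c k.+1 <= c k)%N.
  rewrite geq_max => /andP[/h1 e1 /h2 e2]; have := mul k; rewrite e1 e2 => e.
  by rewrite -(leq_pmul2l r0) -e mulnC leq_mul2r tr orbT.
exists (\sum_(j < (maxn k1 k2).+1) c j)%N => k; rewrite -/(c k).
have le j : (j <= maxn k1 k2)%N -> (c j <= \sum_(j < (maxn k1 k2).+1) c j)%N.
  by move=> jm; rewrite (bigD1 (Ordinal (jm : j < (maxn k1 k2).+1)%N)) //= leq_addr.
have [km|mk] := leqP k (maxn k1 k2); first exact: le.
move: mk => /ltnW /subnK <-; elim: (k - _)%N => [|m IH]; first exact: le.
by rewrite addSn; apply: leq_trans (step _ (leq_addl _ _)) IH.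
Qed.
End Rate.

End Dyn.

(** Bernoulli's inequality (1 + 1 / b)^k >= 1 + k / b, cleared of denominators. *)
Lemma expn_bernoulli b k : ((b + k) * b ^ k <= b.+1 ^ k * b)%N.
Proof.
elim: k => [|k IH]; first by rewrite addn0 !expn0 muln1 mul1n.
rewrite !expnS; have := leq_mul (leqnn b.+1) IH; nia.
Qed.

Lemma expn_le_base a b K : (forall k, a ^ k <= K * b ^ k)%N -> (a <= b)%N.
Proof.
move=> H; rewrite leqNgt; apply/negP => ba.
have b0 : (0 < b)%N.
  by case: b ba H => // a0 /(_ 1%N); rewrite !expn1 muln0 leqNgt a0.
pose k := (K * b).+1; have h1 := expn_bernoulli b k.
have h2 : (b.+1 ^ k <= K * b ^ k)%N by apply: leq_trans (H k); rewrite leq_exp2r.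
have : ((b + k) * b ^ k <= K * b * b ^ k)%N.
  by apply: leq_trans h1 _; rewrite mulnAC leq_mul2r h2 orbT.
by rewrite leq_pmul2r ?expn_gt0 ?b0 // /k addnS ltnNge leq_addl.
Qed.

Section Dyn.
Variable X : topologicalZmodType.
Hypothesis cX : compact [set: X].
Hypothesis zX : zero_dimensional X.
Implicit Types (U V G H K : set X) (s : seq X).

Lemma osubg_avoid s : (forall x, x \in s -> x != 0) ->
  exists2 U, osubg U & forall x, x \in s -> ~ U x.
Proof.
elim: s => [_|x s IH h]; first by exists setT => //; apply: osubgT.
have [|U oU hU] := IH; first by move=> y ys; apply: h; rewrite inE ys orbT.
have [V oV nV] := osubg_separates cX zX (h x (mem_head _ _)).
exists (U `&` V); first exact: osubgI.
by move=> y; rewrite inE => /predU1P[->|/hU nU] [].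
Qed.

Lemma osubg_sep s : exists2 U, osubg U & {in s &, forall x y, U (x - y) -> x = y}.
Proof.
have [|U oU hU] := @osubg_avoid [seq d <- [seq x - y | x <- s, y <- s] | d != 0].
  by move=> d; rewrite mem_filter => /andP[].
exists U => // x y xs ys Uxy; apply/eqP; rewrite -subr_eq0; apply/negPn/negP => nxy.
by apply: (hU (x - y)) => //; rewrite mem_filter nxy; apply: allpairs_f.
Qed.

(** Two of the first C + 1 orbit points agree modulo [H], so from index C on the orbit has a period
    at most C, which divides C!. The exponents thus depend only on C, not on x. *)
Lemma eventually_periodic (f : X -> X) G H C x : endo f -> subg H ->
  (forall y, H y -> H (f y)) -> (forall s, sep G H s -> (size s <= C)%N) ->
  (forall i, G (iter i f x)) -> H (iter (C`! + C) f x - iter C f x).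
Proof.
move=> ef sH fH bd Gx.
have [i [m [m0 mC iC him]]] : exists i m, [/\ (0 < m)%N, (m <= C)%N, (i <= C)%N & H (iter (m + i) f x - iter i f x)].
  apply: contrapT => no.
  have ne i j : (i < j <= C)%N -> ~ H (iter j f x - iter i f x).
    move=> /andP[ij jC] h; apply: no; exists i, (j - i)%N; split; rewrite ?subnK //; lia.
  have ne' i j : (i <= C)%N -> (j <= C)%N -> H (iter i f x - iter j f x) -> i = j.
    move=> iC jC h; case: (ltngtP i j) => // ij.
      by case: (@ne i j); [rewrite ij|apply: subgC].
    by case: (@ne j i); [rewrite ij|].
  have : (size (mkseq (fun i => iter i f x) C.+1) <= C)%N.
    apply: bd; split.
    - rewrite map_inj_in_uniq ?iota_uniq // => i j; rewrite !mem_iota !add0n !ltnS => iC jC e.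
      by apply: ne' => //; rewrite e subrr; case: sH.
    - by move=> _ /mapP[i _ ->].
    move=> _ _ /mapP[i iI ->] /mapP[j jI ->] h; congr (iter _ f x).
    by apply: ne' => //; [move: iI|move: jI]; rewrite mem_iota add0n ltnS.
  by rewrite size_mkseq ltnn.
have him' t : H (iter (m + (t + i)) f x - iter (t + i) f x).
  elim: t => // t IH; rewrite addSn addnS !iterS -endoB //; exact: fH.
have hq q : H (iter (q * m + C) f x - iter C f x).
  elim: q => [|q IH]; first by rewrite subrr; case: sH.
  apply: (subg_trans (y := iter (q * m + C) f x)) => //.
  by have := him' (q * m + (C - i))%N; rewrite -addnA subnK // addnA mulSn.
have /dvdnP[q ->] : (m %| C`!)%N by apply: dvdn_fact; rewrite m0.
exact: hq.
Qed.

(** [S] induces a surjection from the cosets of [H'] to those of [H]. *)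
Lemma idxn_surj_le (S : X -> X) H H' : endo S -> surj S -> osubg H -> osubg H' ->
  (forall z, H' z -> H (S z)) -> (idxn setT H <= idxn setT H')%N.
Proof.
move=> eS sS oH oH' HS; have [s [[us _ Hs] _ <-]] := idxnP cX setT oH.
have [g Sg] := choice sS.
rewrite -(size_map g); apply: sep_idxn_le => //; split=> //.
  by rewrite map_inj_uniq // => x y e; rewrite -(Sg x) e Sg.
move=> _ _ /mapP[x xs ->] /mapP[y ys ->] /HS; rewrite endoB // !Sg => h.
by rewrite (Hs x y).
Qed.

Section One.
Variables (A : X -> X) (M : nat).
Hypotheses (eA : endo A) (gA : growth_le A M) (sA : surj A).
Hypothesis sAj : forall j, (0 < j)%N -> surj (fun x => iter j A x - x).

Lemma surj_iter_sub C : surj (fun x => iter (C`! + C) A x - iter C A x).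
Proof.
move=> y; have [z <-] := sAj (fact_gt0 C) y; have [x <-] := surj_iter C sA z.
by exists x; rewrite iterD.
Qed.

(** If two consecutive windows agreed, the window would be A-invariant of some finite index C; then
    A^(C! + C) - A^C would map X into it, hence into U, although it is onto. *)
Lemma window_strict U k : osubg U -> (exists x, ~ U x) -> exists2 y, window A U k y & ~ window A U k.+1 y.
Proof.
move=> oU [x0 nUx]; apply: contrapT => no.
have sub y : window A U k y -> window A U k.+1 y.
  by move=> hy; apply: contrapT => h; apply: no; exists y.
have oD := window_osubg k eA oU; have [n iD] := osubg_idx cX oD.
have [x xE] := surj_iter_sub n x0; apply: nUx; rewrite -xE.
have : window A U k (iter (n`! + n) A x - iter n A x).
  apply: (@eventually_periodic A setT) => //; first exact: (proj1 oD).
    by move=> y /sub; rewrite windowSl => -[].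
  by move=> s ss; apply: (sep_idx_le (proj1 oD) ss iD).
by move/sub; rewrite windowSl => -[].
Qed.

(** Torsion keeps multiplication by [p] from being onto, so p X lies in a proper open subgroup U.
    Every successive window of U then has index at least p in the previous one, and the growth is at
    least p^k. *)
Lemma torsion_le p (x : X) : prime p -> x != 0 -> x *+ p = 0 -> (p <= M)%N.
Proof.
move=> pp x0 xp.
have ep : endo (fun y : X => y *+ p).
  split; last by move=> y z; rewrite mulrnDl.
  elim: (p) => [|q IH]; first by move=> y; rewrite /continuous_at /= mulr0n; apply: cvg_cst.
  have -> : (fun y : X => y *+ q.+1) = (fun y => y + y *+ q) by apply/funext => y; rewrite mulrS.
  by apply: add2_continuous => // y; apply: cvg_id.
have [|U [oU pU nU]] := @closed_subg_proper X cX zX (fun y => y *+ p) (proj1 ep) (proj2 ep).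
  apply: contrapT => no.
  have sp (y : X) : exists z : X, z *+ p = y.
    by apply: contrapT => h; apply: no; exists y => z e; apply: h; exists z.
  have [V oV nV] := osubg_separates cX zX x0.
  have [s [[us _ Hs] cs sn]] := idxnP cX setT oV.
  have [g gp] := choice sp.
  have [r rs _] := cs 0 Logic.I.
  have key y z : y \in s -> z \in s -> forall e, e *+ p = 0 -> V (g y + e - g z) -> y = z.
    move=> ys zs e e0 h; apply: Hs => //; have := subgMn p (proj1 oV) h.
    by rewrite mulrnBl mulrnDl e0 addr0 !gp.
  (* If multiplication by p were onto, the representatives divided by p together with g r + x would
     be incongruent modulo V: one class too many. *)
  have : (size ((g r + x)%R :: map g s) <= idxn setT V)%N.
    apply: sep_idxn_le => //; split=> //=.
      rewrite map_inj_uniq ?us ?andbT => [|y z e]; last by rewrite -(gp y) e gp.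
      apply/negP => /mapP[z zs e]; have ezr : r = z.
        by apply: (key _ _ rs zs x xp); rewrite e subrr; case: (proj1 oV).
      by move/eqP: e; rewrite ezr -subr_eq0 addrC addKr (negbTE x0).
    move=> u v; rewrite !inE => /predU1P[->|/mapP[y ys ->]] /predU1P[->|/mapP[z zs ->]] // h.
    - case: nV; have ezr := key _ _ rs zs x xp h; move: h.
      by rewrite ezr addrAC subrr add0r.
    - have h' := subgC (proj1 oV) h.
      case: nV; have ezr := key _ _ rs ys x xp h'; move: h'.
      by rewrite ezr addrAC subrr add0r.
    - by congr g; apply: (key _ _ ys zs 0); rewrite ?mul0rn ?addr0.
  by rewrite /= size_map sn ltnn.
apply: (gA oU) => k; apply: idxn_Dk_ge => // {}k.
have [y Dy nDy] := window_strict k oU nU.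
have oD := window_osubg k.+1 eA oU; have sD := proj1 oD.
(* All of p X lies in U, so p y lies in every window and y has order p modulo the next one. *)
have ypD : window A U k.+1 (y *+ p).
  move=> a _; have := proj2 ep; have eAa := endo_iter a eA.
  suff -> : iter a A (y *+ p) = iter a A y *+ p by move=> _; apply: pU.
  by elim: (p) => [|q IH]; rewrite ?mulr0n ?endo0 // !mulrS (proj2 eAa) IH.
rewrite -[leqLHS](size_mkseq (fun i => y *+ i)); apply: sep_idxn_le => //.
exact: sep_multiples (proj1 (window_osubg k eA oU)) sD Dy nDy ypD.
Qed.
End One.
End Dyn.

Section Dyn.
Variable X : topologicalZmodType.
Hypothesis cX : compact [set: X].
Hypothesis zX : zero_dimensional X.
Implicit Types (U V G H K : set X) (s : seq X).

(* Fixed points are lifted through T - 1 again and again: if (T - 1) x ranges over a separated set and y over ys,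
   then the x + y are separated in the next window. *)
Lemma fixed_points_growth (T : X -> X) U ys k : endo T -> osubg U ->
  surj (fun x => T x - x) -> sep [set x | T x = x] U ys ->
  (size ys ^ k <= idxn setT (window T U k))%N.
Proof.
move=> eT oU sS [uy fy Uy].
have [g gS] := choice sS.
suff [L sL <-] : exists2 L, sep setT (window T U k) L & size L = (size ys ^ k)%N.
  by apply: sep_idxn_le => //; apply: window_osubg.
elim: k => [|k [L [uL _ HL] Lk]].
  exists [:: 0]; last by rewrite expn0.
  by split=> // x y; rewrite !inE => /eqP-> /eqP->.
have key x y x' y' : x \in L -> x' \in L -> y \in ys -> y' \in ys ->
    window T U k.+1 (g x + y - (g x' + y')) -> x = x' /\ y = y'.
  move=> xL xL' yy yy' h.
  have xx : x = x'.
    pose S z := T z - z; have eS : endo S := endo_sub eT (endo_id X).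
    apply: HL => //; have -> : x - x' = S (g x + y - (g x' + y')).
      have Ty : T y = y := fy _ yy; have Ty' : T y' = y' := fy _ yy'.
      by rewrite (endoB _ _ eS) !(proj2 eS) /S !gS Ty Ty' !subrr !addr0.
    apply: (proj2 (proj1 (window_osubg k eT oU))); last exact: windowW.
    by move: h; rewrite windowSl => -[].
  split=> //; apply: Uy => //; move: h; rewrite xx opprD addrACA subrr add0r windowSl => -[] //.
exists [seq g x + y | x <- L, y <- ys]; last by rewrite size_allpairs Lk expnSr.
have oD := window_osubg k.+1 eT oU.
split=> //.
- rewrite allpairs_uniq // => -[x y] [x' y'] /allpairsP[[a b] /= [aL bL [-> ->]]].
  move=> /allpairsP[[a' b'] /= [aL' bL' [-> ->]]] /= e.
  have [|-> -> //] := key a b a' b' aL aL' bL bL'.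
  by rewrite e subrr; case: (proj1 oD).
move=> _ _ /allpairsP[[a b] /= [aL bL ->]] /allpairsP[[a' b'] /= [aL' bL' ->]] h.
by have [-> ->] := key a b a' b' aL aL' bL bL' h.
Qed.

Section Two.
Variables (A B : X -> X) (M : nat).
Hypotheses (eA : endo A) (gA : growth_le A M) (sA : surj A).
Hypothesis sAj : forall j, (0 < j)%N -> surj (fun x => iter j A x - x).
Hypotheses (eB : endo B) (AB : forall x, A (B x) = B (A x)).

Lemma iter_comm i j x : iter i A (iter j B x) = iter j B (iter i A x).
Proof.
have c1 y : A (iter j B y) = iter j B (A y) by elim: j => // j IH; rewrite !iterS AB IH.
by elim: i => // i IH; rewrite !iterS IH c1.
Qed.

Lemma sep_window (f : X -> X) U s : endo f -> osubg U ->
  {in s &, forall x y, (forall k, window f U k (x - y)) -> x = y} ->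
  exists k, {in s &, forall x y, window f U k (x - y) -> x = y}.
Proof.
move=> ef oU h.
have : forall p : X * X, exists k, p \in [seq (x, y) | x <- s, y <- s] -> window f U k (p.1 - p.2) -> p.1 = p.2.
  move=> [x y]; have [e|ne] := pselect (x = y); first by exists 0%N.
  have [ps|] := boolP ((x, y) \in [seq (x, y) | x <- s, y <- s]); last by exists 0%N.
  have [[u v] /= [us vs [xu yv]]] := allpairsP ps.
  have [k nk] : exists k, ~ window f U k (x - y).
    apply: contrapT => no; apply: ne; apply: h; rewrite ?xu ?yv // => k.
    by apply: contrapT => nk; apply: no; exists k; rewrite xu yv.
  by exists k.
move=> /choice[K HK]; exists (\max_(p <- [seq (x, y) | x <- s, y <- s]) K p)%N => x y xs ys D.
have ps : (x, y) \in [seq (x, y) | x <- s, y <- s] by apply: allpairs_f.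
apply: (HK (x, y) ps) => /= a aK; apply: D; apply: leq_trans aK _.
exact: (@leq_bigmax_seq _ _ xpredT).
Qed.

(* A acts on the quotient of the infinite windows of U and V, a finite group, so that some A^(j + C) - A^C kills it;
   compactness replaces the infinite window of U by a finite one. *)
Lemma window_inside U r V : rate A U r -> (forall V t, rate A V t -> (t <= r)%N) ->
  osubg V -> V `<=` U -> exists C i0, forall x, window A U i0 x -> V (iter (C`! + C) A x - iter C A x).
Proof.
move=> rU rmax oV VU; have [C HC] := ratio_bounded cX eA rU rmax oV VU.
have oU := proj1 rU.
exists C.
have eS : endo (fun x => iter (C`! + C) A x - iter C A x) by apply: endo_sub; apply: endo_iter.
have [|||x Dx|i0 Hi0] := @decreasing_osubg_inside X cX (window A U) ((fun x => iter (C`! + C) A x - iter C A x) @^-1` V).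
- by move=> k; apply: window_osubg.
- by move=> k; apply: windowW.
- by apply: open_comp => [y _|]; [apply: (proj1 eS)|apply: (proj2 oV)].
- rewrite /preimage /=.
  pose G := [set x | forall k, window A U k x]; pose H := [set x | forall k, window A V k x].
  suff : H (iter (C`! + C) A x - iter C A x) by move=> /(_ 1%N); rewrite window1.
  have sH : subg H.
    split=> [k|u v Hu Hv k]; first by case: (proj1 (window_osubg k eA oV)).
    exact: (proj2 (proj1 (window_osubg k eA oV))).
  apply: (@eventually_periodic X A G H) => //.
  - by move=> y Hy k; have := Hy k.+1; rewrite windowSl => -[].
  - move=> s [us Gs Hs]; have [k sk] := sep_window eA oV Hs.
    apply: leq_trans (HC k); apply: sep_idxn_le => //; first exact: window_osubg.
    by split=> // y /Gs.
  move=> i k a ak; rewrite -iterD; apply: (Dx (a + i).+1); exact: leqnn.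
by exists i0.
Qed.

Definition window2 U k l := window B (window A U k) l.

Lemma window2P U k l x : window2 U k l x <-> forall a b, (a < k)%N -> (b < l)%N -> U (iter a A (iter b B x)).
Proof. by split=> [h a b ak bl|h b bl a ak]; apply: h. Qed.

Lemma window2_osubg U k l : osubg U -> osubg (window2 U k l).
Proof. by move=> oU; do 2 apply: window_osubg => //. Qed.

(** A step in the direction of A costs at most the index of U. A step in the direction of B costs at
    most the index of the windows of U meet B^-1 U in those of U, which [ratio_bounded] controls
    independently of k. *)
Lemma window2_growth U r : rate A U r -> (forall V t, rate A V t -> (t <= r)%N) ->
  exists n C, [/\ (0 < n)%N, (0 < C)%N & forall k l, (idxn setT (window2 U k l) <= n ^ k * C ^ l)%N].
Proof.
move=> rU rmax; have oU := proj1 rU.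
have oU1 : osubg (U `&` B @^-1` U).
  by apply: osubgI => //; apply: osubg_preimage => //; case: eB.
have [C HC] := ratio_bounded cX eA rU rmax oU1 (@subIsetl _ _ _).
exists (idxn setT U), C.+1; split=> //; first exact: idxn_gt0.
move=> k l; have oD := window_osubg k eA oU.
have hk : (idxn setT (window A U k) <= idxn setT U ^ k)%N.
  by apply: idxn_Dk_le => // j; rewrite -(window_index0 A); apply: window_index_le0.
have step j : (window_index B (window A U k) j.+1 <= C)%N.
  apply: (@leq_trans (window_index B (window A U k) 1)).
    by elim: j => // j IH; apply: leq_trans (window_index_nonincreasing cX _ eB oD) IH.
  apply: leq_trans (HC k); rewrite /window_index window1 windowSl window1 (_ : window A U k `&` _ = window A (U `&` B @^-1` U) k) //.
  apply/seteqP; split=> x /=.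
    by move=> [h1 h2] a ak; split; [apply: h1|have := h2 a ak; have := iter_comm a 1 x => /= ->].
  by move=> h; split=> a ak; have [h1 h2] := h a ak => //; have /= -> := iter_comm a 1 x.
rewrite /window2; case: l => [|l].
  by rewrite window0 idxnTT // expn0 muln1 expn_gt0 idxn_gt0.
elim: l => [|l IH].
  by rewrite window1 expn1 (leq_trans hk) // leq_pmulr.
by rewrite idxn_DkS // expnSr mulnA leq_mul // ltnW // ltnS.
Qed.

(** The subgroup V0 separating the points of s may be arbitrarily small, but it affects only the
    constant n^(1 + i0) C, which disappears as k grows. *)
Lemma fixed_points_bound : exists c, forall i j,
  surj (fun x => iter i A (iter j B x) - x) ->
  forall s, uniq s -> (forall x, x \in s -> iter i A (iter j B x) = x) -> (size s <= c ^ (i + j))%N.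
Proof.
have [U [r [rU rmax]]] := max_rate cX eA gA.
have [n [C [n0 C0 HW]]] := window2_growth rU rmax; have oU := proj1 rU.
exists (n * C)%N => i j sT s us fs; pose T x := iter i A (iter j B x).
have eT : endo T by apply: (endo_comp (endo_iter i eA) (endo_iter j eB)).
have [V0 oV0 sV0] := osubg_sep cX zX s.
have oV := osubgI oV0 oU.
have sV : sep [set x | T x = x] (V0 `&` U) s by split=> // x y xs ys [h _]; apply: sV0.
have [C' [i0 HS]] := window_inside rU rmax oV (@subIsetr _ _ _).
set S := fun x => iter (C'`! + C') A x - iter C' A x.
have eS : endo S by apply: endo_sub; apply: endo_iter.
have sS : surj S := surj_iter_sub sA sAj C'.
have TE m x : iter m T x = iter (m * i) A (iter (m * j) B x).
  by elim: m => // m IH; rewrite iterS IH /T -iter_comm -!iterD -!mulSn.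
apply: (@leq_trans (n ^ i * C ^ j)); last first.
  by rewrite expnMn leq_mul // leq_pexp2l // ?leq_addr ?leq_addl.
apply: (@expn_le_base _ _ (n ^ (1 + i0) * C)) => k.
apply: leq_trans (fixed_points_growth k eT oV sT sV) _.
(* As T^m = A^(m i) B^(m j), the T-window tests only points of this rectangle. *)
apply: (@leq_trans (idxn setT (window2 (V0 `&` U) (k * i + 1) (k * j + 1)))).
  apply: (@idxn_le X cX id) => //; [exact: endo_id|exact: window_osubg|exact: window2_osubg|].
  move=> x _ /window2P h m mk; rewrite TE; apply: h; rewrite addn1 ltnS leq_mul2r ltnW ?orbT //.
(* S is onto and carries a window of U, longer by i0 in the direction of A, into the window of V0
   meet U. *)
apply: (@leq_trans (idxn setT (window2 U (k * i + 1 + i0) (k * j + 1)))).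
  apply: (idxn_surj_le cX eS sS); [exact: window2_osubg|exact: window2_osubg|].
  move=> z /window2P h; apply/window2P => a b ak bl.
  have SE : iter a A (iter b B (S z)) = S (iter a A (iter b B z)).
    rewrite /S (endoB _ _ (endo_iter b eB)) (endoB _ _ (endo_iter a eA)) -!iter_comm -!iterD.
    by congr (iter _ A _ - iter _ A _); rewrite addnC.
  rewrite SE; apply: HS => a' a'i; rewrite -iterD; apply: h => //; lia.
apply: leq_trans (HW _ _) _.
rewrite expnMn !expnD !expn1 -!expnM.
rewrite [(i * k)%N]mulnC [(j * k)%N]mulnC; lia.
Qed.
End Two.
End Dyn.

(** * Actions, mixing and entropy *)

Section Action.
Variables (d : nat) (X : topologicalZmodType) (alpha : zvec d -> X -> X).
Hypothesis act : is_Zd_action alpha.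

Lemma act_endo n : endo (alpha n).
Proof. by case: act => _ _ c a; split. Qed.

Lemma act0 x : alpha 0 x = x. Proof. by case: act. Qed.
Lemma actD m n x : alpha (m + n) x = alpha m (alpha n x). Proof. by case: act. Qed.

Lemma act_iter n j x : iter j (alpha n) x = alpha (n *+ j) x.
Proof.
elim: j => [|j IH]; first by rewrite mulr0n act0.
by rewrite iterS IH mulrS actD.
Qed.

Lemma act_surj n : surj (alpha n).
Proof. by move=> y; exists (alpha (- n) y); rewrite -actD subrr act0. Qed.

End Action.

Section Mix.
Variables (R : realType) (X : topologicalZmodType).
Hypothesis cX : compact [set: X].
Hypothesis zX : zero_dimensional X.

Lemma open_sigma (U : set X) : open U -> <<s @open X >> U.
Proof. by move=> oU; apply: sub_sigma_algebra. Qed.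

(** The m cosets are disjoint, cover X and have equal measure; empty sets extend them to a sequence.
    The value +oo is excluded because the total is 1. *)
Lemma haar_osubg (mu : set X -> \bar R) U m : haar_prob mu -> osubg U -> idx setT U m ->
  exists2 r : R, mu U = r%:E & m%:R * r = 1.
Proof.
move=> [mu0 mu_ge0 mu_add muT mu_inv] oU [s [[us _ Hs] cs sm]].
have sU := proj1 oU.
pose C k : set X := [set nth 0 s k + a | a in U].
have CE k x : C k x <-> U (x - nth 0 s k).
  split; first by move=> [a Ua <-]; rewrite addrC addKr.
  by move=> h; exists (x - nth 0 s k) => //; rewrite addrC subrK.
pose F k := if (k < m)%N then C k else set0.
have mF k : <<s @open X >> (F k).
  rewrite /F; case: ifP => _; last by apply: open_sigma; apply: open0.
  apply: open_sigma; rewrite (_ : C k = [set x | U (x - nth 0 s k)]).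
    by apply: open_shift; case: oU.
  by apply/seteqP; split=> x /CE.
have tF : trivIset setT F.
  move=> i j _ _ [x []]; rewrite /F; case: ifP => // im /CE hi; case: ifP => // jm /CE hj.
  have e := subg_trans sU (subgC sU hi) hj.
  have : nth 0 s i = nth 0 s j by apply: Hs => //; rewrite mem_nth // sm.
  by move/eqP; rewrite nth_uniq ?sm // => /eqP.
have UF : \bigcup_k F k = setT.
  apply/seteqP; split=> // x _; have [r rs rx] := cs x Logic.I.
  exists (index r s) => //; rewrite /F -sm index_mem rs; apply/CE; by rewrite nth_index.
have muU0 : (0 <= mu U)%E by apply: mu_ge0; apply: open_sigma; case: oU.
have lim := mu_add F mF tF; rewrite UF muT in lim.
have sumE n : (m <= n)%N -> (\sum_(k < n) mu (F k) = \sum_(k < m) mu U)%E.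
  move=> mn; rewrite -(big_mkord xpredT (fun k => mu (F k))) (@big_cat_nat _ _ _ m) //=.
  rewrite [X in (_ + X)%E]big_nat [X in (_ + X)%E]big1 ?adde0; last first.
    by move=> k /andP[mk _]; rewrite /F ltnNge mk mu0.
  rewrite big_mkord; apply: eq_bigr => k _; rewrite /F ltn_ord mu_inv //.
  by apply: open_sigma; case: oU.
have lim2 : (fun n => \sum_(k < n) mu (F k))%E @ \oo --> (\sum_(k < m) mu U)%E.
  apply: cvg_near_cst; exists m => // n /= mn; exact: sumE.
have : (\sum_(k < m) mu U = 1)%E.
  exact: (@cvg_unique _ (@ereal_hausdorff R) _ _ _ _ lim2 lim).
have m0 : (0 < m)%N by rewrite -sm; have [r] := cs 0 Logic.I; case: (s).
move: muU0; case: (mu U) => [r| |] //.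
  move=> _; rewrite sumEFin sumr_const card_ord => h; exists r => //.
  by rewrite mulr_natl; exact: (EFin_inj h).
move=> _; case: (m) m0 => // k _; rewrite big_ord_recl.
rewrite addye // gt_eqF // (lt_le_trans (ltNyr 0)) // sume_ge0 // => i _; exact: leey.
Qed.
End Mix.

Section Mix.
Variables (R : realType) (X : topologicalZmodType).
Hypothesis cX : compact [set: X].
Hypothesis zX : zero_dimensional X.

(* If alpha^n - 1 is not onto, its image lies in a proper open subgroup U; then U is alpha^n-invariant and mixing
   forces mu(U) = mu(U)^2. *)
Lemma mixing_surj d (alpha : zvec d -> X -> X) (mu : set X -> \bar R) (n : zvec d) :
  is_Zd_action alpha -> haar_prob mu -> mixing alpha mu -> n != 0 ->
  surj (fun x => alpha n x - x).
Proof.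
move=> act hmu mix n0 y; apply: contrapT => no.
have en : endo (fun x => alpha n x - x) := endo_sub (act_endo act n) (endo_id X).
have [|U [oU TU [x0 nU]]] := closed_subg_proper cX zX (proj1 en) (proj2 en).
  by exists y => z e; apply: no; exists z.
have sU := proj1 oU; have [m im] := osubg_idx cX oU.
have [r muU mr] := haar_osubg hmu oU im.
have TjU j x : U (alpha (n *+ j) x - x).
  elim: j => [|j IH]; first by rewrite mulr0n act0 // subrr; case: sU.
  rewrite mulrS actD //; exact: (subg_trans sU (TU _) IH).
have oUs : <<s @open X >> U by apply: open_sigma; case: oU.
have [i ni] : exists i, n ord0 i != 0.
  apply: contrapT => h; move/eqP: n0; apply; apply/rowP => i; rewrite mxE.
  by apply/eqP/negPn/negP => hi; apply: h; exists i.
have rr e : 0 < e -> `|r - r * r| < e.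
  move=> e0; have [K HK] := mix U U oUs oUs e e0.
  (* A nonzero coordinate of n, multiplied by K + 1, exceeds K in absolute value. *)
  have := HK (n *+ K.+1); rewrite (_ : alpha (n *+ K.+1) @^-1` U `&` U = U) ?muU; last first.
    apply/seteqP; split=> x /=; first by case.
    move=> Ux; split=> //; rewrite -(subrK x (alpha _ x)); exact: subgD.
  apply; exists i; by rewrite mulmxnE -mulr_natr abszM natz absz_nat leq_pmull // absz_gt0.
have r2 : r = r * r.
  apply/eqP; rewrite -subr_eq0 -normr_le0 leNgt; apply/negP => h.
  by have := rr _ h; rewrite ltxx.
have r0 : r != 0 by apply/eqP => h; move: mr; rewrite h mulr0 => /esym/eqP; rewrite oner_eq0.
have r1 : r = 1 by apply: (mulfI r0); rewrite -r2 mulr1.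
have m1 : m = 1%N by move: mr; rewrite r1 mulr1 => /eqP; rewrite pnatr_eq1 => /eqP.
apply: nU; apply: (@idx1_sub _ setT U sU _ Logic.I x0 Logic.I).
by rewrite -m1.
Qed.

Lemma join_iterP (T : X -> X) (U : set X) (cos : seq (set X)) n :
  endo T -> osubg U -> (forall C, C \in cos -> forall x y, C x -> C y -> U (x - y)) ->
  forall C, C \in join_iter T cos n -> forall x y, C x -> C y -> window T U n (x - y).
Proof.
move=> eT oU hU; elim: n => [|n IH] C /=; first by rewrite window0.
move=> /allpairsP[[A B] /= [hA hB ->]] x y [Ax Bx] [Ay By].
rewrite windowS; split; first exact: (IH A).
rewrite /= (endoB _ _ (endo_iter n eT)); exact: (hU B).
Qed.

Lemma join_iter_cover (T : X -> X) (cos : seq (set X)) n :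
  (forall x, exists2 C, C \in cos & C x) -> forall x, exists2 C, C \in join_iter T cos n & C x.
Proof.
move=> h; elim: n => [|n IH] x; first by exists setT; rewrite ?inE.
have [A hA Ax] := IH x; have [B hB Bx] := h (iter n T x).
by exists (A `&` (iter n T @^-1` B)) => //; apply: (allpairs_f (fun A B => A `&` (iter n T @^-1` B))).
Qed.

(** Each member of [V] lies in one coset of [H], so points chosen from a subcover represent all
    cosets. *)
Lemma mincov_ge (V : seq (set X)) (H : set X) : osubg H ->
  (forall C, C \in V -> forall x y, C x -> C y -> H (x - y)) ->
  (forall x, exists2 C, C \in V & C x) -> (idxn setT H <= mincov V)%N.
Proof.
move=> oH VH cV.
have ex : exists k, `[< subcover_of_size V k >].
  exists (size V); apply/asboolP; exists (iota 0 (size V)); split.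
  - by rewrite size_iota.
  - by apply/allP => i; rewrite mem_iota.
  move=> x; have [C CV Cx] := cV x; exists (index C V); last by rewrite nth_index.
  by rewrite mem_iota index_mem.
have : subcover_of_size V (mincov V).
  case: (ex_minnP ex) => k /asboolP hk kmin.
  have : [set k | subcover_of_size V k /\ forall j, subcover_of_size V j -> (k <= j)%N] (mincov V).
    by apply: (@xgetPex _ 0%N _ (ex_intro _ k _)); split=> // j hj; apply: kmin; apply/asboolP.
  by case.
move=> [s [<- /allP sV sc]].
have [rep hrep] : {rep : nat -> X & forall i, (exists x, nth set0 V i x) -> nth set0 V i (rep i)}.
  apply: (@choice _ _ (fun i r => (exists x, nth set0 V i x) -> nth set0 V i r)) => i.
  by have [[x hx]|h] := pselect (exists x, nth set0 V i x); [exists x|exists 0].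
have [|n ns iN] := @cov_idx _ setT H (map rep s) (proj1 oH).
  move=> v _; have [i is_ iv] := sc v; exists (rep i); first exact: map_f.
  apply: (VH (nth set0 V i)) => //; first by apply: mem_nth; apply: sV.
  by apply: hrep; exists v.
by rewrite size_map in ns; rewrite (idx_inj (proj1 oH) (idxnP cX setT oH) iN).
Qed.

(** For the cover by cosets of U, members of the n-fold join lie in cosets of the window, so a
    subcover has at least r^n members and ln r is at most the entropy. *)
Lemma entropy_growth (T : X -> X) : endo T -> (top_entropy R T < +oo)%E ->
  exists M, growth_le T M.
Proof.
move=> eT hfin.
have [h0 hh0] : exists h0 : R, (top_entropy R T <= h0%:E)%E.
  by move: hfin; case: (top_entropy R T) => [r| |] // _; [exists r|exists 0; rewrite leNye].
exists (Num.truncn (expR h0)).+1 => U r oU hr.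
have [->//|r0] := posnP r.
have [s [_ cs _]] := idxnP cX setT oU.
pose cos := [seq [set y | U (y - x)] | x <- s].
have cosU C : C \in cos -> forall x y, C x -> C y -> U (x - y).
  move=> /mapP[z _ ->] x y /= hx hy; exact: (subg_trans (proj1 oU) hx (subgC (proj1 oU) hy)).
have cosc x : exists2 C, C \in cos & C x.
  by have [z zs zx] := cs x Logic.I; exists [set y | U (y - z)] => //; apply: map_f.
have ocos : open_cover cos.
  split=> [i ic|x].
    have : nth set0 cos i \in cos by apply: mem_nth.
    by move=> /mapP[z _ ->]; apply: open_shift; case: oU.
  by have [C Cc Cx] := cosc x; exists (index C cos); rewrite ?index_mem // nth_index.
have low : ((ln r%:R)%:E <= cover_entropy R T cos)%E.
  apply: le_ereal_inf_tmp => _ [A [N _ NA] <-].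
  apply: le_trans (_ : ((ln (mincov (join_iter T cos N.+1))%:R) / N.+1%:R)%:E <= _)%E; last first.
    by apply: ereal_sup_ubound; exists N => //; apply: NA => /=.
  have oD := window_osubg N.+1 eT oU.
  have hm : (idxn setT (window T U N.+1) <= mincov (join_iter T cos N.+1))%N.
    by apply: mincov_ge => //; [apply: join_iterP|apply: join_iter_cover].
  have m0 : (0 < mincov (join_iter T cos N.+1))%N by apply: leq_trans hm; apply: idxn_gt0.
  rewrite lee_fin ler_pdivlMr ?ltr0n // mulr_natr -lnXn ?ltr0n // -natrX.
  rewrite ler_ln ?posrE ?ltr0n ?expn_gt0 ?r0 // ler_nat; exact: leq_trans (hr _) hm.
have le : ((ln r%:R)%:E <= h0%:E)%E.
  apply: le_trans low (le_trans _ hh0); apply: ereal_sup_ubound; by exists cos.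
rewrite lee_fin -ler_expR lnK ?posrE ?ltr0n // in le.
rewrite -ltnS -(ltr_nat R); apply: le_lt_trans le (lt_trans (truncnS_gt _) _).
by rewrite ltr_nat.
Qed.
End Mix.

(** * Subgroups of prime index *)

Lemma iter_coprime_fixed (T : Type) (f : T -> T) (q e : nat) x : prime q -> (0 < e < q)%N ->
  iter q f x = x -> iter e f x = x -> f x = x.
Proof.
move=> pq eq fq fe; have /andP[e0 _] := eq.
have [u v E _] := egcdnP q e0; rewrite (eqP (coprime_lt_prime pq eq)) in E.
have per k n : iter n f x = x -> iter (k * n) f x = x.
  by move=> h; elim: k => // k IH; rewrite mulSn iterD IH.
have := per u e fe; rewrite E addn1 iterS per //.
Qed.

(** Every orbit has exactly [q] points, since a shorter period would by Bezout make a point fixed;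
    orbits are removed one by one. *)
Lemma prime_orbits_dvd (T : eqType) (f : T -> T) (q : nat) (s : seq T) : prime q -> injective f ->
  uniq s -> {in s, forall x, [/\ f x \in s, iter q f x = x & f x <> x]} -> (q %| size s)%N.
Proof.
move=> pq fi; have [n] := ubnP (size s); elim: n s => // n IH [|x t] // sn us hs.
set s := x :: t in sn us hs *; have q0 := prime_gt0 pq.
have itf i : iter i f x \in s.
  by elim: i => [|i IHi]; [rewrite mem_head|rewrite iterS; have [] := hs _ IHi].
have [_ fq nf] := hs x (mem_head _ _).
pose o := mkseq (fun i => iter i f x) q.
have uo : uniq o.
  have key i j : (i < j < q)%N -> iter i f x <> iter j f x.
    move=> /andP[ij jq] e; apply: nf.
    have inj_iter k y z : iter k f y = iter k f z -> y = z.
      by elim: k => // k IHk /fi/IHk.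
    apply: (@iter_coprime_fixed _ f q (j - i) x pq) => //; first by lia.
    by apply: (inj_iter i); rewrite -iterD subnKC ?(ltnW ij).
  rewrite map_inj_in_uniq ?iota_uniq // => i j; rewrite !mem_iota !add0n /= => iq jq e.
  by case: (ltngtP i j) => // ij; [case: (@key i j); rewrite ?ij|case: (@key j i); rewrite ?ij].
pose s' := [seq y <- s | y \notin o].
have sE : size s = (size s' + q)%N.
  rewrite -(count_predC (mem o) s) addnC !size_filter; congr (_ + _)%N.
  rewrite -size_filter -(size_mkseq (fun i => iter i f x) q); apply/perm_size/uniq_perm => //.
    by rewrite filter_uniq.
  move=> y; rewrite mem_filter; apply/andP/idP => [[]//|yo]; split=> //.
  by have /mapP[i _ ->] := yo.
rewrite sE dvdn_addr //; apply: IH.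
- by move: sn; rewrite sE; lia.
- by rewrite filter_uniq.
move=> y; rewrite mem_filter => /andP[yo /hs[fy fqy nfy]]; split=> //.
rewrite mem_filter fy andbT; apply: contra yo => /mapP[[|i] iq e].
  apply/mapP; exists q.-1; first by rewrite mem_iota add0n prednK /=.
  by apply: fi; rewrite e -iterS prednK.
apply/mapP; exists i; last by apply: fi; rewrite e.
by move: iq; rewrite !mem_iota !add0n /= => /ltnW.
Qed.

Section Finite.
Variable V : zmodType.
Implicit Types (H W : set V).

Lemma subg0 : subg [set (0 : V)].
Proof. by split=> // u v /= -> ->; rewrite subrr. Qed.

Lemma idx_extend p W H h x : prime p -> subg W -> subg H -> H `<=` W -> W x -> ~ H x -> x *+ p = 0 ->
  idx H [set 0] h -> exists H', [/\ subg H', H `<=` H', H' `<=` W & idx H' [set 0] (p * h)].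
Proof.
move=> pp sW sH HW Wx nHx xp iH; have p0 := prime_gt0 pp.
pose H' : set V := [set u | exists i, H (u - x *+ i)].
have HH' : H `<=` H' by move=> u Hu; exists 0%N; rewrite mulr0n subr0.
have modp i : x *+ (i %% p) = x *+ i.
  by rewrite {2}(divn_eq i p) mulrnDr mulnC mulrnA xp mul0rn add0r.
have negx i : x *+ (p - i %% p) = - (x *+ i).
  by rewrite mulrnBr ?xp ?sub0r ?modp // ltnW // ltn_mod.
have sH' : subg H'.
  split; first by apply: HH'; case: sH.
  move=> u v [i hi] [j hj]; exists (i + (p - j %% p))%N.
  rewrite mulrnDr negx (_ : u - v - (x *+ i - x *+ j) = (u - x *+ i) - (v - x *+ j)); first exact: (proj2 sH).
  by rewrite !opprB [x *+ j - x *+ i]addrC addrACA [- v + x *+ j]addrC.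
exists H'; split=> //.
  by move=> u [i hi]; rewrite -(subrK (x *+ i) u); apply: subgD => //; [apply: HW|apply: subgMn].
apply: (idx_mul sH' sH subg0 HH' _ _ iH); first by move=> u ->; case: sH.
exists (mkseq (fun i => x *+ i) p); split; last by rewrite size_mkseq.
  apply: sep_multiples => //; last by rewrite xp; case: sH.
  by exists 1%N; rewrite mulr1n subrr; case: sH.
move=> u [i hi]; exists (x *+ (i %% p)); last by rewrite modp.
by apply/mapP; exists (i %% p)%N => //; rewrite mem_iota add0n /= ltn_mod.
Qed.

(** Adjoining elements of W one at a time multiplies the order of the subgroup by p until W is
    reached; k bounds what is still missing. *)
Lemma idx_pgroup p W n : prime p -> subg W -> (forall x, W x -> x *+ p = 0) ->
  idx W [set 0] n -> exists a, n = (p ^ a)%N.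
Proof.
move=> pp sW Wp iW.
suff key k : forall H a, (n <= k + p ^ a)%N -> subg H -> H `<=` W -> idx H [set 0] (p ^ a) ->
    exists b, n = (p ^ b)%N.
  apply: (key n [set 0] 0%N (leq_addr _ _) subg0); first by move=> x ->; case: sW.
  exists [:: 0]; split=> //; first by split=> [//|x|x y]; rewrite !inE => /eqP-> // /eqP->.
  by move=> v ->; exists 0; rewrite ?inE //= subrr.
elim: k => [|k IH] H a nk sH HW iH.
all: have [WH|nWH] := pselect (W `<=` H).
1,3: exists a; rewrite (_ : W = H) in iW; [exact: (idx_inj subg0 iW iH)|by apply/seteqP].
all: have [x [Wx nHx]] : exists x, W x /\ ~ H x by
  apply: contrapT => h; apply: nWH => x Wx; apply: contrapT => nHx; apply: h; exists x.
all: have [H' [sH' HH' H'W iH']] := idx_extend pp sW sH HW Wx nHx (Wp _ Wx) iH.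
all: have pa : (0 < p ^ a)%N by rewrite expn_gt0 prime_gt0.
all: have p1 := prime_gt1 pp.
  have : (p * p ^ a <= n)%N.
    apply: (@idx_le _ id H' [set 0] W [set 0]) iH' iW => //; exact: subg0.
  by move: nk; rewrite add0n; nia.
apply: (IH H' a.+1) => //; last by rewrite expnS.
rewrite expnS; nia.
Qed.
End Finite.

Section Lattice.
Variables (d : nat) (L : set (zvec d)) (q : nat).
Hypotheses (sL : subgroupZ L) (iL : has_index L q).

Lemma lattice_pigeonhole (T : finType) (v : T -> zvec d) : (q < #|T|)%N ->
  exists t t', t <> t' /\ L (v t - v t').
Proof.
move=> qT; have [s [sq cs Hs]] := iL.
have ex t : exists i : 'I_q, L (v t - nth 0 s i).
  have [r rs Lr] := cs (v t); have rq : (index r s < q)%N by rewrite -sq index_mem.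
  by exists (Ordinal rq); rewrite /= nth_index.
have [f Hf] := choice ex.
have : ~~ injectiveb f.
  apply/negP => /injectiveP /leq_card; rewrite card_ord leqNgt qT //.
move=> /injectivePn[t [t' ne e]]; exists t, t'; split; first exact/eqP.
have Ht' := Hf t'; rewrite -e in Ht'; exact: (subg_trans sL (Hf t) (subgC sL Ht')).
Qed.

(** Translation by [e] permutes the cosets of [L], so in the sum over all representatives only q e
    remains. *)
Lemma lattice_index_mul (e : zvec d) : L (e *+ q).
Proof.
have [s [sq cs Hs]] := iL.
have ex (i : 'I_q) : exists j : 'I_q, L (nth 0 s i + e - nth 0 s j).
  have [r rs Lr] := cs (nth 0 s i + e); have rq : (index r s < q)%N by rewrite -sq index_mem.
  by exists (Ordinal rq); rewrite /= nth_index.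
have [f Hf] := choice ex.
have fi : injective f.
  move=> i j fij; apply: val_inj; apply: (Hs i j (ltn_ord i) (ltn_ord j)).
  have Hj := Hf j; rewrite -fij in Hj.
  by have := subg_trans sL (Hf i) (subgC sL Hj); rewrite opprD addrACA subrr addr0.
have S : L (\sum_(i < q) (nth 0 s i + e - nth 0 s (f i))).
  by apply: (big_ind L) => //; [case: sL|move=> u v; apply: (@subgD _ L)].
have E : \sum_(i < q) nth 0 s (f i) = \sum_(i < q) nth 0 s i.
  by apply/esym; rewrite (reindex_inj fi).
by move: S; rewrite sumrB big_split /= E sumr_const card_ord addrAC subrr add0r.
Qed.

End Lattice.

Section Final.
Variables (d : nat) (X : topologicalZmodType) (alpha : zvec d -> X -> X).
Hypothesis cX : compact [set: X].
Hypothesis zX : zero_dimensional X.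
Hypothesis act : is_Zd_action alpha.
Hypothesis sur : forall n, n != 0 -> surj (fun x => alpha n x - x).
Variables (i1 i2 : 'I_d) (M : nat).
Hypothesis i12 : i1 != i2.
Let e1 : zvec d := delta_mx 0 i1.
Let e2 : zvec d := delta_mx 0 i2.
Hypothesis gA : growth_le (alpha e1) M.

(** After a change of sign only the second coordinate of a short vector can be negative; replacing
    e2 by its opposite keeps all exponents natural numbers. *)
Let sgn (b : bool) : zvec d := if b then e2 else - e2.

Lemma short_nonzero i j b : (0 < i + j)%N -> e1 *+ i + sgn b *+ j != 0.
Proof.
move=> ij; apply/eqP => h.
have ent k : (e1 *+ i + sgn b *+ j) ord0 k = (k == i1)%:R *+ i + (if b then (k == i2)%:R else - (k == i2)%:R) *+ j.
  by rewrite mxE !mulmxnE /sgn; case: b {h} => /=; rewrite ?mxE /= ?mxE /=.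
have := ent i1; rewrite h mxE eqxx (negbTE i12) oppr0 if_same mul0rn addr0 natz => /eqP.
have := ent i2; rewrite h mxE eqxx eq_sym (negbTE i12) mul0rn add0r.
case: b {h ent} => /eqP; rewrite ?mulNrn ?eqr_oppLR ?oppr0 eq_sym; lia.
Qed.

Lemma short_vector (L : set (zvec d)) q w : subgroupZ L -> has_index L q -> (q < w.+1 ^ 2)%N ->
  exists i j b, [/\ (i <= w)%N, (j <= w)%N, (0 < i + j)%N & L (e1 *+ i + sgn b *+ j)].
Proof.
move=> sL iL qw.
pose v (t : 'I_w.+1 * 'I_w.+1) : zvec d := e1 *+ t.1 + e2 *+ t.2.
have [|t [t' [ne Lt]]] := lattice_pigeonhole sL iL v.
  by rewrite card_prod !card_ord mulnn.
wlog le : t t' ne Lt / (t'.1 <= t.1)%N.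
  move=> H; case: (leqP t'.1 t.1) => [|/ltnW] le; first exact: (H t t').
  by apply: (H t' t) => //; [move=> e; apply: ne|exact: (subgC sL Lt)].
case: t t' ne Lt le => [a b] [a' b'] /= ne; rewrite /v /= opprD addrACA => Lt le.
have aw := ltn_ord a; have bw := ltn_ord b; have bw' := ltn_ord b'.
have ne' : ~ (a = a' :> nat /\ b = b' :> nat).
  by move=> [h1 h2]; apply: ne; congr (_, _); apply: val_inj.
have [lb|/ltnW lb] := leqP b' b.
  exists (a - a')%N, (b - b')%N, true; split; try lia.
  by rewrite /sgn !mulrnBr.
exists (a - a')%N, (b' - b)%N, false; split; try lia.
by rewrite /sgn mulNrn !mulrnBr // opprB.
Qed.

Lemma iter_sub_surj j : (0 < j)%N -> surj (fun x => iter j (alpha e1) x - x).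
Proof.
move=> j0; have := @short_nonzero j 0 true; rewrite addn0 mulr0n addr0 => /(_ j0)/sur.
by move=> h y; have [x xE] := h y; exists x; rewrite act_iter.
Qed.

Lemma fixed_bound : exists c, (0 < c)%N /\ forall i j b, (0 < i + j)%N ->
  forall s, uniq s -> (forall x, x \in s -> alpha (e1 *+ i + sgn b *+ j) x = x) ->
  (size s <= c ^ (i + j))%N.
Proof.
have AB b x : alpha e1 (alpha (sgn b) x) = alpha (sgn b) (alpha e1 x).
  by rewrite -!(actD act) addrC.
have H b := fixed_points_bound cX zX (act_endo act e1) gA (act_surj act e1) iter_sub_surj (act_endo act (sgn b)) (AB b).
have [c1 H1] := H true; have [c2 H2] := H false.
exists (maxn c1 c2).+1; split=> // i j b ij s us fs.
have E x : iter i (alpha e1) (iter j (alpha (sgn b)) x) = alpha (e1 *+ i + sgn b *+ j) x.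
  by rewrite !(act_iter act) -(actD act).
have sT : surj (fun x => iter i (alpha e1) (iter j (alpha (sgn b)) x) - x).
  by move=> y; have [x xE] := sur (short_nonzero b ij) y; exists x; rewrite E.
have fs' x : x \in s -> iter i (alpha e1) (iter j (alpha (sgn b)) x) = x by rewrite E; apply: fs.
case: b sT fs' {E fs} => sT fs'.
  by apply: leq_trans (H1 _ _ sT _ us fs') _; rewrite leq_exp2r // leqW ?leq_maxl.
by apply: leq_trans (H2 _ _ sT _ us fs') _; rewrite leq_exp2r // leqW ?leq_maxr.
Qed.

(* Among the points moved by f take x of least order m = m' p. If m' x were fixed, f would act on x by
   translation by z = f x - x with q z = 0, and q-torsion is excluded. So f moves the p-torsion point m' x. *)
Lemma fixed_subgroup_trivial (Fx : set X) (f : X -> X) q N : prime q -> (M < q)%N -> subg Fx ->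
  (forall s, uniq s -> (forall x, x \in s -> Fx x) -> (size s <= N)%N) ->
  endo f -> (forall x, Fx x -> Fx (f x)) -> injective f -> (forall x, Fx x -> iter q f x = x) ->
  (forall p k, prime p -> (p <= M)%N -> (0 < k)%N -> (p ^ k <= N)%N -> ~~ (q %| p ^ k - 1)%N) ->
  forall x, Fx x -> f x = x.
Proof.
move=> pq Mq sF bd ef Ff fi fq ord x0 Fx0; apply: contrapT => nf0.
have tors p (x : X) : prime p -> x != 0 -> x *+ p = 0 -> (p <= M)%N.
  exact: (torsion_le cX zX (act_endo act e1) gA (act_surj act e1) iter_sub_surj).
have F0 x : Fx x -> exists2 m, (0 < m)%N & x *+ m = 0.
  move=> Fxx; have [[i j] [ij e]] : exists t : nat * nat, (t.1 < t.2)%N /\ x *+ t.1 = x *+ t.2.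
    apply: contrapT => no.
    have : (size (mkseq (fun i => (x *+ i)%R) N.+1) <= N)%N.
      apply: bd => [|_ /mapP[i _ ->]]; last exact: subgMn.
      rewrite map_inj_in_uniq ?iota_uniq // => i j _ _ e.
      by case: (ltngtP i j) => // ij; case: no; [exists (i, j)|exists (j, i)].
    by rewrite size_mkseq ltnn.
  exists (j - i)%N; first by rewrite subn_gt0.
  by rewrite mulrnBr ?(ltnW ij) // -e subrr.
pose P m := `[< (0 < m)%N /\ exists x, [/\ Fx x, f x <> x & x *+ m = 0] >].
have ex : exists m, P m.
  by have [m m0 xm] := F0 _ Fx0; exists m; apply/asboolP; split=> //; exists x0.
case: (ex_minnP ex) => m /asboolP[m0 [x [Fxx nfx xm]]] mmin.
have f0 := endo0 ef.
have m1 : (1 < m)%N.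
  by case: m m0 xm {mmin} => [//|[|//]] _; rewrite mulr1n => x0'; case: nfx; rewrite x0' f0.
have pp := pdiv_prime m1; set p := pdiv m in pp.
have /dvdnP[m' mE] := pdiv_dvd m; rewrite -/p in mE.
have m'0 : (0 < m')%N by case: m' mE m0 => // ->.
have fMn y n : f (y *+ n) = f y *+ n.
  by elim: n => [|n IH]; rewrite ?mulr0n // !mulrS (proj2 ef) IH.
have Fm : f (x *+ m') <> x *+ m'.
  move=> fy; pose z := f x - x.
  have Fz : Fx z by apply: (proj2 sF) => //; apply: Ff.
  have zm : z *+ m' = 0 by rewrite /z mulrnBl -fMn fy subrr.
  have fz : f z = z.
    apply: contrapT => nfz; have : (m <= m')%N by apply: mmin; apply/asboolP; split=> //; exists z.
    by rewrite mE leqNgt ltn_Pmulr // prime_gt1.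
  have itx k : iter k f x = x + z *+ k.
    elim: k => [|k IH]; first by rewrite mulr0n addr0.
    rewrite iterS IH (proj2 ef) fMn fz mulrS addrA; congr (_ + _).
    by rewrite /z addrC subrK.
  have zq : z *+ q = 0 by have := fq _ Fxx; rewrite itx => /(canRL (addKr _)); rewrite addNr.
  have z0 : z != 0 by rewrite subr_eq0; apply/eqP.
  by have := tors _ _ pq z0 zq; rewrite leqNgt Mq.
have xmp : x *+ m' *+ p = 0 by rewrite -mulrnA -mE.
have xm0 : x *+ m' != 0 by apply/eqP => h; apply: Fm; rewrite h f0.
have pM := tors _ _ pp xm0 xmp.
pose W : set X := [set y | Fx y /\ y *+ p = 0].
pose W' : set X := [set y | W y /\ f y = y].
have sW : subg W.
  split; first by split; [case: sF|rewrite mul0rn].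
  by move=> u v [Fu up] [Fv vp]; split; [apply: (proj2 sF)|rewrite mulrnBl up vp subrr].
have sW' : subg W'.
  split; first by split; [case: sW|].
  by move=> u v [Wu fu] [Wv fv]; split; [apply: (proj2 sW)|rewrite (endoB _ _ ef) fu fv].
have [|n nN [s [[us Ws Hs] cs sn]]] := @sep_idx _ W [set 0] N (@subg0 X).
  by move=> s [us Ws _]; apply: bd => // y /Ws[].
have ms y : W y <-> y \in s.
  split; last exact: Ws.
  by move=> /cs[r rs /= /eqP]; rewrite subr_eq0 => /eqP->.
have [a na] : exists a, n = (p ^ a)%N.
  by apply: (idx_pgroup pp sW) => [y []//|]; exists s.
(* The p-torsion and its part fixed by f both have p-power order, and the remaining points form
   orbits of length q; hence q divides p^a - p^b. *)
pose s1 := [seq y <- s | f y == y]; pose s2 := [seq y <- s | f y != y].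
have [b nb] : exists b, size s1 = (p ^ b)%N.
  apply: (@idx_pgroup X p W') => // [y [[]]//|]; exists s1; split=> //.
    split=> [|y|y z]; first by rewrite filter_uniq.
      by rewrite mem_filter => /andP[/eqP fy ys]; split=> //; apply/ms.
    by rewrite !mem_filter => /andP[_ ys] /andP[_ zs]; apply: Hs.
  move=> y [/ms ys fy]; exists y; first by rewrite mem_filter fy eqxx.
  by rewrite /= subrr.
have s12 : (size s = size s1 + size s2)%N.
  by rewrite !size_filter -(count_predC (fun y => f y == y) s).
have qs2 : (q %| size s2)%N.
  apply: (@prime_orbits_dvd _ f) => //; first by rewrite filter_uniq.
  move=> y; rewrite mem_filter => /andP[/eqP fy /ms Wy]; split=> //.
    rewrite mem_filter (inj_eq fi); apply/andP; split; first exact/eqP.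
    by apply/ms; split; [apply: Ff; case: Wy|rewrite -fMn; case: Wy => _ ->].
  by apply: fq; case: Wy.
have s20 : (0 < size s2)%N.
  have : x *+ m' \in s2.
    rewrite mem_filter; apply/andP; split; first exact/eqP.
    by apply/ms; split=> //; apply: subgMn.
  by case: (s2).
have ab : (b < a)%N.
  by rewrite -(ltn_exp2l _ _ (prime_gt1 pp)) -na -nb -sn s12 -addn1 leq_add2l.
have k0 : (0 < a - b)%N by rewrite subn_gt0.
have kN : (p ^ (a - b) <= N)%N.
  by apply: leq_trans nN; rewrite na leq_exp2l ?prime_gt1 // leq_subr.
apply: (negP (ord p (a - b)%N pp pM k0 kN)).
have : (q %| p ^ b * (p ^ (a - b) - 1))%N.
  rewrite mulnBr -expnD subnKC ?(ltnW ab) // muln1 -na -nb -sn s12 addKn //.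
rewrite Gauss_dvdr // coprimeXr // prime_coprime // dvdn_prime2 //.
by apply/eqP => qp; move: Mq; rewrite qp ltnNge pM.
Qed.

(** For w = floor(sqrt q) at most c^(2 w) points are fixed by L, and alpha^e has q-th power 1 on
    them because q e lies in L. The constant C = 4 c^2 comes from k <= 2 c w. *)
Lemma fix_prime_index : exists C, (0 < C)%N /\ forall q, prime q -> (M < q)%N ->
  (forall p, prime p -> (p <= M)%N -> ~~ small_order p C q) ->
  forall L, subgroupZ L -> has_index L q ->
  forall x, (forall n, L n -> alpha n x = x) -> forall e, alpha e x = x.
Proof.
have [c [c0 Hc]] := fixed_bound.
exists (4 * c ^ 2)%N; split; first by rewrite muln_gt0 expn_gt0 c0.
move=> q pq Mq small L sL iL x Fxx e.
have [w /andP[wq qw]] := sqrtn_ex q.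
have [i [j [b [iw jw ij Lij]]]] := short_vector sL iL qw.
pose Fx : set X := [set y | forall n, L n -> alpha n y = y].
have sF : subg Fx.
  split=> [n _|u v Fu Fv n Ln]; first exact: (endo0 (act_endo act n)).
  by rewrite (endoB _ _ (act_endo act n)) Fu ?Fv.
apply: (@fixed_subgroup_trivial Fx (alpha e) q (c ^ (2 * w))%N) => //.
- move=> s us Fs; apply: (@leq_trans (c ^ (i + j))%N).
    by apply: (Hc i j b ij s us) => y /Fs; apply.
  rewrite leq_pexp2l //; lia.
- exact: act_endo.
- by move=> y Fy n Ln; rewrite -(actD act) addrC (actD act) Fy.
- by move=> y z /(congr1 (alpha (- e))); rewrite -!(actD act) addNr !(act0 act).
- by move=> y Fy; rewrite (act_iter act); apply: Fy; apply: lattice_index_mul.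
move=> p k pp pM k0 pk; apply: contra (small p pp pM) => qk; apply/small_orderP; exists k; split=> //.
have kw : (k <= 2 * c * w)%N.
  (* The chain is 2^k <= p^k <= c^(2 w) <= 2^(2 c w). *)
  rewrite -(leq_exp2l _ _ (isT : 1 < 2)%N).
  apply: (@leq_trans (p ^ k)); first by rewrite leq_exp2r // prime_gt1.
  apply: leq_trans pk _; rewrite (_ : 2 * c * w = c * (2 * w))%N; last by lia.
  rewrite (expnM 2 c); have [->//|w0] := posnP (2 * w)%N.
  by rewrite leq_exp2r // ltnW // ltn_expl.
apply: (@leq_trans ((2 * c * w) ^ 2)); first by rewrite leq_exp2r.
by rewrite !expnMn leq_mul.
Qed.
End Final.

(** * Density *)

Lemma primepi_mono m n : (m <= n)%N -> (primepi m <= primepi n)%N.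
Proof.
move=> mn; rewrite /primepi -!(big_mkord xpredT (fun p => prime p : nat)).
by rewrite [leqRHS](@big_cat_nat _ _ _ m.+1) //= leq_addr.
Qed.

Lemma primepi_unbounded m : exists N0, forall N, (N0 <= N)%N -> (m <= primepi N)%N.
Proof.
suff [N0 h] : exists N0, (m <= primepi N0)%N.
  by exists N0 => N /primepi_mono; apply: leq_trans.
elim: m => [|m [N0 IH]]; first by exists 0%N.
have [p pN pp] := prime_above N0; exists p.
case: p pN pp => // p pN pp; rewrite /primepi big_ord_recr /= pp addn1 ltnS.
exact: (leq_trans IH (@primepi_mono N0 p pN)).
Qed.

Lemma has_rel_density_one (R : realType) (Q : set nat) :
  (forall e : R, 0 < e -> exists N0, forall N, (N0 <= N)%N ->
    (\sum_(q < N.+1) (prime q && ~~ `[< Q q >]))%:R <= e * (primepi N)%:R) ->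
  has_rel_density Q (1 : R).
Proof.
move=> H; rewrite /has_rel_density; apply/cvgrPdist_le => e e0.
have [N0 HN0] := H e e0; have [N1 HN1] := primepi_unbounded 1.
exists (maxn N0 N1) => // N /=; rewrite geq_max => /andP[/HN0 h /HN1 p0].
have piE : prime_count setT N = primepi N.
  rewrite /prime_count /primepi big_mkcond; apply: eq_bigr => q _.
  by rewrite asboolT // andbT; case: prime.
have sumE : (prime_count Q N + \sum_(q < N.+1) (prime q && ~~ `[< Q q >]) = primepi N)%N.
  rewrite /prime_count big_mkcond -big_split; apply: eq_bigr => q _ /=.
  by case: prime; case: asbool.
have pr : (0 : R) < (primepi N)%:R by rewrite ltr0n.
rewrite piE; have -> : 1 - (prime_count Q N)%:R / (primepi N)%:R =
   (\sum_(q < N.+1) (prime q && ~~ `[< Q q >]))%:R / (primepi N)%:R :> R.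
  rewrite -{1}(divff (lt0r_neq0 pr)) -mulrBl; congr (_ / _).
  by rewrite -{1}sumE natrD addrC addKr.
by rewrite ger0_norm ?divr_ge0 // ler_pdivrMr.
Qed.

(** The missing primes are those up to M and a finite union, over the primes p <= M, of sets of
    density zero. *)
Lemma has_rel_density_large_order (R : realType) (M C : nat) : (0 < C)%N ->
  has_rel_density [set q | [/\ prime q, (M < q)%N &
    forall p, prime p -> (p <= M)%N -> ~~ small_order p C q]] (1 : R).
Proof.
move=> C0; apply: has_rel_density_one => e e0; set Q := [set q | _].
pose e' := e / (2 * M.+1%:R); have Mr : (0 : R) < M.+1%:R by rewrite ltr0n.
have e'0 : 0 < e' by rewrite divr_gt0 // mulr_gt0.
have ex p : exists N0, forall N, (N0 <= N)%N -> (1 < p)%N ->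
    (\sum_(q < N.+1) (prime q && small_order p C q))%:R <= e' * (primepi N)%:R.
  case: (ltnP 1 p) => p1; last by exists 0%N.
  by have [N0 h] := small_order_density p1 C0 e'0; exists N0 => N /h.
have [N0 HN0] := choice ex.
have [N1 HN1] := primepi_unbounded (Num.truncn (2 * M.+1%:R / e)).+1.
exists (N1 + \sum_(p < M.+1) N0 p)%N => N NN.
have h1 : M.+1%:R <= e / 2 * (primepi N)%:R.
  have h := truncnS_gt (2 * M.+1%:R / e).
  have : (Num.truncn (2 * M.+1%:R / e)).+1%:R <= (primepi N)%:R :> R.
    by rewrite ler_nat; apply: HN1; apply: leq_trans NN; apply: leq_addr.
  move/(lt_le_trans h); rewrite ltr_pdivrMr // => h2; lra.
have h2 : (\sum_(p < M.+1 | prime p) \sum_(q < N.+1) (prime q && small_order p C q))%:R <= e / 2 * (primepi N)%:R.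
  rewrite natr_sum; apply: (@le_trans _ _ (\sum_(p < M.+1) e' * (primepi N)%:R)).
    rewrite big_mkcond; apply: ler_sum => p _; case: ifP => [pp|_]; last first.
      by rewrite mulr_ge0 // ltW.
    apply: HN0; last exact: prime_gt1.
    by apply: leq_trans NN; rewrite (bigD1 p) //= addnCA leq_addr.
  rewrite sumr_const card_ord -mulr_natl /e' le_eqVlt; apply/orP; left; apply/eqP.
  by field; rewrite gt_eqF.
have h3 : (\sum_(q < N.+1) (prime q && ~~ `[< Q q >]) <=
   M.+1 + \sum_(p < M.+1 | prime p) \sum_(q < N.+1) (prime q && small_order p C q))%N.
  rewrite exchange_big /=.
  apply: (@leq_trans (\sum_(q < N.+1) ((q < M.+1) + \sum_(p < M.+1 | prime p) (prime q && small_order p C q)))%N).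
    apply: leq_sum => q _; case pq: (prime q) => //=; case: asboolP => // nQ.
    case: (ltnP q M.+1) => //= Mq; rewrite add0n.
    have [p [pp pM so]] : exists p, [/\ prime p, (p <= M)%N & small_order p C q].
      apply: contrapT => no; apply: nQ; split=> // p pp pM; apply/negP => so; apply: no; by exists p.
    by rewrite (bigD1 (Ordinal (pM : (p < M.+1)%N))) //= so.
  by rewrite big_split leq_add2r /= sum_ltn_le.
apply: (@le_trans _ _ (M.+1 + \sum_(p < M.+1 | prime p) \sum_(q < N.+1) (prime q && small_order p C q))%N%:R).
  by rewrite ler_nat.
rewrite natrD; lra.
Qed.

Theorem theorem1p3 (R : realType) (d : nat) (X : topologicalZmodType)
  (alpha : zvec d -> X -> X) :
  (2 <= d)%N ->
  is_Zd_action alpha ->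
  compact [set: X] -> metrizable R X -> zero_dimensional X ->
  (exists mu : set X -> \bar R, haar_prob mu /\ mixing alpha mu) ->
  noetherian_action R alpha ->
  entropy_rank_one R alpha ->
  (exists (Q : set nat) (delta : R),
     [/\ (forall p, Q p -> prime p), has_rel_density Q delta, 0 < delta &
         finite_set [set Fix_count alpha L |
                     L in [set L | subgroupZ L /\ exists2 p, Q p & has_index L p]]])
  /\
  ((3 <= d)%N ->
   exists Q : set nat,
     [/\ (forall p, Q p -> prime p), has_rel_density Q (1 : R) &
         finite_set [set Fix_count alpha L |
                     L in [set L | subgroupZ L /\ exists2 p, Q p & has_index L p]]]).
Proof.
move=> d2 act cX _ zX [mu [hmu mix]] _ ent.
suff [Q [Qp Q1 Qf]] : exists Q : set nat,
     [/\ (forall p, Q p -> prime p), has_rel_density Q (1 : R) &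
         finite_set [set Fix_count alpha L |
                     L in [set L | subgroupZ L /\ exists2 p, Q p & has_index L p]]].
  by split=> [|_]; [exists Q, 1; split|exists Q].
have sur n : n != 0 -> surj (fun x => alpha n x - x) := mixing_surj cX zX act hmu mix.
pose i1 : 'I_d := Ordinal (ltnW d2); pose i2 : 'I_d := Ordinal d2.
have [M gA] := entropy_growth cX (act_endo act (delta_mx 0 i1)) (ent (delta_mx 0 i1)).
have [C [C0 HC]] := fix_prime_index cX zX act sur (isT : i1 != i2) gA.
exists [set q | [/\ prime q, (M < q)%N & forall p, prime p -> (p <= M)%N -> ~~ small_order p C q]].
split; [by move=> p []|exact: has_rel_density_large_order|].
(* All these L fix the same points as the whole of Z^d, so a single value remains. *)
apply: (@sub_finite_set _ _ [set Fix_count alpha setT]); last exact: finite_set1.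
move=> _ [L [sL [q [pq Mq so] iL]] <-] /=; congr count_set; apply/seteqP; split=> x /= hx n _; last exact: hx.
exact: (HC q pq Mq so L sL iL x hx n).
Qed.
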